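(* Let $n\ge5$, let $G=G_1\ast\dots\ast G_n$ be a free splitting of a group $G$ with every $G_i$ non-trivial, and let $\mathcal{C}_n$ be the associated $2$-dimensional simplicial complex of labelled trees defined in the context. Then $\mathcal{C}_n$ is simply connected.
   Context: Let $n\ge5$ and $G=G_1\ast\dots\ast G_n$ with each $G_i$ non-trivial. Write $H^{g}=g^{-1}Hg$. Tree shapes. Consider finite trees with $n$ ''non-trivial'' vertices named $1,\dots,n$, possibly some unnamed ''trivial'' vertices, and a distinguished basepoint, of one of the following shapes. Distinct letters denote distinct elements of $\{1,\dots,n\}$; in every case each index not mentioned is a leaf attached to the basepoint; $*$ denotes a trivial basepoint, and $u,u'$ further trivial vertices. $\alpha$: basepoint $*$ (all of $1,\dots,n$ are leaves at $*$). $\rho_{ij}$: basepoint $*$; $u$ adjacent to $*$; leaves $i,j$ at $u$. $\sigma_{i,jk,lm}$: basepoint $i$; $u,u'$ adjacent to $i$; leaves $j,k$ at $u$; leaves $l,m$ at $u'$. $\tau_{i,j,kl}$: basepoint $*$; path $*-i-j$; $u$ adjacent to $*$; leaves $k,l$ at $u$. $\beta_{i,j}$: basepoint $*$; path $*-i-j$. $\gamma_{i,jk}$: basepoint $i$; $u$ adjacent to $i$; leaves $j,k$ at $u$. $\delta_{i,j,k,lm}$: basepoint $i$; path $i-j-k$; $u$ adjacent to $i$; leaves $l,m$ at $u$. $\varepsilon_{i,j,k,l}$: basepoint $*$; paths $*-i-j$ and $*-k-l$. $A_i$: basepoint $i$ (all others are leaves at $i$). $B_{i,j,k}$: basepoint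 $i$; path $i-j-k$. $C_{i,j,k,l,m}$: basepoint $i$; paths $i-j-k$ and $i-l-m$. Labellings. A labelling of such a tree $T$ is a tuple $(H_1,\dots,H_n)$ of subgroups of $G$, with $H_i$ assigned to vertex $i$, such that each $H_i=G_i^{g_i}$ for some $g_i\in G$ and $G$ is the free product $H_1\ast\dots\ast H_n$; trivial vertices $v$ have $H_v=\{1\}$. Two labellings $(H_i)$, $(H_i')$ of $T$ are equivalent if for every vertex $v$ of $T$ (including trivial ones) there is $g_v\in G$ with $H_v'=H_v^{g_v}$, such that for every edge $e$ of $T$, with endpoint $o(e)$ closer to the basepoint and other endpoint $t(e)$, $g_{t(e)}g_{o(e)}^{-1}\in H_{o(e)}$. Collapses. An edge is collapsible if at least one endpoint is trivial; collapsing it means contracting it to a vertex carrying the group of the other endpoint. $T_2$ is a collapse of $T_1$ if it is obtained by successively collapsing one or more edges. The complex $\mathcal{C}_n$. Its $0$-simplices are the equivalence classes of labelled trees whose underlying tree has one of the shapes $\alpha$, $\rho_{ij}$, $\sigma_{i,jk,lm}$, $\tau_{i,j,kl}$, $\beta_{i,j}$, $\gamma_{i,jk}$, $\delta_{i,j,k,lm}$, $\varepsilon_{i,j,k,l}$, $A_i$, $B_{i,j,k}$, $C_{i,j,k,l,m}$. There is a $1$-simplex joining $[T_1]$ and $[T_2]$ if and only if some representative of $[T_2]$ is a collapse of some representative of $[T_1]$ (or vice versa). There is a $2$-simplex for each triple of pairwise adjacent $0$-simplices. *)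

(* Defs.v *)
From HB Require Import structures.
From Stdlib Require Import Relation_Operators.
From mathcomp Require Import all_boot all_order all_algebra.
From mathcomp Require Import all_classical all_reals all_analysis.
Set Implicit Arguments.
Unset Strict Implicit.
Unset Printing Implicit Defensive.
Import Order.TTheory GRing.Theory Num.Theory numFieldNormedType.Exports.
Local Open Scope classical_set_scope.
Local Open Scope ring_scope.

Record complex (V : choiceType) := Complex {
  simplex : set (set V);
  simplex_fin : forall s, simplex s -> finite_set s;
  simplex_neq0 : forall s, simplex s -> s !=set0;
  simplex_sub : forall s t, simplex s -> t `<=` s -> t !=set0 -> simplex t;
  simplex1 : forall v, simplex [set v] }.

Section Realization.
Variables (R : realType) (V : choiceType).

Record realization (K : complex V) := Point {
  bary :> V -> R;
  bary_ge0 : forall v, 0 <= bary v;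
  bary_supp : simplex K [set v | bary v != 0];
  bary_sum : \sum_(v \in [set v | bary v != 0]) bary v = 1 }.

Variable K : complex V.

Definition closed_simplex (s : set V) : set (realization K) :=
  [set x | [set v | x v != 0] `<=` s].

(* The coherent (weak) topology; [{ptws V -> R}] induces on each closed simplex
   its Euclidean topology. *)
Definition realization_open (U : set (realization K)) :=
  forall s, simplex K s -> exists2 W : set {ptws V -> R}, open W &
    closed_simplex s `&` U = closed_simplex s `&` [set x | W (bary x)].

Fact realization_openT : realization_open setT.
Proof. by move=> s _; exists setT => //; exact: openT. Qed.

Fact realization_openI : setI_closed realization_open.
Proof.
move=> A B oA oB s Ks; have [W oW AW] := oA s Ks; have [W' oW' BW'] := oB s Ks.
exists (W `&` W'); first exact: openI.
by rewrite setIIr AW BW' -setIIr.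
Qed.

Fact realization_open_bigU (I : Type) (f : I -> set (realization K)) :
  (forall i, realization_open (f i)) -> realization_open (\bigcup_i f i).
Proof.
move=> of_ s Ks.
have /choice[W WP] : forall i, exists W : set {ptws V -> R}, open W /\
    closed_simplex s `&` f i = closed_simplex s `&` [set x | W (bary x)].
  by move=> i; have [W ? ?] := of_ i s Ks; exists W.
exists (\bigcup_i W i); first by apply: bigcup_open => i _; case: (WP i).
rewrite setI_bigcupr (eq_bigcupr (fun i _ => (WP i).2)) -setI_bigcupr.
by congr (_ `&` _); apply/seteqP; split=> x [i].
Qed.

HB.instance Definition _ := gen_eqMixin (realization K).
HB.instance Definition _ := gen_choiceMixin (realization K).
HB.instance Definition _ := isOpenTopological.Build (realization K)
  realization_openT realization_openI realization_open_bigU.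

End Realization.

Section SimplyConnected.
Variables (R : realType) (X : topologicalType).

Definition path_connected := [set: X] !=set0 /\
  forall x y : X, exists p : R -> X,
    [/\ {within `[0, 1], continuous p}, p 0 = x & p 1 = y].

(* Null-homotopic relative to the endpoints 0 and 1. *)
Definition null_homotopic (p : R -> X) := exists h : R * R -> X,
  [/\ {within `[0, 1] `*` `[0, 1], continuous h},
      forall t, 0 <= t <= 1 -> h (t, 0) = p t,
      forall t, 0 <= t <= 1 -> h (t, 1) = p 0 &
      forall s, 0 <= s <= 1 -> h (0, s) = p 0 /\ h (1, s) = p 0].

Definition simply_connected := path_connected /\
  forall p : R -> X, {within `[0, 1], continuous p} -> p 0 = p 1 ->
    null_homotopic p.

End SimplyConnected.

Section Groups.
Local Open Scope group_scope.
Variable G : groupType.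

(* [x ^ g = g^-1 * (x * g)] *)
Definition conj_set (H : set G) (g : G) : set G := (fun x => x ^ g) @` H.

Definition reduced_word n (H : 'I_n -> set G) (w : seq ('I_n * G)) :=
  (forall p, p \in w -> H p.1 p.2 /\ p.2 <> 1) /\
  sorted (fun p q => p.1 != q.1) w.

(* [G] is the internal free product of the subgroups [H i]: normal form property. *)
Definition is_free_product n (H : 'I_n -> set G) :=
  (forall i, group_closed [in H i]) /\
  forall x : G, exists! w, reduced_word H w /\ \prod_(p <- w) p.2 = x.

End Groups.

(* The vertex named i is [inl i]; the unnamed, trivial vertices are the [inr a].
   The rooted tree is given by its parent map: the edges are the pairs
   {v, parent v} for v != base, and [parent v] is the endpoint closer to the
   basepoint.  The basepoint is its own parent. *)
Record btree (n : nat) := BTree {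
  ntriv : nat;
  base : 'I_n + 'I_ntriv;
  parent : 'I_n + 'I_ntriv -> 'I_n + 'I_ntriv }.

Definition vert n (T : btree n) : Type := ('I_n + 'I_(ntriv T))%type.

Definition is_tree n (T : btree n) :=
  parent (base T) = base T /\
  forall v : vert T, exists k, iter k (@parent n T) v = base T.

Definition is_iso n (S T : btree n) (f : vert S -> vert T) :=
  [/\ bijective f, forall i, f (inl i) = inl i, f (base S) = base T &
      forall v, f (parent v) = parent (f v)].

(* The constructors follow the list alpha, rho, sigma, tau, beta, gamma, delta,
   epsilon, A, B, C, with the indices in the order of the subscripts.  A trivial
   basepoint is t0.  A vertex not mentioned after [with] (in particular each
   index not mentioned) has the basepoint as its parent. *)
Section Shapes.
Variable n : nat.
Notation t0 := (inr ord0).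
Notation t1 := (inr ord_max).
Notation tree k b p := (@BTree n k b (p : 'I_n + 'I_k -> 'I_n + 'I_k)).

Inductive listed_tree : btree n -> Prop :=
| Alpha :
  listed_tree (tree 1 t0 (fun=> t0))
| Rho i j of uniq [:: i; j] :
  listed_tree (tree 2 t0 [eta (fun=> t0) with inl i |-> t1, inl j |-> t1])
| Sigma i j k l m of uniq [:: i; j; k; l; m] :
  listed_tree (tree 2 (inl i)
    [eta (fun=> inl i) with inl j |-> t0, inl k |-> t0, inl l |-> t1, inl m |-> t1])
| Tau i j k l of uniq [:: i; j; k; l] :
  listed_tree (tree 2 t0
    [eta (fun=> t0) with inl j |-> inl i, inl k |-> t1, inl l |-> t1])
| Beta i j of uniq [:: i; j] :
  listed_tree (tree 1 t0 [eta (fun=> t0) with inl j |-> inl i])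
| Gamma i j k of uniq [:: i; j; k] :
  listed_tree (tree 1 (inl i)
    [eta (fun=> inl i) with inl j |-> t0, inl k |-> t0])
| Delta i j k l m of uniq [:: i; j; k; l; m] :
  listed_tree (tree 1 (inl i)
    [eta (fun=> inl i) with inl k |-> inl j, inl l |-> t0, inl m |-> t0])
| Epsilon i j k l of uniq [:: i; j; k; l] :
  listed_tree (tree 1 t0
    [eta (fun=> t0) with inl j |-> inl i, inl l |-> inl k])
| ShapeA i :
  listed_tree (tree 0 (inl i) (fun=> inl i))
| ShapeB i j k of uniq [:: i; j; k] :
  listed_tree (tree 0 (inl i) [eta (fun=> inl i) with inl k |-> inl j])
| ShapeC i j k l m of uniq [:: i; j; k; l; m] :
  listed_tree (tree 0 (inl i)
    [eta (fun=> inl i) with inl k |-> inl j, inl m |-> inl l]).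

End Shapes.

Section LabelledTrees.
Local Open Scope group_scope.
Variables (G : groupType) (n : nat) (Gs : 'I_n -> set G).

Definition is_labelling (H : 'I_n -> set G) :=
  (forall i, exists g, H i = conj_set (Gs i) g) /\ is_free_product H.

Record ltree := LTree {
  tree :> btree n;
  label : 'I_n -> set G;
  treeP : is_tree tree;
  labelP : is_labelling label }.

Definition vgroup (X : ltree) (v : vert X) : set G :=
  match v with inl i => label X i | inr _ => [set 1] end.

(* Equivalence of labellings, up to an isomorphism of the underlying trees
   preserving names and basepoints. *)
Definition ltree_equiv (X Y : ltree) :=
  exists (f : vert X -> vert Y) (g : vert X -> G),
  [/\ is_iso f,
      forall v, vgroup (f v) = conj_set (vgroup v) (g v) &
      forall v, v <> base X -> vgroup (parent v : vert X) (g v * (g (parent v))^-1)].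

Definition is_trivial (X : ltree) (v : vert X) := exists a, v = inr a.

(* Y is obtained from X, up to isomorphism, by collapsing the edge
   {v, parent v}; the map f is the contraction of this edge. *)
Definition collapse_edge (X Y : ltree) (v : vert X) :=
  [/\ v <> base X, is_trivial v \/ is_trivial (parent v : vert X),
      label Y = label X &
      exists f : vert X -> vert Y,
      [/\ set_surj setT setT f,
          forall x y, f x = f y <->
            [\/ x = y, x = v /\ y = parent v | x = parent v /\ y = v],
          forall i, f (inl i) = inl i,
          f (base X) = base Y &
          forall x, x <> v -> f (parent x) = parent (f x)]].

Definition is_collapse : ltree -> ltree -> Prop :=
  clos_trans ltree (fun X Y => exists v, @collapse_edge X Y v).

Definition has_listed_shape (X : ltree) :=
  exists2 S : btree n, listed_tree S & exists f : vert S -> vert X, is_iso f.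

Definition ltree_class (X : ltree) : set ltree := [set Y | ltree_equiv X Y].

(* The 0-simplices, as the type of the elements of a set of classes. *)
Definition Cvertex : choiceType :=
  set_type (ltree_class @` [set X | has_listed_shape X]).

Definition Cadj (c d : Cvertex) := exists X Y : ltree,
  [/\ val c X, val d Y & is_collapse X Y \/ is_collapse Y X].

(* The cliques with at most three vertices. *)
Definition Csimplex (s : set Cvertex) :=
  [/\ s !=set0,
      exists a b c : Cvertex, s `<=` [set a; b; c] &
      forall c d, s c -> s d -> c <> d -> Cadj c d].

Fact Csimplex_fin s : Csimplex s -> finite_set s.
Proof. by case=> _ [a [b [c sabc]]] _; exact: sub_finite_set sabc _. Qed.

Fact Csimplex_neq0 s : Csimplex s -> s !=set0.
Proof. by case. Qed.

Fact Csimplex_sub s t : Csimplex s -> t `<=` s -> t !=set0 -> Csimplex t.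
Proof.
case=> _ [a [b [c sabc]]] sadj ts t0; split=> //.
  by exists a, b, c; exact: subset_trans sabc.
by move=> x y /ts sx /ts; exact: sadj.
Qed.

Fact Csimplex1 v : Csimplex [set v].
Proof.
split; first by exists v.
  by exists v, v, v => x ->; left; left.
by move=> x y -> ->.
Qed.

Definition Ccomplex : complex Cvertex :=
  Complex Csimplex_fin Csimplex_neq0 Csimplex_sub Csimplex1.

End LabelledTrees.

(* Main.v *)
(* A complex is simply connected as soon as its 1-skeleton is connected and every
   function e on its edges, with values in a group, such that e x y * e y z = e x z
   on triangles, is a coboundary: apply this to the values in the fundamental group.

   On C_n, the labellings of the star alpha are connected by the moves that preserve
   the class of shape A_i for some i, i.e. that conjugate the other factors by
   elements of H_i. The norm of a labelling is the sum, over p and q, of the number of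
   syllables separating the vertices fixed by G_p and G_q in the Bass-Serre tree of
   H_1 * ... * H_n. Two moves with distinct operating factors i, j and disjoint
   supports commute, and since n >= 5 the resulting square of labellings is filled by
   trees of shape C. At a peak of the norm, deleting the common support of the two
   moves makes at least one of them decrease the norm, so commuting squares replace
   the peak by a lower chain; hence the product of e along a closed chain is trivial
   and e is a coboundary on the stars. The potential extends to the shapes A, B, C without
   trivial vertices, and from there to all other vertices. *)
Require Import Defs.
From HB Require Import structures.
From Stdlib Require Import Relation_Operators.
From mathcomp Require Import all_boot all_order all_algebra finmap.
From mathcomp Require Import all_classical all_reals all_analysis.
From mathcomp Require Import zify lra.
Set Implicit Arguments.
Unset Strict Implicit.
Unset Printing Implicit Defensive.

(** * Free products *)

(** The Bass-Serre tree is never built: the number of separating syllables is the length of a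
    shortest word in a double coset of [H p] and [H q], and a move acts on it by a one-pass
    rewriting of that word whose emitted syllables are counted. Syllables are the unit because the
    factors are arbitrary groups, with no length of their own. The norm vanishes only on the star of
    [Gs], so chains of norm zero are constant. Plateaus are the main obstacle: a neighbour of a peak
    may have the same norm. Peaks are therefore removed starting from the end of the chain, where
    the next labelling is strictly lower. The number five comes from the square of two single-factor
    moves: two operating factors, two moved factors and a basepoint for the tree of shape C. General
    squares are cut into such squares. Using a potential instead of edge loops avoids simplicial
    approximation: the potential extends to all points of the realization, and an open-and-closed
    argument along a path concludes. Its consistency is checked only at trees with two trivial
    vertices, since every tree with one is a collapse of such a tree. *)

Section FreeProduct.
Local Open Scope classical_set_scope.
Local Open Scope group_scope.
Variables (G : groupType) (n : nat).
Implicit Types (H : 'I_n -> set G) (w : seq ('I_n * G)) (i j : 'I_n).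

Lemma conj_setP (A : set G) g x : conj_set A g x <-> A (x ^ g^-1).
Proof.
split=> [[y Ay <-]|Ax]; first by rewrite conjgK.
by exists (x ^ g^-1) => //; rewrite conjgKV.
Qed.

Lemma conj_setE (A : set G) g x : conj_set A g x = A (x ^ g^-1).
Proof. exact/propext/conj_setP. Qed.

Lemma conj_set1 (A : set G) : conj_set A 1 = A.
Proof. by apply/funext => x; rewrite conj_setE invg1 conjg1. Qed.

Lemma conj_setM (A : set G) g h : conj_set A (g * h) = conj_set (conj_set A g) h.
Proof. by apply/funext => x; rewrite !conj_setE invgM conjgM. Qed.

Definition subgp (A : set G) := [/\ A 1, (forall x y, A x -> A y -> A (x * y)) &
  forall x, A x -> A x^-1].

Lemma subgpP (A : set G) : subgp A <-> group_closed [in A].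
Proof.
split=> [[A1 AM AV]|[A1 AD]].
  split; first exact/mem_set.
  by move=> x y /set_mem Ax /set_mem Ay; apply/mem_set/AM => //; exact: AV.
have AV x : A x -> A x^-1.
  by move=> Ax; rewrite -div1g; apply/set_mem/AD => //; exact/mem_set.
split=> //; first exact: set_mem.
move=> x y Ax Ay; rewrite -[y]invgK; apply/set_mem/AD; apply/mem_set => //.
exact: AV.
Qed.

Lemma conj_set_id (A : set G) g : subgp A -> A g -> conj_set A g = A.
Proof.
move=> [A1 AM AV] Ag; apply/funext => x; rewrite conj_setE; apply/propext.
rewrite conjgE invgK; split=> [Ax|Ax]; last exact: AM (AM _ _ Ax (AV _ Ag)).
have -> : x = g^-1 * (g * (x * g^-1)) * g by rewrite mulKg mulgVK.
exact: AM (AM _ _ (AV _ Ag) Ax) Ag.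
Qed.

Lemma subgp_conj (A : set G) g : subgp A -> subgp (conj_set A g).
Proof.
move=> [A1 AM AV]; split=> [|x y|x]; rewrite !conj_setE.
- by rewrite conj1g.
- by rewrite conjMg; exact: AM.
- by rewrite conjVg; exact: AV.
Qed.

(** The conditions under which a letter of index [i] can be added in front of a reduced word, or
    behind it; both hold for the empty word. *)
Definition hdne (i : 'I_n) w := if w is q :: _ then i != q.1 else true.
Definition lstne w (i : 'I_n) := if w is q :: w' then (last q w').1 != i else true.

(** Recursive form of [reduced_word], suited to induction from the head of the word. *)
Fixpoint rword H (w : seq ('I_n * G)) : Prop :=
  match w with
  | [::] => True
  | p :: w' => [/\ H p.1 p.2, p.2 <> 1, hdne p.1 w' & rword H w']
  end.

Lemma rwordP H w : rword H w <-> reduced_word H w.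
Proof.
elim: w => [|p w IHw] /=; first by split=> // _; split.
split=> [[Hp p1 pw /IHw[Hw sw]]|[Hw sw]].
  split; last by case: w pw sw {IHw Hw} => //= q w -> /=.
  by move=> q; rewrite inE => /predU1P[->|/Hw].
have [Hp p1] := Hw _ (mem_head _ _).
split=> //; first by case: w sw {IHw Hw} => //= q w /andP[].
apply/IHw; split; last by case: w sw {IHw Hw} => //= q w /andP[].
by move=> q qw; apply: Hw; rewrite inE qw orbT.
Qed.

Definition wprod w := \prod_(p <- w) p.2.

Lemma wprod0 : wprod [::] = 1. Proof. exact: big_nil. Qed.
Lemma wprod_cons p w : wprod (p :: w) = p.2 * wprod w.
Proof. exact: big_cons. Qed.
Lemma wprod_cat w w' : wprod (w ++ w') = wprod w * wprod w'.
Proof. exact: big_cat. Qed.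

Lemma rword_cat H w w' : rword H w -> rword H w' ->
  (if w' is q :: _ then lstne w q.1 else true : bool) -> rword H (w ++ w').
Proof.
case: w => //= p w; elim: w p => [|q w IHw] p /=.
  by move=> [Hp p1 _ _] Hw' c; split=> //; case: w' {Hw'} c.
move=> [Hp p1 pq Hw] Hw' lst; split=> //.
exact: IHw.
Qed.

Lemma rword_catl H w w' : rword H (w ++ w') -> rword H w.
Proof.
elim: w => //= p w IHw [Hp p1 pw Hw]; split=> //; last exact: IHw.
by case: w pw {IHw Hw}.
Qed.

Lemma rword_catr H w w' : rword H (w ++ w') -> rword H w'.
Proof. by elim: w => //= p w IHw [_ _ _]; exact: IHw. Qed.

Definition winv w := rev [seq (p.1, p.2^-1) | p <- w].

Lemma winv_cat w w' : winv (w ++ w') = winv w' ++ winv w.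
Proof. by rewrite /winv map_cat rev_cat. Qed.

Lemma winv_cons p w : winv (p :: w) = rcons (winv w) (p.1, p.2^-1).
Proof. by rewrite /winv /= rev_cons. Qed.

Lemma wprod_winv w : wprod (winv w) = (wprod w)^-1.
Proof.
elim: w => [|p w IHw]; first by rewrite /winv /= wprod0 invg1.
by rewrite winv_cons -cats1 wprod_cat wprod_cons IHw wprod_cons wprod0 mulg1 invgM.
Qed.

Lemma winvK : involutive winv.
Proof.
move=> w; rewrite /winv map_rev revK -map_comp map_id_in// => -[i x] _ /=.
by rewrite invgK.
Qed.

Lemma size_winv w : size (winv w) = size w.
Proof. by rewrite size_rev size_map. Qed.

Lemma lstne_rcons w p i : lstne (rcons w p) i = (p.1 != i).
Proof. by case: w => //= q w; rewrite last_rcons. Qed.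

Lemma lstne_winv w i : lstne (winv w) i = hdne i w.
Proof. by case: w => //= p w; rewrite winv_cons lstne_rcons /= eq_sym. Qed.

Lemma hdne_winv w i : hdne i (winv w) = lstne w i.
Proof. by rewrite -lstne_winv winvK. Qed.

Lemma rword_winv H w : (forall i, subgp (H i)) -> rword H w -> rword H (winv w).
Proof.
move=> sH; elim: w => //= p w IHw [Hp p1 pw Hw].
rewrite winv_cons -cats1; apply: rword_cat; first exact: IHw.
  split=> //=; first by have [_ _] := sH p.1; exact.
  by move=> /eqP; rewrite invg_eq1 => /eqP.
by rewrite lstne_winv.
Qed.

Section Nf.
Variable H : 'I_n -> set G.
Hypothesis fpH : is_free_product H.

Lemma fp_subgp i : subgp (H i).
Proof. by apply/subgpP; case: fpH. Qed.
Let sH := fp_subgp.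

Lemma nf_ex (x : G) : exists w, rword H w /\ wprod w = x.
Proof. by have [_ /(_ x) [w [[/rwordP Hw wx] _]]] := fpH; exists w. Qed.

Lemma rword_uniq w w' : rword H w -> rword H w' -> wprod w = wprod w' -> w = w'.
Proof.
move=> Hw Hw' E; have [_ /(_ (wprod w)) [w0 [_ u]]] := fpH.
have <- : w0 = w by apply: u; split=> //; exact/rwordP.
by apply: u; split; [exact/rwordP|rewrite E].
Qed.

Definition nf x := projT1 (cid (nf_ex x)).

Lemma nf_rword x : rword H (nf x).
Proof. by rewrite /nf; case: cid => w []. Qed.

Lemma nfK x : wprod (nf x) = x.
Proof. by rewrite /nf; case: cid => w []. Qed.

Lemma nf_wprod w : rword H w -> nf (wprod w) = w.
Proof. by move=> Hw; apply: rword_uniq => //; [exact: nf_rword|exact: nfK]. Qed.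

Lemma nf1 : nf 1 = [::].
Proof. by rewrite -wprod0 nf_wprod. Qed.

Lemma nf_letter i x : H i x -> x <> 1 -> nf x = [:: (i, x)].
Proof.
move=> Hx x1; rewrite -[in LHS](mulg1 x) -wprod0 -(wprod_cons (i, x)).
by rewrite nf_wprod.
Qed.

Lemma nfV x : nf x^-1 = winv (nf x).
Proof.
rewrite -{1}(nfK x) -wprod_winv nf_wprod //.
by apply: rword_winv => //; exact: nf_rword.
Qed.

Lemma fp_disjoint i j x : H i x -> H j x -> i != j -> x = 1.
Proof.
move=> Hi Hj ij; apply: contrapT => x1.
have := nf_letter Hi x1; rewrite (nf_letter Hj x1) => -[] ji.
by rewrite ji eqxx in ij.
Qed.

End Nf.

Lemma is_free_productP H : is_free_product H <->
  [/\ forall i, subgp (H i), (forall x, exists w, rword H w /\ wprod w = x) &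
    forall w w', rword H w -> rword H w' -> wprod w = wprod w' -> w = w'].
Proof.
split=> [fpH|[sH ex un]].
  by split; [exact: fp_subgp|exact: nf_ex|exact: rword_uniq].
split=> [i|x]; first exact/subgpP.
have [w [Hw wx]] := ex x; exists w; split=> [|w' [/rwordP Hw' w'x]].
  by split=> //; exact/rwordP.
by apply: un => //; exact: etrans wx (esym w'x).
Qed.

End FreeProduct.

(** * Effect of a partial conjugation on reduced words *)

Section Rewriting.
Local Open Scope classical_set_scope.
Local Open Scope group_scope.
Variables (G : groupType) (n : nat).
Implicit Types (H : 'I_n -> set G) (w : seq ('I_n * G)) (i j m p q : 'I_n).
Implicit Types (f g : 'I_n -> G).

Definition cj H f : 'I_n -> set G := fun i => conj_set (H i) (f i).

Lemma cjM H f g : cj (cj H f) g = cj H (fun i => f i * g i).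
Proof. by apply/funext => i; rewrite /cj conj_setM. Qed.

Lemma cj1 H : cj H (fun=> 1) = H.
Proof. by apply/funext => i; rewrite /cj conj_set1. Qed.

Lemma cj_mem H f i x : H i x -> cj H f i (x ^ f i).
Proof. by move=> Hx; rewrite /cj conj_setE conjgK. Qed.

Definition lw H w := forall l, l \in w -> H l.1 l.2.

Lemma lw_cons H l w : lw H (l :: w) <-> H l.1 l.2 /\ lw H w.
Proof.
split=> [Hw|[Hl Hw] l']; last by rewrite inE => /predU1P[->|/Hw].
split; first exact: (Hw _ (mem_head _ _)).
by move=> l' lw'; apply: Hw; rewrite inE lw' orbT.
Qed.

Lemma lw_rword H w : rword H w -> lw H w.
Proof. by move=> /rwordP[Hw _] l /Hw[]. Qed.

Definition emit m (z : G) w := if z == 1 then w else (m, z) :: w.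

Lemma size_emit m z w : size (emit m z w) = ((z != 1%g) + size w)%N.
Proof. by rewrite /emit; case: eqP. Qed.

Lemma wprod_emit m z w : wprod (emit m z w) = z * wprod w.
Proof.
by rewrite /emit; case: eqP => [->|_]; rewrite ?mul1g ?wprod_cons.
Qed.

(* Rewrites a word over [H] into one over [cj H f], where [f] takes its values
   in [H m]; [y] is the element of [H m] carried over from the left, and the
   word is read up to a final factor [z], or up to [H m] if [e] is [None]. *)
Fixpoint rw m f (y : G) (e : option G) w :=
  match w with
  | [::] => if e is Some z then emit m (y * z) [::] else [::]
  | (b, s) :: w' =>
    if b == m then rw m f (y * s) e w'
    else emit m (y * f b) ((b, s ^ f b) :: rw m f (f b)^-1 e w')
  end.

(** Telescoping: a letter [s] of index [b] other than [m] equals [f b * s ^ f b * (f b)^-1], and the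
    two outer factors merge with the elements of [H m] carried on either side. The correction [k] is
    what is still carried at the end when [e] is [None]. *)
Lemma rw_prod m f y (e : option G) w : f m = 1 ->
  exists k : G, [/\ (e <> None -> k = 1),
    (forall H, subgp (H m) -> (forall a, H m (f a)) -> H m y -> lw H w -> H m k) &
    wprod (rw m f y e w) * k = y * wprod w * odflt 1 e].
Proof.
move=> fm; elim: w y => [|[b s] w IHw] y /=.
  case: e => [z|] /=.
    by exists 1; split=> // [H []//|]; rewrite wprod_emit !wprod0 !mulg1.
  by exists y; rewrite wprod0 !mulg1 mul1g; split.
have [->|bm] := eqVneq b m.
  have [k [k1 Hk E]] := IHw (y * s); exists k; split=> //.
    move=> H sH Hf Hy /lw_cons[Hs Hw]; apply: Hk => //.
    by have [_ + _] := sH; apply.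
  by rewrite E wprod_cons /= !mulgA.
have [k [k1 Hk E]] := IHw (f b)^-1; exists k; split=> //.
  move=> H sH Hf Hy /lw_cons[Hs Hw]; apply: Hk => //.
  by have [_ _] := sH; apply.
rewrite wprod_emit !wprod_cons /= -[LHS]mulgA -[(_ * _) * k]mulgA E.
by rewrite conjgE !mulgA mulgK mulgK.
Qed.

Section Reduced.
Variables (H : 'I_n -> set G) (m : 'I_n) (f : 'I_n -> G).
Hypotheses (sH : subgp (H m)) (fm : f m = 1) (Hf : forall a, H m (f a)).

Let H1 : H m 1. Proof. by case: sH. Qed.
Let HM x y : H m x -> H m y -> H m (x * y). Proof. by have [_ + _] := sH; apply. Qed.
Let HV x : H m x -> H m x^-1. Proof. by have [_ _] := sH; apply. Qed.

Lemma cj_op : cj H f m = H m.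
Proof. by rewrite /cj fm conj_set1. Qed.

Let emit_red z w : H m z -> rword (cj H f) w -> hdne m w ->
  rword (cj H f) (emit m z w).
Proof.
move=> Hz Hw mw; rewrite /emit; case: eqP => // z1.
by split=> //=; rewrite cj_op.
Qed.

(** Here [a] is the index of the last letter passed outside [H m], and [k] the element of [H m] read
    since. If nothing is emitted before the next letter, of index [b], then [k = f a * (f b)^-1].
    For [a = b] this gives [k = 1], so that two letters of equal index would have been adjacent in
    the input. *)
Lemma rw_red a k e w : a != m -> H m k -> (forall z, e = Some z -> H m z) ->
  rword H w -> (k = 1 -> hdne a w) -> (k <> 1 -> hdne m w) ->
  rword (cj H f) (rw m f ((f a)^-1 * k) e w) /\
  hdne a (rw m f ((f a)^-1 * k) e w).
Proof.
move=> + + He; elim: w a k => [|[b s] w IHw] a k am Hk /= Hw ka km.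
  case: e He => // z /(_ _ erefl) Hz; split.
    by apply: emit_red => //; apply: HM => //; apply: HM => //; exact: HV.
  by rewrite /emit; case: ifP.
have [bm|bm] := eqVneq b m.
  have k1 : k = 1 by apply: contrapT => /km /eqP; rewrite bm.
  case: Hw => /= Hs s1 bw Hw; rewrite k1 mulg1; apply: IHw => //.
  - by rewrite -bm.
  - by rewrite -bm.
case: Hw => /= Hs s1 bw Hw.
have [//|//|rwb bhd] := IHw b 1 bm H1 Hw; rewrite mulg1 in rwb bhd.
have Hb : rword (cj H f) ((b, s ^ f b) :: rw m f (f b)^-1 e w).
  split=> //=; first exact: cj_mem.
  by move=> /eqP; rewrite conjg_eq1 => /eqP.
split.
  apply: emit_red => //; last by rewrite /= eq_sym.
  by apply: HM => //; apply: HM => //; exact: HV.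
rewrite /emit; case: eqP => //= E.
apply/eqP => ab; move: E ka; rewrite -ab => /eqP.
by rewrite -mulgA mulg_eq1 eqg_inv -{1}[f a]mul1g => /eqP/mulIg<- /(_ erefl)/eqP.
Qed.

Lemma rw_red0 y e w : H m y -> (forall z, e = Some z -> H m z) ->
  rword H w -> hdne m w -> rword (cj H f) (rw m f y e w).
Proof.
move=> Hy He; case: w => [|[b s] w] /=.
  by case: e He => // z /(_ _ erefl) Hz _ _; apply: emit_red => //; exact: HM.
case=> /= Hs s1 bw Hw mb; rewrite eq_sym (negbTE mb).
have bm : b != m by rewrite eq_sym.
have [//|//|] := rw_red bm H1 He Hw; rewrite mulg1 => rwb bhd.
apply: emit_red => //; first exact: HM.
split=> //=; first exact: cj_mem.
by move=> /eqP; rewrite conjg_eq1 => /eqP.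
Qed.

Lemma rw_red1 w : rword H w -> rword (cj H f) (rw m f 1 (Some 1) w).
Proof.
have He z : Some 1 = Some z -> H m z by move=> [<-].
case: w => [|[b s] w] Hw; first exact: rw_red0.
have [bm|bm] := eqVneq b m; last by apply: rw_red0; rewrite //= eq_sym.
case: Hw => /= Hs s1 bw Hw; rewrite bm eqxx mul1g.
by rewrite bm in Hs bw; exact: rw_red0.
Qed.


Lemma rw_last q a k w : a != m -> H m k -> rword H w ->
  (k = 1 -> hdne a w) -> (k <> 1 -> hdne m w) -> lstne w q ->
  (w = [::] -> if q == m then k = 1 else k = 1 -> a != q) ->
  (last a [seq x.1 | x <- rw m f ((f a)^-1 * k)
     (if q == m then None else Some (f q)) w]) != q.
Proof.
elim: w a k => [|[b s] w IHw] a k am Hk Hw ka km wq.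
  move=> /(_ erefl); have [->//|qm aq] := eqVneq q m.
  rewrite /= /emit; case: ifPn => /= [|_]; last by rewrite eq_sym.
  move=> E; apply/negP => /eqP aq'; move: E aq; rewrite -aq'.
  rewrite -mulgA mulg_eq1 eqg_inv -{1}[f a]mul1g => /eqP/mulIg<- /(_ erefl)/eqP.
  exact.
case: Hw => /= Hs s1 bw Hw _.
have wq' : lstne w q by case: w wq {IHw bw Hw ka km}.
have [bm|bm] := eqVneq b m.
  have k1 : k = 1 by apply: contrapT => /km /eqP; rewrite bm.
  rewrite k1 mulg1; apply: IHw => //; rewrite -?bm //.
  by move=> w0; move: wq; rewrite w0 /= bm eq_sym => /negbTE ->.
have := IHw b 1 bm H1 Hw (fun=> bw) (fun h => False_ind _ (h erefl)) wq'.
rewrite mulg1 => IH.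
have {}IH : last b [seq x.1 | x <- rw m f (f b)^-1
     (if q == m then None else Some (f q)) w] != q.
  apply: IH => w0; case: (eqVneq q m) => // _ _; by move: wq; rewrite w0.
by rewrite /emit; case: ifP.
Qed.

End Reduced.

Definition mrg m (y : G) w :=
  if w is (b, s) :: w' then if b == m then emit m (y * s) w' else emit m y w
  else emit m y [::].

Lemma mrg1 H m w : rword H w -> mrg m 1 w = w.
Proof.
case: w => [|[b s] w] /=; first by rewrite /emit eqxx.
case=> /= _ s1 _ _; rewrite mul1g /emit eqxx; case: eqP => // ->.
by case: eqP.
Qed.

(** Opposite rewritings cancel letter by letter, and only the elements carried in from the left
    survive, merged into the head of the word. With [y] and [z] trivial, rewriting is thus injective
    on reduced words, which transports the uniqueness of normal forms. *)
Lemma rwK H m f f' y z w : (forall a, f' a = (f a)^-1) -> f m = 1 -> rword H w ->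
  rw m f' z (Some 1) (rw m f y (Some 1) w) = mrg m (z * y) w.
Proof.
move=> f'E fm; elim: w y z => [|[b s] w IHw] y z Hw.
  rewrite /= mulg1 {1}/emit; case: eqP => [->|_] /=; first by rewrite !mulg1.
  by rewrite eqxx mulg1.
case: Hw => /= Hs s1 bw Hw.
have [bm|bm] := eqVneq b m.
  rewrite IHw //; rewrite bm in bw; case: w bw {IHw Hw} => [|[c t] w] //=.
    by rewrite mulgA.
  by rewrite eq_sym => /negbTE->; rewrite mulgA.
have W : rw m f' (f' b)^-1 (Some 1) (rw m f (f b)^-1 (Some 1) w) = w.
  by rewrite IHw // f'E invgK mulgV (mrg1 _ Hw).
rewrite {1}/emit; case: eqP => [E|E] /=.
  rewrite (negbTE bm) W !f'E conjgK; congr emit.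
  by congr (z * _); move/eqP: E; rewrite mulg_eq1 => /eqP.
rewrite eqxx (negbTE bm) W !f'E conjgK; congr emit.
by rewrite mulgA mulgK.
Qed.

(** Existence of reduced words comes from rewriting with [f]. For uniqueness, words are rewritten
    back with the inverses [f'] and compared over [H]. *)
Lemma fp_move H m f : is_free_product H -> (forall a, H m (f a)) -> f m = 1 ->
  is_free_product (cj H f).
Proof.
move=> fpH Hf fm; have sH := fp_subgp fpH.
have [_ _ V] := sH m.
pose f' a := (f a)^-1.
have HE : cj (cj H f) f' = H.
  by rewrite cjM -[RHS]cj1; congr cj; apply/funext => a; rewrite mulgV.
have f'm : f' m = 1 by rewrite /f' fm invg1.
have Hf' a : cj H f m (f' a) by rewrite cj_op //; exact: V.
have sH' i : subgp (cj H f i) by exact: subgp_conj.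
have prod1 (g : 'I_n -> G) w : g m = 1 -> wprod (rw m g 1 (Some 1) w) = wprod w.
  move=> gm; have [k [k1 _]] := rw_prod 1 (Some 1) w gm.
  by rewrite (k1 _) // mulg1 mul1g mulg1.
apply/is_free_productP; split=> // [x|w w' Hw Hw' E].
  have [w [Hw wx]] := nf_ex fpH x.
  exists (rw m f 1 (Some 1) w); split; last by rewrite prod1.
  exact: rw_red1.
have R (u : seq ('I_n * G)) : rword (cj H f) u -> rword H (rw m f' 1 (Some 1) u).
  by move=> Hu; rewrite -HE; apply: rw_red1.
have K (u : seq ('I_n * G)) : rword (cj H f) u -> rw m f 1 (Some 1) (rw m f' 1 (Some 1) u) = u.
  move=> Hu; rewrite (rwK _ _ _ f'm Hu) ?mul1g ?(mrg1 _ Hu) // => a.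
  by rewrite /f' invgK.
rewrite -(K w) // -(K w') //; congr rw; apply: (rword_uniq fpH); try exact: R.
by rewrite !prod1.
Qed.

Lemma wprod_conj w (g : G) : wprod [seq (l.1, l.2 ^ g) | l <- w] = wprod w ^ g.
Proof.
by elim: w => [|l w IHw]; rewrite ?wprod0 ?conj1g //= !wprod_cons conjMg IHw.
Qed.

Lemma rword_conj H (g : G) w : rword H w ->
  rword (cj H (fun=> g)) [seq (l.1, l.2 ^ g) | l <- w].
Proof.
elim: w => //= l w IHw [Hl l1 lw Hw]; split=> /=; last exact: IHw.
- exact: (cj_mem (fun=> g)).
- by move=> /eqP; rewrite conjg_eq1 => /eqP.
- by case: w lw {IHw Hw}.
Qed.

Lemma fp_conj H (g : G) : is_free_product H -> is_free_product (cj H (fun=> g)).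
Proof.
move=> fpH; have sH := fp_subgp fpH; apply/is_free_productP; split=> [i|x|w w' Hw Hw' E].
- exact: subgp_conj.
- have [w [Hw wx]] := nf_ex fpH (x ^ g^-1).
  exists [seq (l.1, l.2 ^ g) | l <- w]; split; first exact: rword_conj.
  by rewrite wprod_conj wx conjgKV.
have K (u : seq ('I_n * G)) : [seq (l.1, l.2 ^ g) | l <- [seq (l.1, l.2 ^ g^-1) | l <- u]] = u.
  by rewrite -map_comp map_id_in // => -[a x] _ /=; rewrite conjgKV.
have R (u : seq ('I_n * G)) : rword (cj H (fun=> g)) u -> rword H [seq (l.1, l.2 ^ g^-1) |
  l <- u].
  move=> /(rword_conj g^-1); rewrite cjM (_ : cj _ _ = H) // -[RHS]cj1.
  by congr cj; apply/funext => a; rewrite mulgV.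
rewrite -(K w) -(K w'); congr map; apply: (rword_uniq fpH); try exact: R.
by rewrite !wprod_conj E.
Qed.

(** * Syllable distance between vertices of the Bass-Serre tree *)

Section Distance.
Variable H : 'I_n -> set G.
Hypothesis fpH : is_free_product H.
Let sH := fp_subgp fpH.

Lemma nf_cons i s x : H i s -> (size (nf fpH (s * x)) <= (size (nf fpH x)).+1)%N.
Proof.
move=> Hs; have := nf_rword fpH x; have := nfK fpH x.
case: (nf fpH x) => [|[b t] w] <- Hw.
  rewrite wprod0 mulg1; have [->|/eqP s1] := eqVneq s 1; first by rewrite nf1.
  by rewrite (nf_letter fpH Hs).
have [->|/eqP s1] := eqVneq s 1; first by rewrite mul1g nf_wprod.
have [bi|bi] := eqVneq b i; last first.
  by rewrite -(wprod_cons (i, s)) nf_wprod //; split=> //=; rewrite eq_sym.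
case: (Hw) => /= Ht t1 bw Hw'; rewrite wprod_cons mulgA /=.
have [->|/eqP st] := eqVneq (s * t) 1.
  by rewrite mul1g nf_wprod // leqW.
rewrite -(wprod_cons (b, s * t)) nf_wprod //; split=> //=.
by have [_ M _] := sH b; rewrite bi in Ht M *; exact: M.
Qed.

Lemma nf_size w : lw H w -> (size (nf fpH (wprod w)) <= size w)%N.
Proof.
elim: w => [|l w IHw]; first by rewrite wprod0 nf1.
move=> /lw_cons[Hl Hw]; rewrite wprod_cons.
by apply: leq_trans (nf_cons _ Hl) _; rewrite ltnS IHw.
Qed.

(* The word [w] labels the geodesic between the vertices fixed by [H p] and by
   [(H q) ^ u^-1] in the Bass-Serre tree of the free product decomposition. *)
Definition geod p q u w := [/\ rword H w, hdne p w, lstne w q &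
  exists h k, [/\ H p h, H q k & u = h * wprod w * k]].

(** Take the normal form of [u] and strip a leading letter of [H p] and a trailing letter of
    [H q]. *)
Lemma geod_ex p q u : exists w, geod p q u w.
Proof.
have [h [w [Hw hw Hh uE]]] : exists h w, [/\ rword H w, hdne p w, H p h & u = h * wprod w].
  have := nf_rword fpH u; have := nfK fpH u.
  case: (nf fpH u) => [|[b s] w] <- Hw.
    by exists 1, [::]; split=> //; rewrite ?mul1g //; case: (sH p).
  have [bp|bp] := eqVneq b p; last first.
    exists 1, ((b, s) :: w); split; rewrite ?mul1g //=; first by rewrite eq_sym.
    by case: (sH p).
  case: Hw => /= Hs s1 bw Hw; exists s, w; split=> //; rewrite -?bp //.
  by rewrite wprod_cons.
case/lastP: w Hw hw uE => [|w [b t]] Hw hw uE.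
  exists [::]; split=> //; exists h, 1; split; rewrite ?mulg1 //.
  by case: (sH q).
have [bq|bq] := eqVneq b q; last first.
  exists (rcons w (b, t)); split=> //; first by rewrite lstne_rcons.
  by exists h, 1; split; rewrite ?mulg1 //; case: (sH q).
rewrite -cats1 in Hw uE hw; exists w; split.
- exact: rword_catl Hw.
- by case: w hw {Hw uE}.
- move: Hw; elim: w {uE hw} => [//|l w IHw]; case: w IHw => [_ [_ _ /=]|l' w IHw [_ _ _]].
    by rewrite bq.
  by move/IHw.
- exists h, t; rewrite uE wprod_cat wprod_cons wprod0 mulg1 mulgA; split=> //.
  by have := rword_catr Hw; rewrite bq; case.
Qed.

(** Comparing the two expressions of [u] gives [wprod w' = a * wprod w * c] with [a] in [H p] and
    [c] in [H q]. As [p] and [q] differ, the word stays reduced after these letters are added around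
    [w], so the normal form of [wprod w'] is at least as long as [w]. *)
Lemma geod_min p q u w w' h k : p != q -> geod p q u w -> lw H w' ->
  H p h -> H q k -> u = h * wprod w' * k -> (size w <= size w')%N.
Proof.
move=> pq [Hw pw wq [h1 [k1 [Hh1 Hk1 E]]]] Hw' Hh Hk E'.
have [_ _ Vp] := sH p; have [_ Mp _] := sH p.
have [_ _ Vq] := sH q; have [_ Mq _] := sH q.
have {E'} : wprod w' = (h^-1 * h1) * wprod w * (k1 * k^-1).
  by apply: (mulgI h); apply: (mulIg k); rewrite -E' E !mulgA mulgV mul1g mulgVK.
move: (Mp _ _ (Vp _ Hh) Hh1) (Mq _ _ Hk1 (Vq _ Hk)).
move: (h^-1 * h1) (k1 * k^-1) => a c Ha Hc E'.
apply: leq_trans (nf_size Hw').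
have -> : wprod w' = wprod (emit p a (w ++ emit q c [::])).
  by rewrite wprod_emit wprod_cat wprod_emit wprod0 mulg1 E' mulgA.
rewrite nf_wprod; first by rewrite size_emit size_cat addnA -addnA addnCA leq_addr.
have Hc1 : rword H (w ++ emit q c [::]).
  by apply: rword_cat => //; rewrite /emit; case: eqP.
rewrite /emit; case: eqP => // a1; split=> //.
case: w pw {wq E E' Hw Hc1} => //= _; rewrite /emit; case: eqP => //.
Qed.

(** The geodesic is picked by choice; by [distE] its length does not depend on the choice when [p]
    and [q] differ. *)
Definition dist p q u := size (projT1 (cid (geod_ex p q u))).

Lemma distE p q u w : p != q -> geod p q u w -> dist p q u = size w.
Proof.
move=> pq gw; rewrite /dist; case: cid => w' /= gw'; apply/eqP.
have [Hw _ _ [h [k [Hh Hk E]]]] := gw; have [Hw' _ _ [h' [k' [Hh' Hk' E']]]] := gw'.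
rewrite eqn_leq (geod_min pq gw' (lw_rword Hw) Hh Hk E).
exact: (geod_min pq gw (lw_rword Hw') Hh' Hk' E').
Qed.

Lemma dist_le p q u w h k : p != q -> lw H w -> H p h -> H q k ->
  u = h * wprod w * k -> (dist p q u <= size w)%N.
Proof.
have [w' gw'] := geod_ex p q u.
by move=> pq *; rewrite (distE pq gw'); apply: (geod_min pq gw'); eassumption.
Qed.

Lemma dist_mul p q u a b : p != q -> H p a -> H q b -> dist p q (a * u * b) = dist p q u.
Proof.
move=> pq Ha Hb; have [w gw] := geod_ex p q u; rewrite (distE pq gw); apply: distE => //.
have [Hw pw wq [h [k [Hh Hk ->]]]] := gw; split=> //.
exists (a * h), (k * b); split; rewrite ?mulgA //.
- by have [_ M _] := sH p; exact: M.
- by have [_ M _] := sH q; exact: M.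
Qed.

End Distance.

End Rewriting.

(* [move:] generalizes up to the conversion between the instances of [mul] and
   [one] inferred along different coercion paths. *)
Ltac gen_lia cost :=
  repeat move: (cost _ _ _ _ _) => ?; repeat move: (nat_of_bool _) => ?; lia.

(** * Syllable counts for two moves with distinct operating factors *)

Section Peak.
Local Open Scope classical_set_scope.
Local Open Scope group_scope.
Variables (G : groupType) (n : nat).
Implicit Types (H : 'I_n -> set G) (w : seq ('I_n * G)) (i j m p q : 'I_n).
Implicit Types (f g : 'I_n -> G).

(** When the path ends at the operating factor, a final element of [H m] belongs to the stabiliser
    of the end and costs nothing: hence [None]. *)
Definition fin m f q := if q == m then None else Some (f q).

(** When the path begins at the operating factor, the initial element of [H m] can be chosen freely;
    this choice makes the first emission trivial. On the empty word [head] returns [q], so that the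
    final [f q] is cancelled in the same way. *)
Definition start m f p q w :=
  if p == m then (f (head q [seq l.1 | l <- w]))^-1 else (f p)^-1.

Definition cost m f y q w := size (rw m f y (fin m f q) w).

Lemma cost_nil m f y q : cost m f y q [::] = (if q == m then 0 else (y * f q != 1)%g : nat)%N.
Proof. by rewrite /cost /fin; case: eqP => //= _; rewrite size_emit addn0. Qed.

Lemma cost_cons m f y q b s w : cost m f y q ((b, s) :: w) =
  if b == m then cost m f (y * s) q w
  else ((y * f b != 1)%g + (cost m f (f b)^-1 q w).+1)%N.
Proof. by rewrite /cost /=; case: eqP => // _; rewrite size_emit. Qed.

(** The rewritten word is reduced by [rw_red], and what is left over at its ends lies in the new end
    factors, so it represents the double coset of [(f p)^-1 * u * f q]. *)
Lemma geod_move H m f p q u w : is_free_product H -> (forall a, H m (f a)) ->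
  f m = 1 -> p != q -> geod H p q u w ->
  geod (cj H f) p q ((f p)^-1 * u * f q) (rw m f (start m f p q w) (fin m f q) w).
Proof.
move=> fpH Hf fm pq [Hw pw wq [h [k [Hh Hk uE]]]].
have sH := fp_subgp fpH; have [H1 HM HV] := sH m.
have He z : fin m f q = Some z -> H m z by rewrite /fin; case: eqP => // _ [<-].
have Hs : H m (start m f p q w) by rewrite /start; case: eqP => _; exact: HV.
have [k' [k'1 Hk' E]] := rw_prod (start m f p q w) (fin m f q) w fm.
have {}Hk' : H m k' by apply: Hk' => //; exact: lw_rword.
(* [c] compares the true left factor [(f p)^-1] with the carried element chosen by [start]. They can
   differ only for [p = m], where [c] lies in the end factor. *)
have [c Hc cE] : exists2 c, cj H f p c & (f p)^-1 = c * start m f p q w.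
  rewrite /start; case: (eqVneq p m) => [->|_]; last first.
    exists 1; rewrite ?mul1g //.
    by rewrite /cj conj_setE conj1g; case: (sH p).
  by exists (f (head q [seq l.1 | l <- w])); rewrite ?cj_op ?fm ?invg1 ?mulgV.
have {k'1 Hk'} Hk' : cj H f q k'.
  have [qm|qm] := eqVneq q m; first by rewrite qm cj_op.
  rewrite k'1 /fin ?(negbTE qm) // /cj conj_setE conj1g.
  by case: (sH q).
have finE : odflt 1 (fin m f q) = f q by rewrite /fin; case: eqP => // ->.
rewrite finE in E.
set X := rw _ _ _ _ _ in E *.
suff [HX pX qX] : [/\ rword (cj H f) X, hdne p X & lstne X q].
  have sub a : subgp (cj H f a) by exact: subgp_conj.
  split=> //; exists (h ^ f p * c), (k' * k ^ f q); split.
  - by have [_ M _] := sub p; apply: M => //; exact: cj_mem.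
  - by have [_ M _] := sub q; apply: M => //; exact: cj_mem.
  - rewrite !mulgA -[_ * wprod X * k']mulgA E !mulgA -[_ * c * _]mulgA -cE uE.
    by rewrite !conjgE !mulgA !mulgK.
rewrite {E}/X; have [pm|pm] := eqVneq p m; last first.
  have st : start m f p q w = (f p)^-1 * 1 by rewrite /start (negbTE pm) mulg1.
  rewrite st; have [//|//|HX pX] := rw_red (sH m) fm Hf pm H1 He Hw; split=> //.
  have := rw_last f (sH m) pm H1 Hw (fun=> pw) (fun h => False_ind _ (h erefl)) wq.
  rewrite /fin; case: (rw _ _ _ _ _) => //= l X; rewrite last_map; apply.
  by move=> _; case: ifP => // _ _.
have qm : q != m by rewrite eq_sym -pm.
rewrite /start pm eqxx; case: w pw wq Hw Hs {Hk uE cE} => [|[b s] w] pw wq Hw Hs.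
  by rewrite /= /fin (negbTE qm) /emit mulVg eqxx; split.
have bm : b != m by rewrite eq_sym -pm.
case: Hw => /= Hb s1 bw Hw; rewrite (negbTE bm) mulVg /emit eqxx.
have [//|//|] := rw_red (sH m) fm Hf bm H1 He Hw; rewrite mulg1 => HX bX.
split=> //=; last 2 first.
- by rewrite eq_sym.
- have wq' : lstne w q by case: w wq {pw bw Hw Hs HX bX} => //= l w; rewrite lstne_rcons.
  have := rw_last f (sH m) bm H1 Hw (fun=> bw) (fun h => False_ind _ (h erefl)) wq'.
  rewrite mulg1 => L; rewrite -(last_map fst) /=; apply: L => w0; rewrite (negbTE qm) => _.
  by move: wq; rewrite w0.
split=> //=; first exact: cj_mem.
by move=> /eqP; rewrite conjg_eq1 => /eqP.
Qed.

Lemma dist_move H m f p q u w (fpH : is_free_product H) (fpH' : is_free_product (cj H f)) :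
  (forall a, H m (f a)) -> f m = 1 -> p != q -> geod H p q u w ->
  dist fpH' p q ((f p)^-1 * u * f q) = cost m f (start m f p q w) q w.
Proof. by move=> Hf fm pq gw; rewrite (distE _ pq (geod_move fpH Hf fm pq gw)). Qed.

(** Deletes from the move [f] the factors that [g] moves as well: [off f g] is disjoint from [g],
    and [f] from [off g f]. *)
Definition off f g a : G := if g a == 1 then f a else 1.

Notation alt := (path (fun i j => i != j)).

Lemma neqVg (x y : G) : (x^-1 * y != 1) = (x != y).
Proof. by rewrite mulg_eq1 eqg_inv. Qed.

Let turn_le f g a b :
  (((off f g a)^-1 * off f g b != 1)%g + ((off g f a)^-1 * off g f b != 1)%g <=
   ((f a)^-1 * f b != 1)%g + ((g a)^-1 * g b != 1)%g)%N.
Proof.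
rewrite !neqVg /off.
case: (eqVneq (f a) 1) => [fa|/negbTE fa]; case: (eqVneq (g a) 1) => [ga|/negbTE ga];
case: (eqVneq (f b) 1) => [fb|/negbTE fb]; case: (eqVneq (g b) 1) => [gb|/negbTE gb];
by rewrite ?fa ?fb ?ga ?gb ?eqxx ?(eq_sym 1) ?fa ?fb ?ga ?gb //=; lia.
Qed.

(** Local estimate just after a letter [s] of the first operating factor, reached from [a]. The last
    summand is the debt incurred when [a] lies in the common support and [f a] is deleted; a
    deletion at [b] is paid by the syllable that [g b] loses. *)
Let pass_le f g a b s :
  (((off f g a)^-1 * s * off f g b != 1)%g + (off g f b != 1)%g <=
   ((f a)^-1 * s * f b != 1)%g + (g b != 1)%g + (f a != 1%g) && (g a != 1%g))%N.
Proof.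
rewrite /off.
case: (eqVneq (f a) 1) => [fa|/negbTE fa]; case: (eqVneq (g a) 1) => [ga|/negbTE ga];
case: (eqVneq (f b) 1) => [fb|/negbTE fb]; case: (eqVneq (g b) 1) => [gb|/negbTE gb];
by rewrite ?fa ?fb ?ga ?gb ?eqxx ?invg1 ?mul1g ?mulg1 ?fb ?gb //=; lia.
Qed.

Let off_supp f g a :
  ((off f g a != 1)%g + (f a != 1)%g && (g a != 1)%g = (f a != 1)%g)%N.
Proof. by rewrite /off; case: (eqVneq (g a) 1) => ga; rewrite ?andbF ?andbT ?addn0 ?eqxx. Qed.

Let off_eq f g a : (f a != 1) && (g a != 1) = false -> off f g a = f a.
Proof. by rewrite /off; case: (eqVneq (g a) 1) => // ga; rewrite andbT => /eqP. Qed.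

Let pass1_le f g a s :
  (((off f g a)^-1 * s != 1)%g <= ((f a)^-1 * s != 1)%g + (f a != 1%g) && (g a != 1%g))%N.
Proof.
case E: (_ && _); last by rewrite off_eq // addn0.
by rewrite addn1; case: (_ != _).
Qed.

(* Charging: deleting the common support [Q] of [f] and [g] from both can cost
   at most one new syllable at each visit of an operating factor next to [Q], and
   each such visit is paid by a syllable of the other operating factor that
   disappears. *)
Lemma peak_word w : forall i j f g q a, i != j -> f i = 1 -> f j = 1 ->
  g i = 1 -> g j = 1 ->
  (a != i -> a != j -> alt a (rcons [seq l.1 | l <- w] q) ->
   (cost i (off f g) (off f g a)^-1 q w + cost j (off g f) (off g f a)^-1 q w <=
    cost i f (f a)^-1 q w + cost j g (g a)^-1 q w)%N) /\
  (a != i -> forall s, alt i (rcons [seq l.1 | l <- w] q) ->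
   (cost i (off f g) ((off f g a)^-1 * s) q w + cost j (off g f) 1 q w <=
    cost i f ((f a)^-1 * s) q w + cost j g 1 q w + (f a != 1%g) && (g a != 1%g))%N).
Proof.
elim: w => [|[b t] w IHw] i j f g q a ij fi fj gi gj.
  have oi : off f g i = 1 by rewrite /off gi fi eqxx.
  have oj : off g f j = 1 by rewrite /off fj gj eqxx.
  have oi' : off g f i = 1 by rewrite /off gi fi eqxx.
  have oj' : off f g j = 1 by rewrite /off fj gj eqxx.
  split=> [ai aj _|ai s qi /=]; rewrite !cost_nil.
    have [->|qi] := eqVneq q i.
      rewrite (negbTE ij) oi' gi !mulg1 !invg_eq1 !add0n.
      by rewrite -[leqRHS](off_supp g f) leq_addr.
    have [->|qj] := eqVneq q j.
      rewrite fj oj' !mulg1 !invg_eq1 !addn0.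
      by rewrite -[leqRHS](off_supp f g) leq_addr.
    exact: turn_le.
  move: qi; rewrite /= andbT eq_sym => /negbTE->; rewrite !mul1g.
  have [->|qj] := eqVneq q j; last exact: pass_le.
  by rewrite fj oj' !mulg1 !addn0; exact: pass1_le.
have oi : off f g i = 1 by rewrite /off gi fi eqxx.
have oj : off g f j = 1 by rewrite /off fj gj eqxx.
have oi' : off g f i = 1 by rewrite /off gi fi eqxx.
have oj' : off f g j = 1 by rewrite /off fj gj eqxx.
have ji : j != i by rewrite eq_sym.
split=> [ai aj|ai s] /= /andP[ab bw]; rewrite !cost_cons.
  (* The path enters the operating factor [i] from [a]. By [off_supp], the syllable of [g] that
     disappears when [a] is in the common support is exactly the debt allowed in the second
     statement. *)
  have [bi|bi] := eqVneq b i.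
    rewrite bi (negbTE ij) oi' gi invg1 !mulg1 !invg_eq1.
    rewrite bi in bw ab; have [_ /(_ ai t bw)] := IHw i j f g q a ij fi fj gi gj.
    have := off_supp g f a; rewrite andbC; gen_lia cost.
  have [bj|bj] := eqVneq b j.
    rewrite bj fj oj' invg1 !mulg1 !invg_eq1.
    rewrite bj in bw; have [_ /(_ aj t bw)] := IHw j i g f q a ji gj gi fj fi.
    have := off_supp f g a; rewrite andbC; gen_lia cost.
  have [/(_ bi bj bw) + _] := IHw i j f g q b ij fi fj gi gj.
  have := turn_le f g a b; gen_lia cost.
rewrite eq_sym (negbTE ab).
have [bj|bj] := eqVneq b j.
  rewrite bj fj oj' invg1 !mulg1 !mul1g.
  rewrite bj in bw; have [_ /(_ ij t bw)] := IHw j i g f q i ji gj gi fj fi.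
  rewrite oi' gi invg1 !mul1g fi eqxx /=.
  have := pass1_le f g a s; gen_lia cost.
have bi : b != i by rewrite eq_sym.
rewrite !mul1g.
have [/(_ bi bj bw) + _] := IHw i j f g q b ij fi fj gi gj.
have := pass_le f g a b s; gen_lia cost.
Qed.


Section Commuting.
Variable H : 'I_n -> set G.
Hypothesis sH : forall i, subgp (H i).

Definition disj f g := forall a, f a = 1 \/ g a = 1.

Lemma disjC f g : disj f g -> disj g f.
Proof. by move=> d a; case: (d a); [right|left]. Qed.

Lemma disj_comm f g a : disj f g -> f a * g a = g a * f a.
Proof. by case/(_ a) => ->; rewrite mul1g mulg1. Qed.

Lemma disj_cross f g a b : disj f g ->
  (f a)^-1 * f b * ((g a)^-1 * g b) = (f a * g a)^-1 * (f b * g b) \/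
  (g a)^-1 * g b * ((f a)^-1 * f b) = (f a * g a)^-1 * (f b * g b).
Proof.
move=> d; rewrite invgM; case: (d a) => ->; last first.
  by left; rewrite invg1 !mul1g mulgA.
by case: (d b) => ->; [left|right]; rewrite ?invg1 ?mul1g ?mulg1.
Qed.

Lemma lw_emit K m z w : lw K w -> K m z -> lw K (emit m z w).
Proof. by move=> Kw Kz; rewrite /emit; case: eqP => // _; apply/lw_cons. Qed.

(** The syllables emitted by the two rewritings are interleaved in the order given by [disj_cross].
    A letter of [w] of index other than [i] and [j] occurs once in [W] and once in each rewriting; a
    letter of index [i] or [j] is absorbed by one rewriting and kept by the other. This balance
    produces the term [size w]. [W] need not be reduced, since only an upper bound for a distance is
    wanted. *)
Lemma comm_word w : forall i j f g q a, i != j -> disj f g ->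
  f i = 1 -> f j = 1 -> g i = 1 -> g j = 1 ->
  (forall b, H i (f b)) -> (forall b, H j (g b)) -> lw H w ->
  (a != i -> a != j -> alt a (rcons [seq l.1 | l <- w] q) ->
    exists W k, [/\ lw (cj H (fun b => f b * g b)) W, cj H (fun b => f b * g b) q k,
      (size W + size w <= cost i f (f a)^-1 q w + cost j g (g a)^-1 q w)%N &
      wprod W * k = (f a * g a)^-1 * wprod w * (f q * g q)]) /\
  (forall y, H i y -> alt i (rcons [seq l.1 | l <- w] q) ->
    exists W k, [/\ lw (cj H (fun b => f b * g b)) W, cj H (fun b => f b * g b) q k,
      (size W + size w <= cost i f y q w + cost j g 1 q w)%N &
      wprod W * k = y * wprod w * (f q * g q)]).
Proof.
elim: w => [|[b t] w IHw] i j f g q a ij d fi fj gi gj Hf Hg Hw.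
  set H3 := cj H _.
  have sH3 b : subgp (H3 b) by exact: subgp_conj.
  have H31 b : H3 b 1 by case: (sH3 b).
  have H3i : H3 i = H i by rewrite /H3 /cj fi gi mulg1 conj_set1.
  have H3j : H3 j = H j by rewrite /H3 /cj fj gj mulg1 conj_set1.
  have [_ Mi Vi] := sH i; have [_ Mj Vj] := sH j.
  have l0 : lw H3 [::] by [].
  split=> [ai aj _|y Hy qi]; rewrite !cost_nil wprod0 mulg1.
    have [->|qi] := eqVneq q i.
      rewrite (negbTE ij); exists (emit j (g a)^-1 [::]), (f a)^-1; split.
      - by apply: lw_emit; rewrite ?H3j; auto.
      - by rewrite H3i; auto.
      - by rewrite size_emit gi mulg1 !addn0.
      - by rewrite wprod_emit wprod0 fi gi !mulg1 invgM.
    have [->|qj] := eqVneq q j.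
      exists (emit i (f a)^-1 [::]), (g a)^-1; split.
      - by apply: lw_emit; rewrite ?H3i; auto.
      - by rewrite H3j; auto.
      - by rewrite size_emit fj mulg1 !addn0.
      - by rewrite wprod_emit wprod0 fj gj !mulg1 disj_comm // invgM.
    have H1 : H3 i ((f a)^-1 * f q) by rewrite H3i; auto.
    have H2 : H3 j ((g a)^-1 * g q) by rewrite H3j; auto.
    have [E|E] := disj_cross a q d.
      exists (emit i ((f a)^-1 * f q) (emit j ((g a)^-1 * g q) [::])), 1; split=> //.
      - by apply: lw_emit => //; apply: lw_emit.
      - by rewrite !size_emit !addn0.
      - by rewrite !wprod_emit wprod0 !mulg1.
    exists (emit j ((g a)^-1 * g q) (emit i ((f a)^-1 * f q) [::])), 1; split=> //.
    - by apply: lw_emit => //; apply: lw_emit.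
    - by rewrite !size_emit !addn0 addnC.
    - by rewrite !wprod_emit wprod0 !mulg1.
  move: qi; rewrite /= andbT eq_sym => /negbTE ->; rewrite !mul1g.
  have H1 : H3 i (y * f q) by rewrite H3i; auto.
  have H2 : H3 j (g q) by rewrite H3j.
  exists (emit i (y * f q) (emit j (g q) [::])), 1; split=> //.
  - by apply: lw_emit => //; apply: lw_emit.
  - rewrite !size_emit !addn0; case: (eqVneq q j) => [->|_ //].
    by rewrite gj eqxx.
  - by rewrite !wprod_emit wprod0 !mulg1 mulgA.
have /lw_cons[/= Ht Hw'] := Hw.
set H3 := cj H _.
have sH3 c : subgp (H3 c) by exact: subgp_conj.
have H31 c : H3 c 1 by case: (sH3 c).
have H3i : H3 i = H i by rewrite /H3 /cj fi gi mulg1 conj_set1.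
have H3j : H3 j = H j by rewrite /H3 /cj fj gj mulg1 conj_set1.
have [_ Mi Vi] := sH i; have [_ Mj Vj] := sH j.
have ji : j != i by rewrite eq_sym.
have H3' : cj H (fun c => g c * f c) = H3.
  by congr cj; apply/funext => c; rewrite [RHS]disj_comm.
have [IH1 IH2] := IHw i j f g q b ij d fi fj gi gj Hf Hg Hw'.
have [_ IH3] := IHw j i g f q b ji (disjC d) gj gi fj fi Hg Hf Hw'.
rewrite H3' -(disj_comm q d) in IH3; rewrite -/H3 in IH1 IH2.
have H3t : H3 b (t ^ (f b * g b)) by exact: (cj_mem (fun b => f b * g b)).
split=> [ai aj|y Hy] /= /andP[ab bw]; rewrite !cost_cons wprod_cons /=.
  have [bi|bi] := eqVneq b i.
    rewrite bi in bw Ht *; rewrite (negbTE ij) gi mulg1 !invg_eq1 invg1.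
    have [|//|W [k [HW Hk sW E]]] := IH2 ((f a)^-1 * t); first by auto.
    exists (emit j (g a)^-1 W), k; split=> //.
    - by apply: lw_emit; rewrite ?H3j; auto.
    - by rewrite size_emit invg_eq1; move: sW; gen_lia cost.
    - by rewrite wprod_emit -mulgA E invgM !mulgA.
  have [bj|bj] := eqVneq b j.
    rewrite bj in bw Ht *; rewrite fj mulg1 !invg_eq1 invg1.
    have [|//|W [k [HW Hk sW E]]] := IH3 ((g a)^-1 * t); first by auto.
    exists (emit i (f a)^-1 W), k; split=> //.
    - by apply: lw_emit; rewrite ?H3i; auto.
    - by rewrite size_emit invg_eq1; move: sW; gen_lia cost.
    - by rewrite wprod_emit -mulgA E (disj_comm a d) invgM !mulgA.
  have [W [k [HW Hk sW E]]] := IH1 bi bj bw.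
  have H1 : H3 i ((f a)^-1 * f b) by rewrite H3i; auto.
  have H2 : H3 j ((g a)^-1 * g b) by rewrite H3j; auto.
  have HW' : lw H3 ((b, t ^ (f b * g b)) :: W) by apply/lw_cons.
  have [C|C] := disj_cross a b d.
    exists (emit i ((f a)^-1 * f b) (emit j ((g a)^-1 * g b) ((b, t ^ (f b * g b)) :: W))), k.
    split=> //.
    - by apply: lw_emit => //; apply: lw_emit.
    - by rewrite !size_emit /=; move: sW; gen_lia cost.
    - move: C E; move: (f b * g b) => F C E.
      by rewrite !wprod_emit wprod_cons /= mulgA C -!mulgA E !mulgA !mulgK.
  exists (emit j ((g a)^-1 * g b) (emit i ((f a)^-1 * f b) ((b, t ^ (f b * g b)) :: W))), k.
  split=> //.
  - by apply: lw_emit => //; apply: lw_emit.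
  - by rewrite !size_emit /=; move: sW; gen_lia cost.
  - move: C E; move: (f b * g b) => F C E.
    by rewrite !wprod_emit wprod_cons /= mulgA C -!mulgA E !mulgA !mulgK.
rewrite eq_sym (negbTE ab) mul1g.
have [bj|bj] := eqVneq b j.
  rewrite bj in bw Ht *; rewrite fj mulg1 invg1.
  have [//|//|W [k [HW Hk sW E]]] := IH3 t.
  exists (emit i y W), k; split=> //.
  - by apply: lw_emit; rewrite ?H3i; auto.
  - by rewrite size_emit; move: sW; gen_lia cost.
  - by rewrite wprod_emit -mulgA E !mulgA.
have bi : b != i by rewrite eq_sym.
have [W [k [HW Hk sW E]]] := IH1 bi bj bw.
have H1 : H3 i (y * f b) by rewrite H3i; auto.
have H2 : H3 j (g b) by rewrite H3j; auto.
have HW' : lw H3 ((b, t ^ (f b * g b)) :: W) by apply/lw_cons.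
exists (emit i (y * f b) (emit j (g b) ((b, t ^ (f b * g b)) :: W))), k; split=> //.
- by apply: lw_emit => //; apply: lw_emit.
- by rewrite !size_emit /= mul1g; move: sW; gen_lia cost.
- rewrite !wprod_emit mulgA -[y * f b * g b]mulgA.
  move: E; move: (f b * g b) => F E.
  by rewrite wprod_cons /= -!mulgA E !mulgA !mulgK.
Qed.

End Commuting.

End Peak.

(** * Labellings of the star *)

Section Labellings.
Local Open Scope classical_set_scope.
Local Open Scope group_scope.
Variables (G : groupType) (n : nat) (Gs : 'I_n -> set G).
Hypothesis hG : is_free_product Gs.
Hypothesis hnt : forall i, Gs i <> [set 1].
Implicit Types (i j a b p q : 'I_n) (f : 'I_n -> G).

Definition lab := {H : 'I_n -> set G | is_labelling Gs H}.
Implicit Types L : lab.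
Definition lb L : 'I_n -> set G := sval L.

Lemma lab_fp L : is_free_product (lb L).
Proof. by case: L => H []. Qed.

Lemma lab_subgp L i : subgp (lb L i).
Proof. exact: fp_subgp (lab_fp L) i. Qed.

Lemma lab_inj L L' : lb L = lb L' -> L = L'.
Proof. by case: L L' => [H HP] [H' HP'] /= E; exact: eq_exist. Qed.

Lemma lab_cj L f : is_free_product (cj (lb L) f) ->
  exists L', lb L' = cj (lb L) f.
Proof.
case: L => H [Hc Hfp] /= fp; suff P : is_labelling Gs (cj H f) by exists (exist _ _ P).
split=> // a; have [g E] := Hc a; exists (g * f a).
by rewrite conj_setM -E.
Qed.

Lemma lab_move L i f : (forall a, lb L i (f a)) -> f i = 1 ->
  exists L', lb L' = cj (lb L) f.
Proof. by move=> Hf fi; apply: lab_cj; apply: fp_move Hf fi; exact: lab_fp. Qed.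

Lemma lab_conj L (g : G) : exists L', lb L' = cj (lb L) (fun=> g).
Proof. by apply: lab_cj; apply: fp_conj; exact: lab_fp. Qed.

(** The conjugators lead from the labelling back to [Gs]. Up to [H p] on the left and [H q] on the
    right, [x p * (x q)^-1] then records the relative position of the vertices fixed by [Gs p] and
    [Gs q] in the Bass-Serre tree of [H]. *)
Definition marking (H : 'I_n -> set G) (x : 'I_n -> G) := forall i, Gs i = conj_set (H i) (x i).

Lemma conj_setK (A : set G) (g : G) : conj_set (conj_set A g) g^-1 = A.
Proof. by rewrite -conj_setM mulgV conj_set1. Qed.

Lemma marking_ex L : exists x, marking (lb L) x.
Proof.
have /choice[x xP] : forall i, exists g, lb L i = conj_set (Gs i) g.
  by case: L => H [].
by exists (fun i => (x i)^-1) => i; rewrite xP conj_setK.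
Qed.

Lemma nontriv (H : 'I_n -> set G) i : is_free_product H -> H i <> [set 1] -> exists2 z,
  H i z & z <> 1.
Proof.
move=> fpH ntH; apply: contrapT => no; apply: ntH; apply/seteqP; split=> [z Hz|_ ->].
  by apply: contrapT => z1; apply: no; exists z.
by case: (fp_subgp fpH i).
Qed.

Lemma lab_nt L i : lb L i <> [set 1].
Proof.
move=> E; have [x xP] := marking_ex L; case: (hnt (i:=i)); rewrite (xP i) E.
apply/seteqP; split=> z; rewrite conj_setE /=; last by move=> ->; rewrite conj1g.
by move=> /eqP; rewrite conjg_eq1 => /eqP.
Qed.

Lemma hdne_split (H : 'I_n -> set G) i (u : G) : is_free_product H ->
  exists h w, [/\ H i h, rword H w, hdne i w & u = h * wprod w].
Proof.
move=> fpH; have := nf_rword fpH u; have := nfK fpH u.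
case: (nf fpH u) => [|[b s] w] <- Hw.
  by exists 1, [::]; split=> //; rewrite ?mul1g //; case: (fp_subgp fpH i).
have [bp|bp] := eqVneq b i; last first.
  exists 1, ((b, s) :: w); split; rewrite ?mul1g //=; last by rewrite eq_sym.
  by case: (fp_subgp fpH i).
case: Hw => /= Hs s1 bw Hw; exists s, w; split=> //; rewrite -?bp //.
by rewrite wprod_cons.
Qed.

(** Write [x = h * wprod w] with [h] in [H i] and [w] not starting in [H i]. For a nontrivial [z] in
    [H i], the normal form of [z ^ x] has length [2 * size w + 1], and it is a single letter only if
    [w] is empty. *)
Lemma normalizer (H : 'I_n -> set G) i (x : G) : is_free_product H -> H i <> [set 1] ->
  conj_set (H i) x = H i -> H i x.
Proof.
move=> fpH ntH E; have [z Hz z1] := nontriv fpH ntH.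
have [h [w [Hh Hw iw xE]]] := hdne_split i x fpH.
have sHi := fp_subgp fpH; have [_ M V] := sHi i.
have Hz' : H i (z ^ h).
  by have := conj_set_id (sHi i) Hh => <-; exact: (cj_mem (fun=> h)).
have Hzx : H i (z ^ x) by rewrite -E; exact: (cj_mem (fun=> x)).
have Ez : z ^ x = wprod (winv w ++ (i, z ^ h) :: w).
  by rewrite wprod_cat wprod_winv wprod_cons xE conjgM.
have Hwz : rword H (winv w ++ (i, z ^ h) :: w).
  apply: rword_cat; first exact: rword_winv.
    by split=> //=; move=> /eqP; rewrite conjg_eq1 => /eqP.
  by rewrite lstne_winv.
have zx1 : z ^ x <> 1 by move=> /eqP; rewrite conjg_eq1 => /eqP.
have := nf_letter fpH Hzx zx1; rewrite Ez nf_wprod // => /(congr1 size).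
rewrite size_cat size_winv addnS /= => /eqP; rewrite eqSS addn_eq0 => /andP[/nilP w0 _].
by rewrite xE w0 wprod0 mulg1.
Qed.

Lemma marking_uniq L x y i : marking (lb L) x -> marking (lb L) y ->
  exists2 h, lb L i h & x i = h * y i.
Proof.
move=> xP yP; exists (x i * (y i)^-1); last by rewrite mulgVK.
apply: (normalizer (lab_fp L)); first exact: lab_nt.
by rewrite conj_setM -xP (yP i) conj_setK.
Qed.

Definition normx L (x : 'I_n -> G) := (\sum_p \sum_(q | p != q)
  dist (lab_fp L) p q (x p * (x q)^-1))%N.

Definition mark L := projT1 (cid (marking_ex L)).

Lemma markP L : marking (lb L) (mark L).
Proof. by rewrite /mark; case: cid. Qed.

Definition norm L := normx L (mark L).

(** Two markings differ by elements of the factors on the left ([marking_uniq]), which [dist_mul]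
    absorbs. *)
Lemma normE L x : marking (lb L) x -> norm L = normx L x.
Proof.
move=> xP; apply: eq_bigr => p _; apply: eq_bigr => q pq.
have [h Hh ->] := marking_uniq p (@markP L) xP.
have [k Hk ->] := marking_uniq q (@markP L) xP.
rewrite invgM mulgA -[h * x p * _]mulgA dist_mul //.
by have [_ _] := lab_subgp L q; apply.
Qed.

Lemma dist_eq (H H' : 'I_n -> set G) (fpH : is_free_product H) (fpH' : is_free_product H') p q u :
  H = H' -> dist fpH p q u = dist fpH' p q u.
Proof. by move=> E; case: _ / E fpH' => fpH'; rewrite (Prop_irrelevance fpH fpH'). Qed.

Lemma norm_conj L L' (g : G) : lb L' = cj (lb L) (fun=> g) -> norm L' = norm L.
Proof.
move=> E; have xP := @markP L.
have yP : marking (lb L') (fun i => g^-1 * mark L i).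
  by move=> i; rewrite E /cj -conj_setM mulgA mulgV mul1g -xP.
rewrite (normE yP) /norm; apply: eq_bigr => p _; apply: eq_bigr => q pq.
have [w gw] := geod_ex (lab_fp L) p q (mark L p * (mark L q)^-1).
rewrite (distE (lab_fp L) pq gw) -(size_map (fun l => (l.1, l.2 ^ g)) w).
apply: distE => //; have [Hw pw wq [h [k [Hh Hk uE]]]] := gw; rewrite E; split.
- exact: rword_conj.
- by case: w pw {gw Hw wq uE}.
- by case: w wq {gw Hw pw uE} => //= l w; rewrite last_map.
- exists (h ^ g), (k ^ g); split; try exact: (cj_mem (fun=> g)).
  rewrite wprod_conj -!conjMg -uE conjgE; rewrite invgM invgK.
  by rewrite !mulgA.
Qed.

(** * The norm along moves from a fixed labelling *)

Section Moves.
Variables (L0 : lab).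
Let H := lb L0.
Let x := mark L0.
Let xP : marking H x := @markP L0.
Let fpH : is_free_product H := lab_fp L0.

Let word p q := projT1 (cid (geod_ex fpH p q (x p * (x q)^-1))).
Let wordP p q : geod H p q (x p * (x q)^-1) (word p q).
Proof. by rewrite /word; case: cid. Qed.

Let norm0 : norm L0 = (\sum_p \sum_(q | p != q) size (word p q))%N.
Proof.
apply: eq_bigr => p _; apply: eq_bigr => q pq.
exact: (distE _ pq (wordP p q)).
Qed.

Let marking_cj f L : lb L = cj H f -> marking (lb L) (fun i => (f i)^-1 * x i).
Proof. by move=> E i; rewrite E /cj -conj_setM mulgA mulgV mul1g -xP. Qed.

Let cost0 i f p q := cost i f (start i f p q (word p q)) q (word p q).

Let uE f p q : ((f p)^-1 * x p) * ((f q)^-1 * x q)^-1 = (f p)^-1 * (x p * (x q)^-1) * f q.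
Proof. by rewrite invgM invgK !mulgA. Qed.

Lemma norm_move i f L : (forall a, H i (f a)) -> f i = 1 -> lb L = cj H f ->
  norm L = (\sum_p \sum_(q | p != q) cost0 i f p q)%N.
Proof.
move=> Hf fi E; rewrite (normE (marking_cj E)).
apply: eq_bigr => p _; apply: eq_bigr => q pq; rewrite uE.
have fp' : is_free_product (cj H f) by rewrite -E; exact: lab_fp.
by rewrite (dist_eq _ fp' _ _ _ E) (dist_move fpH fp' Hf fi pq (wordP p q)).
Qed.

Let word_alt p q : p != q -> path (fun i j => i != j) p (rcons [seq l.1 | l <- word p q] q).
Proof.
move=> pq; have [Hw pw wq _] := wordP p q; move: (word p q) Hw pw wq => w.
rewrite rcons_path; case: w => [|l w] //= [_ _ lw Hw] ->; rewrite last_map => -> /=.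
rewrite andbT {pq}; elim: w l lw Hw => //= l' w IHw l -> [_ _ lw Hw] /=.
exact: IHw.
Qed.

(** [peak_word] covers the paths that begin outside the two operating factors. [key] treats [p = i],
    where [start] makes the first emission trivial, and [p = j] is its mirror image. *)
Lemma cost_peak i j f g p q : i != j -> p != q -> f i = 1 -> f j = 1 -> g i = 1 -> g j = 1 ->
  (cost0 i (off f g) p q + cost0 j (off g f) p q <= cost0 i f p q + cost0 j g p q)%N.
Proof.
have key i' j' f' g' : i' != j' -> p != q -> f' i' = 1 -> f' j' = 1 -> g' i' = 1 ->
  g' j' = 1 -> p = i' ->
  (cost0 i' (off f' g') p q + cost0 j' (off g' f') p q <= cost0 i' f' p q + cost0 j' g' p q)%N.
  move=> {f g i j} ij pq fi fj gi gj pi.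
  have := word_alt pq; rewrite /cost0 /start; rewrite pi in pq *.
  have oi : off g' f' i' = 1 by rewrite /off gi fi eqxx.
  have oj : off f' g' j' = 1 by rewrite /off fj gj eqxx.
  rewrite eqxx (negbTE ij) oi gi invg1.
  case: (word i' q) => [|[b t] w] /= => [_|/andP[ib bw]].
    rewrite !cost_nil eq_sym (negbTE pq) !mulVg !eqxx !add0n !mul1g.
    by case: (q == j') => //; rewrite /off; case: (f' q == 1); rewrite ?eqxx.
  rewrite !cost_cons eq_sym (negbTE ib) !mulVg !eqxx !add0n !mul1g.
  have ji : j' != i' by rewrite eq_sym.
  have bi : b != i' by rewrite eq_sym.
  have [bj|bj] := eqVneq b j'.
    rewrite bj oj fj invg1 in bw *; have [_ /(_ ij t bw)] := peak_word w q i' ji gj gi fj fi.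
    rewrite oi gi fi invg1 !mul1g eqxx andbF addn0.
    by gen_lia cost.
  have [/(_ bi bj bw) + _] := peak_word w q b ij fi fj gi gj.
  have : ((off g' f' b != 1)%g <= (g' b != 1)%g)%N.
    by rewrite /off; case: (f' b == 1); rewrite ?eqxx.
  by gen_lia cost.
move=> ij pq fi fj gi gj; have ji : j != i by rewrite eq_sym.
have [/key|pi] := eqVneq p i; first exact.
have [pj|pj] := eqVneq p j; first by rewrite addnC [leqRHS]addnC; exact: key.
have [/(_ pi pj (word_alt pq)) + _] := peak_word (word p q) q p ij fi fj gi gj.
by rewrite /cost0 /start (negbTE pi) (negbTE pj).
Qed.

Lemma cost_comm i j f g p q L : i != j -> p != q -> disj f g ->
  f i = 1 -> f j = 1 -> g i = 1 -> g j = 1 ->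
  (forall b, H i (f b)) -> (forall b, H j (g b)) -> lb L = cj H (fun b => f b * g b) ->
  (dist (lab_fp L) p q ((f p * g p)^-1 * (x p * (x q)^-1) * (f q * g q)) +
   size (word p q) <= cost0 i f p q + cost0 j g p q)%N.
Proof.
have sH a : subgp (H a) by exact: fp_subgp fpH a.
have key i' j' f' g' : i' != j' -> p != q -> disj f' g' -> f' i' = 1 -> f' j' = 1 ->
  g' i' = 1 -> g' j' = 1 -> (forall b, H i' (f' b)) -> (forall b, H j' (g' b)) -> p = i' ->
  exists h W k, [/\ lw (cj H (fun b => f' b * g' b)) W,
    cj H (fun b => f' b * g' b) p h, cj H (fun b => f' b * g' b) q k,
      (size W + size (word p q) <= cost0 i' f' p q + cost0 j' g' p q)%N &
      h * wprod W * k = (f' p * g' p)^-1 * wprod (word p q) * (f' q * g' q)].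
  move=> {f g i j} ij pq d fi fj gi gj Hf Hg pi.
  have := word_alt pq; rewrite pi /cost0 /start eqxx (negbTE ij) gi invg1 -pi.
  have Hw : lw H (word p q) by have [/lw_rword] := wordP p q.
  have [_] := comm_word sH q p ij d fi fj gi gj Hf Hg Hw.
  move: (f' (head q _)) (Hf (head q [seq l.1 | l <- word p q])) => z Hz.
  have [_ _ V] := sH i'; rewrite pi => /(_ z^-1 (V _ Hz)) + al => /(_ al).
  move=> [W [k [HW Hk sW E]]]; exists z, W, k; split=> //.
    by rewrite /cj ?pi fi ?gi mulg1 conj_set1.
  by rewrite -mulgA E ?pi fi ?gi mulg1 invg1 mul1g !mulgA mulgV mul1g.
move=> ij pq d fi fj gi gj Hf Hg E; have ji : j != i by rewrite eq_sym.
have [h [W [k [HW Hh Hk sW EW]]]] : exists h W k, [/\ lw (cj H (fun b => f b * g b)) W,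
    cj H (fun b => f b * g b) p h, cj H (fun b => f b * g b) q k,
      (size W + size (word p q) <= cost0 i f p q + cost0 j g p q)%N &
      h * wprod W * k = (f p * g p)^-1 * wprod (word p q) * (f q * g q)].
  have [pi|pi] := eqVneq p i; first exact: key.
  have [pj|pj] := eqVneq p j.
    have [h [W [k]]] := key j i g f ji pq (disjC d) gj gi fj fi Hg Hf pj.
    rewrite -(disj_comm q d) -(disj_comm p d).
    have -> : cj H (fun b => g b * f b) = cj H (fun b => f b * g b).
      by congr cj; apply/funext => c; rewrite [RHS]disj_comm.
    by rewrite addnC [leqRHS]addnC [X in (X <= _)%N]addnC => P; exists h, W, k.
  have Hw : lw H (word p q) by have [/lw_rword] := wordP p q.
  have [/(_ pi pj (word_alt pq)) [W [k [HW Hk sW EW]]] _] :=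
    comm_word sH q p ij d fi fj gi gj Hf Hg Hw.
  exists 1, W, k; split=> //; last by rewrite mul1g.
    by case: (subgp_conj (f p * g p) (sH p)).
  by rewrite /cost0 /start (negbTE pi) (negbTE pj).
apply: leq_trans sW; rewrite leq_add2r.
have [_ _ _ [h1 [k1 [Hh1 Hk1 ->]]]] := wordP p q.
have sL a : subgp (lb L a) by exact: lab_subgp.
apply: (@dist_le _ _ _ (lab_fp L) p q _ W (h1 ^ (f p * g p) * h) (k * k1 ^ (f q * g q))) => //.
- by rewrite E.
- have [_ M _] := sL p; apply: M; rewrite E //.
  exact: (cj_mem (fun b => f b * g b)).
- have [_ M _] := sL q; apply: M; rewrite E //.
  exact: (cj_mem (fun b => f b * g b)).
rewrite [RHS]mulgA -[_ * h * wprod W]mulgA -[_ * (h * wprod W) * k]mulgA EW !conjgE.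
move: (f p * g p) (f q * g q) => A B.
by rewrite !mulgA !mulgK.
Qed.

(** A submodularity property of the norm on a commuting square: if [L1] is not above [L0] and [L2]
    is strictly below it, then the opposite corner [L] is strictly below as well. *)
Lemma norm_comm i j f g L L1 L2 : i != j -> disj f g ->
  f i = 1 -> f j = 1 -> g i = 1 -> g j = 1 ->
  (forall b, H i (f b)) -> (forall b, H j (g b)) -> lb L = cj H (fun b => f b * g b) ->
  lb L1 = cj H f -> lb L2 = cj H g -> (norm L + norm L0 <= norm L1 + norm L2)%N.
Proof.
move=> ij d fi fj gi gj Hf Hg E E1 E2.
rewrite (norm_move Hf fi E1) (norm_move Hg gj E2) norm0 (normE (marking_cj E)) /normx.
rewrite -!big_split; apply: leq_sum => p _; rewrite -!big_split; apply: leq_sum => q pq.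
have := cost_comm ij pq d fi fj gi gj Hf Hg E.
by rewrite -(uE (fun b => f b * g b)).
Qed.

Lemma norm_peak i j f g L1 L2 L1' L2' : i != j ->
  f i = 1 -> f j = 1 -> g i = 1 -> g j = 1 ->
  (forall b, H i (f b)) -> (forall b, H j (g b)) ->
  lb L1 = cj H f -> lb L2 = cj H g ->
  lb L1' = cj H (off f g) -> lb L2' = cj H (off g f) ->
  (norm L1' + norm L2' <= norm L1 + norm L2)%N.
Proof.
move=> ij fi fj gi gj Hf Hg E1 E2 E1' E2'.
have sH a : subgp (H a) by exact: fp_subgp fpH a.
have Hf' b : H i (off f g b) by rewrite /off; case: ifP => // _; case: (sH i).
have Hg' b : H j (off g f b) by rewrite /off; case: ifP => // _; case: (sH j).
have fi' : off f g i = 1 by rewrite /off gi eqxx.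
have gj' : off g f j = 1 by rewrite /off fj eqxx.
rewrite (norm_move Hf fi E1) (norm_move Hg gj E2) (norm_move Hf' fi' E1') (norm_move Hg' gj' E2').
rewrite -!big_split; apply: leq_sum => p _; rewrite -!big_split; apply: leq_sum => q pq.
exact: cost_peak.
Qed.

End Moves.

Definition eqA L L' := exists g : G, lb L' = cj (lb L) (fun=> g).

(** The equivalence of labellings for the tree of shape A with basepoint [i], written without trees;
    see [adjA_Av]. *)
Definition adjA i L L' := exists g : 'I_n -> G,
  (forall a, a != i -> lb L i (g a * (g i)^-1)) /\ lb L' = cj (lb L) g.

(** A nontrivial [v] would give either a reduced word of length two equal to [t], or a nontrivial
    element common to [H b] and [H c]. *)
Lemma three_letters (H : 'I_n -> set G) a b c (u v t : G) : is_free_product H -> a != b ->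
  a != c -> b != c ->
  H a u -> H b v -> H c t -> u * v = t -> v = 1.
Proof.
move=> fpH ab ac bc Hu Hv Ht E; apply: contrapT => v1.
have [u1|u1] := eqVneq u 1.
  apply: v1; apply: (fp_disjoint fpH Hv _ bc).
  by move: E; rewrite u1 mul1g => ->.
have R : rword H [:: (a, u); (b, v)] by split=> //; exact/eqP.
have := nf_wprod fpH R; rewrite !wprod_cons wprod0 mulg1 /= E => Et.
have [t1|t1] := eqVneq t 1; first by move: Et; rewrite t1 nf1.
by move: Et; rewrite (nf_letter fpH Ht) //; exact/eqP.
Qed.

(** Norm zero puts each [x p * (x q)^-1] in the product of [H p] and [H q]. With [g] chosen so that
    [x i0 * g^-1] and [x i1 * g^-1] lie in their own factors, any other [x a * g^-1] is an element
    of [H a] times one of [H i0], and also one of [H a] times one of [H i1]; [three_letters] leaves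
    only [H a]. *)
Lemma norm0_trivial L : (3 <= n)%N -> norm L = 0 -> exists g : G, lb L = cj Gs (fun=> g).
Proof.
move=> n3 N0; pose i0 := Ordinal (ltn_trans (ltnSn 0) (ltn_trans (ltnSn 1) n3)).
pose i1 := Ordinal (ltn_trans (ltnSn 1) n3).
set x := mark L; set H := lb L; have xP : marking H x := @markP L.
pose fpH := lab_fp L; have sH a : subgp (H a) := lab_subgp L a.
have hk p q : p != q -> exists h k, [/\ H p h, H q k & x p * (x q)^-1 = h * k].
  move=> pq; have [w gw] := geod_ex fpH p q (x p * (x q)^-1).
  suff w0 : w = [::].
    have [_ _ _ [h [k [Hh Hk E]]]] := gw; exists h, k; split=> //.
    by rewrite E w0 wprod0 mulg1.
  apply/nilP; rewrite /nilp -(distE fpH pq gw) -leqn0 -N0 /norm /normx.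
  rewrite (bigD1 p) //=; apply: leq_trans (leq_addr _ _).
  by rewrite (bigD1 q) //= leq_addr.
have [//|h [k [Hh Hk E01]]] := hk i0 i1.
pose g := h^-1 * x i0.
have y0 : x i0 * g^-1 = h by rewrite invgM invgK mulVKg.
have y1 : x i1 * g^-1 = k^-1.
  apply: invg_inj; rewrite invgM !invgK -mulgA E01 mulKg //.
have y a : H a (x a * g^-1).
  have [->|a0] := eqVneq a i0; first by rewrite y0.
  have [->|a1] := eqVneq a i1; first by rewrite y1; have [_ _] := sH i1; apply.
  have [u [v [Hu Hv Ea0]]] := hk _ _ a0; have [r [t [Hr Ht Ea1]]] := hk _ _ a1.
  have ya0 : x a * g^-1 = u * (v * h).
    by rewrite mulgA -Ea0 -y0 mulgA mulgVK.
  have ya1 : x a * g^-1 = r * (t * k^-1).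
    by rewrite mulgA -Ea1 -y1 mulgA mulgVK.
  have [_ M0 V0] := sH i0; have [_ M1 V1] := sH i1; have [_ Ma Va] := sH a.
  have /(three_letters fpH a0 a1 isT) : (r^-1 * u) * (v * h) = t * k^-1.
    by rewrite -mulgA -ya0 ya1 mulKg.
  move=> vh; rewrite ya0 vh ?mulg1 //; [exact: Ma (Va _ Hr) Hu|exact: M0|].
  exact: M1 Ht (V1 _ Hk).
exists g^-1; apply/funext => a; rewrite /cj (xP a) -conj_setM.
by rewrite conj_set_id.
Qed.

(** A global conjugation does not change the star, so the move can be normalised to fix the factor
    [j] too. For the factor [i] itself, conjugating by [g j] or by [g i] is the same, as they differ
    by an element of [H i]. Two moves normalised in this way can be performed in either order. *)
Lemma adj_normal i j L L' : i != j -> adjA i L L' ->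
  exists f (c : G), [/\ forall a, lb L i (f a), f i = 1, f j = 1 &
    lb L' = cj (cj (lb L) f) (fun=> c)].
Proof.
move=> ij [g [Hg E]]; have [_ M V] := lab_subgp L i.
have ji : j != i by rewrite eq_sym.
exists (fun a => if a == i then 1 else g a * (g j)^-1), (g j); split.
- move=> a; case: eqP => [_|/eqP ai]; first by case: (lab_subgp L i).
  rewrite (_ : _ * _ = (g a * (g i)^-1) * (g j * (g i)^-1)^-1).
    exact: M (Hg _ ai) (V _ (Hg _ ji)).
  by rewrite invgM invgK mulgA mulgVK.
- by rewrite eqxx.
- by rewrite (negbTE ji) mulgV.
rewrite E cjM; apply/funext => a; rewrite /cj.
have [->|ai] := eqVneq a i; last by rewrite mulgVK.
rewrite mul1g -[g j](mulgVK (g i)) conj_setM [conj_set _ (g j * _)]conj_set_id //; last exact: Hg.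
exact: lab_subgp.
Qed.

(** By [norm_peak] the two moves without common support have norms of sum less than [2 * norm L0],
    so one of them is strictly below [L0]. It is paired with the full move on the other side, which
    makes the supports disjoint, and [norm_comm] bounds the fourth corner. Only [M1] may fail to be
    strictly lower, and then it is [L1] up to conjugation. *)
Lemma peak i j L0 L1 L2 : i != j -> adjA i L0 L1 -> adjA j L0 L2 ->
  (norm L1 <= norm L0)%N -> (norm L2 < norm L0)%N ->
  exists f g M1 M2 M3,
   [/\ (forall a, lb L0 i (f a)), (forall a, lb L0 j (g a)) & disj f g] /\
   [/\ f i = 1, f j = 1, g i = 1 & g j = 1] /\
   [/\ lb M1 = cj (lb L0) f, lb M2 = cj (lb L0) g & lb M3 = cj (lb L0) (fun a => f a * g a)] /\
   [/\ eqA M1 L1 \/ norm M1 < norm L0, norm M2 < norm L0 & norm M3 < norm L0]%N.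
Proof.
move=> ij A1 A2 N1 N2; have ji : j != i by rewrite eq_sym.
have [f [c [Hf fi fj E1]]] := adj_normal ij A1.
have [g [d [Hg gj gi E2]]] := adj_normal ji A2.
have sH a : subgp (lb L0 a) by exact: lab_subgp.
have [Mf EMf] := lab_move Hf fi; have [Mg EMg] := lab_move Hg gj.
have Hf' b : lb L0 i (off f g b) by rewrite /off; case: ifP => // _; case: (sH i).
have Hg' b : lb L0 j (off g f b) by rewrite /off; case: ifP => // _; case: (sH j).
have fi' : off f g i = 1 by rewrite /off gi eqxx.
have gj' : off g f j = 1 by rewrite /off fj eqxx.
have fj' : off f g j = 1 by rewrite /off gj eqxx.
have gi' : off g f i = 1 by rewrite /off fi eqxx.
have [Mf' EMf'] := lab_move Hf' fi'; have [Mg' EMg'] := lab_move Hg' gj'.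
have Nf : norm Mf = norm L1 by symmetry; apply: (@norm_conj _ _ c); rewrite E1 EMf.
have Ng : norm Mg = norm L2 by symmetry; apply: (@norm_conj _ _ d); rewrite E2 EMg.
have := norm_peak ij fi fj gi gj Hf Hg EMf EMg EMf' EMg'; rewrite Nf Ng => NP.
have comp f1 g1 : disj f1 g1 -> (forall a, lb L0 i (f1 a)) -> (forall a, lb L0 j (g1 a)) ->
    f1 i = 1 -> g1 j = 1 -> f1 j = 1 -> g1 i = 1 ->
    exists M, lb M = cj (lb L0) (fun a => f1 a * g1 a).
  move=> d1 Hf1 Hg1 f1i g1j f1j g1i; have [M EM] := lab_move Hf1 f1i.
  have Hg1' a : lb M j (g1 a) by rewrite EM /cj f1j conj_set1.
  by have [M' EM'] := lab_move Hg1' g1j; exists M'; rewrite EM' EM cjM.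
have [small|big] := ltnP (norm Mg') (norm L0).
  have dj : disj f (off g f).
    by move=> a; rewrite /off; case: eqP => [->|_]; [left|right].
  have [M3 EM3] := comp _ _ dj Hf Hg' fi gj' fj gi'.
  exists f, (off g f), Mf, Mg', M3; split=> //; split=> //; split=> //; split=> //.
    by left; exists c; rewrite E1 EMf.
  have := norm_comm ij dj fi fj gi' gj' Hf Hg' EM3 EMf EMg'.
  rewrite Nf; lia.
have dj : disj (off f g) g.
  by move=> a; rewrite /off; case: eqP => [->|_]; [right|left].
have small : (norm Mf' < norm L0)%N by lia.
have [M3 EM3] := comp _ _ dj Hf' Hg fi' gj fj' gi.
exists (off f g), g, Mf', Mg, M3; split=> //; split=> //; split=> //; split.
- by right.
- by rewrite Ng.
- have := norm_comm ij dj fi' fj' gi gj Hf' Hg EM3 EMf' EMg.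
  rewrite Ng; lia.
Qed.

End Labellings.

(** * Nielsen reduction connects all labellings to the given splitting *)

Section Connectivity.
Local Open Scope classical_set_scope.
Local Open Scope group_scope.
Variables (G : groupType) (n : nat) (Gs : 'I_n -> set G).
Hypothesis hG : is_free_product Gs.
Hypothesis hnt : forall i, Gs i <> [set 1].
Implicit Types (i j a b p q : 'I_n) (w : seq ('I_n * G)) (x : 'I_n -> G).
Let sG : forall i, subgp (Gs i) := fp_subgp hG.

Lemma lab0_ex : exists L : lab Gs, lb L = Gs.
Proof.
suff P : is_labelling Gs Gs by exists (exist _ _ P).
by split=> // i; exists 1; rewrite conj_set1.
Qed.

Definition conn : lab Gs -> lab Gs -> Prop :=
  clos_refl_trans (lab Gs) (fun L L' => exists i, adjA i L L').

Notation nf := (nf hG).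

Definition nielsen_reduced x := forall i a,
  hdne i (nf (x i)) /\ (i != a -> forall w s, nf (x a) <> w ++ (i, s) :: nf (x i)).

(* Common suffixes are the only cancellation in the product of a reduced word and
   the inverse of another one. *)
Lemma suffix_split w w' : exists u v z, [/\ w = u ++ z, w' = v ++ z &
  [\/ u = [::], v = [::] | exists u' l v' l', [/\ u = rcons u' l, v = rcons v' l' & l <> l']]].
Proof.
elim/last_ind: w w' => [|w l IHw] w'; first by exists [::], w', [::]; split; rewrite ?cats0 //;
  constructor 1.
case/lastP: w' => [|w' l']; first by exists (rcons w l), [::], [::]; split; rewrite ?cats0 //;
  constructor 2.
have [ll|ll] := pselect (l = l'); last first.
  exists (rcons w l), (rcons w' l'), [::]; split; rewrite ?cats0 //.
  by constructor 3; exists w, l, w', l'.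
have [u [v [z [-> -> uv]]]] := IHw w'.
by exists u, v, (rcons z l); split; rewrite -?rcons_cat // ll.
Qed.

Lemma hdne_catl i w w' : hdne i (w ++ w') -> hdne i w.
Proof. by case: w. Qed.

Lemma rword_rcons (H : 'I_n -> set G) w l : rword H (rcons w l) ->
  rword H w /\ lstne w l.1.
Proof.
rewrite -cats1 => Hw; split; first exact: rword_catl Hw.
elim: w Hw => //= l' w IHw; case: w IHw => [_ [_ _]|l'' w IHw [_ _ _]] //=.
Qed.

(** After cancellation of the common suffix, the first index is that of [nf (x i)], which the first
    clause keeps away from [i], unless all of [nf (x i)] is cancelled. In that case it is the index
    preceding this suffix in [nf (x j)], and the second clause applies. *)
Lemma reduced_quotient x i j : nielsen_reduced x -> i != j ->
  hdne i (nf (x i * (x j)^-1)).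
Proof.
move=> red ij; have [hi ni] := red i j; have [hj nj] := red j i.
have := nf_rword hG (x i); have := nf_rword hG (x j).
rewrite -{2}(nfK hG (x i)) -{2}(nfK hG (x j)) => Rj Ri.
have [u [v [z [Ei Ej uv]]]] := suffix_split (nf (x i)) (nf (x j)).
rewrite Ei Ej !wprod_cat invgM mulgA mulgK -wprod_winv -wprod_cat.
have Ru : rword Gs u by apply: (@rword_catl _ _ _ u z); rewrite -Ei.
have Rv : rword Gs v by apply: (@rword_catl _ _ _ v z); rewrite -Ej.
have Rv' := rword_winv sG Rv.
have hu : hdne i u by apply: (@hdne_catl i u z); rewrite -Ei.
case: uv => [u0|v0|[u' [l [v' [l' [Eu Ev ll]]]]]].
- rewrite u0 /= nf_wprod // hdne_winv.
  case/lastP: v Ej {Rv Rv'} => // v [b s] Ej; rewrite lstne_rcons /=.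
  apply/negP => /eqP bi; apply: (ni ij v s).
  by rewrite Ej Ei u0 cat_rcons bi.
- by rewrite v0 cats0 nf_wprod.
have [Ru' lu'] : rword Gs u' /\ lstne u' l.1 by apply: rword_rcons; rewrite -Eu.
have [Rv1 lv'] : rword Gs v' /\ lstne v' l'.1 by apply: rword_rcons; rewrite -Ev.
have Rl : rword Gs [:: l] by rewrite Eu -cats1 in Ru; exact: rword_catr Ru.
have Rl' : rword Gs [:: l'] by rewrite Ev -cats1 in Rv; exact: rword_catr Rv.
have [E|E] := eqVneq l.1 l'.1; last first.
  rewrite nf_wprod; first by move: hu; rewrite Eu; case: (u').
  apply: rword_cat => //; rewrite Ev -cats1 winv_cat /=.
  by rewrite Eu lstne_rcons.
case: l l' ll lu' lv' Rl Rl' Eu Ev E => [b s] [c t] /= ll lu' lv' [/= Hs s1 _ _] [/= Ht t1 _ _]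
  Eu Ev E.
rewrite -E in Ht lv' Ev ll.
have st : s * t^-1 <> 1.
  by move=> /eqP; rewrite mulg_eq1 invgK => /eqP st; apply: ll; rewrite st.
have -> : wprod (u ++ winv v) = wprod (u' ++ (b, s * t^-1) :: winv v').
  rewrite Eu Ev -!cats1 winv_cat -catA !wprod_cat wprod_cons; congr (_ * _).
  by rewrite /winv /= [LHS]mulgA !wprod_cons !wprod0 /= !mulg1.
rewrite nf_wprod; first by move: hu; rewrite Eu; case: (u').
apply: rword_cat => //; split=> //=.
- by have [_ M V] := sG b; exact: M Hs (V _ Ht).
- by rewrite hdne_winv.
- exact: rword_winv.
Qed.

Lemma conj_ne1 (g h : G) : h <> 1 -> g * h * g^-1 <> 1.
Proof.
move=> h1 E; apply: h1; have -> : h = g^-1 * (g * h * g^-1) * g by rewrite -mulgA mulgVK mulKg.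
by rewrite E mulg1 mulVg.
Qed.

(** A syllable of [H i] is a letter of [Gs i] conjugated by [x i]. Between two consecutive such
    letters stands [x i * (x j)^-1], whose normal form does not start with [i] nor end with [j] by
    [reduced_quotient], so no letter is lost. *)
Lemma reduced_word_nf x (H : 'I_n -> set G) w i h : nielsen_reduced x ->
  (forall a, H a = conj_set (Gs a) (x a)) -> rword H ((i, h) :: w) ->
  exists s R, rword Gs ((i, s) :: R) /\ x i * wprod ((i, h) :: w) = wprod ((i, s) :: R).
Proof.
move=> red HE; elim: w i h => [|[j k] w IHw] i h [/= Hh h1 hd Hw].
  have {}Hh : Gs i (x i * h * (x i)^-1).
    by move: Hh; rewrite HE conj_setE conjgE invgK mulgA.
  exists (x i * h * (x i)^-1), (nf (x i)); split; last first.
    by rewrite !wprod_cons wprod0 mulg1 /= nfK mulgVK.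
  split=> //=; last exact: nf_rword; last by case: (red i i).
  by apply: conj_ne1 => //.
have ij : i != j by [].
have [s [R [HR E]]] := IHw j k Hw.
have {}Hh : Gs i (x i * h * (x i)^-1).
  by move: Hh; rewrite HE conj_setE conjgE invgK mulgA.
exists (x i * h * (x i)^-1), (nf (x i * (x j)^-1) ++ (j, s) :: R); split.
  split=> /=; first by [].
  - exact: conj_ne1.
  - have := reduced_quotient red ij; case: (nf _) => //= _; exact: ij.
  - apply: rword_cat => //; first exact: nf_rword.
    have := nf_rword hG (x j * (x i)^-1).
    have ji : j != i by rewrite eq_sym.
    have := reduced_quotient red ji; rewrite -[x j * _]invgK invgF nfV hdne_winv //.
rewrite [RHS]wprod_cons wprod_cat -E nfK [in LHS]wprod_cons /= !mulgA.
by rewrite !mulgVK.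
Qed.

(** A nontrivial [z] of [Gs a] is a word over the labelling, say with first index [i]. Its normal
    form over [Gs] is then the inverse of [nf (x i)], a letter of index [i] and a remainder. Its
    length is one, so [nf (x i)] is empty and [i = a]. *)
Lemma reduced_trivial x (L : lab Gs) : nielsen_reduced x ->
  (forall a, lb L a = conj_set (Gs a) (x a)) -> forall a, x a = 1.
Proof.
move=> red HE a; have [z Hz z1] := nontriv hG (hnt (i := a)).
have [w [Hw wz]] := nf_ex (lab_fp L) z.
case: w Hw wz => [|[i h] w] Hw wz; first by rewrite wprod0 in wz; case: z1.
have [s [R [HR E]]] := reduced_word_nf red HE Hw.
have Rw : rword Gs (winv (nf (x i)) ++ (i, s) :: R).
  apply: rword_cat => //; first by apply: rword_winv => //; exact: nf_rword.
  by rewrite lstne_winv; case: (red i i).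
have := nf_letter hG Hz z1; rewrite -wz -[wprod _](mulKg (x i)) E.
rewrite -{1}(nfK hG (x i)) -wprod_winv -wprod_cat nf_wprod //.
case Ex: (nf (x i)) => [|l v] /=.
  case=> ia _ _; rewrite -ia -(nfK hG (x i)) Ex wprod0 //.
move=> /(congr1 size); rewrite size_cat size_winv /=; lia.
Qed.

Lemma nielsen_step (L : lab Gs) x : (forall a, lb L a = conj_set (Gs a) (x a)) ->
  ~ nielsen_reduced x -> exists L' y, [/\ conn L L',
    (forall a, lb L' a = conj_set (Gs a) (y a)) &
    (\sum_a size (nf (y a)) < \sum_a size (nf (x a)))%N].
Proof.
move=> HE nred.
have upd_lt a (c : G) : (size (nf c) < size (nf (x a)))%N ->
    (\sum_b size (nf (if b == a then c else x b)) < \sum_b size (nf (x b)))%N.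
  move=> lt; rewrite (bigD1 a) //= [ltnRHS](bigD1 a) //= eqxx -addSn leq_add //.
  by apply: leq_sum => b /negbTE ->.
have [[a na]|ha] := pselect (exists a, ~~ hdne a (nf (x a))).
  have Rx := nf_rword hG (x a); have xK := nfK hG (x a).
  case Ex: (nf (x a)) na Rx xK => [//|[b s] w] /=; rewrite negbK => /eqP ab [/= Hs s1 bw Hw] xK.
  exists L, (fun b => if b == a then wprod w else x b); split; first exact: rt_refl.
    move=> c; rewrite HE; case: eqP => // ->; rewrite -xK wprod_cons /= conj_setM.
    by rewrite ab (conj_set_id (sG b) Hs).
  by apply: upd_lt; rewrite nf_wprod // Ex.
have [[i [a [ia [w [s Ex]]]]]|no] :=
    pselect (exists i a, i != a /\ exists w s, nf (x a) = w ++ (i, s) :: nf (x i)); last first.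
  exfalso; apply: nred => i a; split.
    by apply/negPn/negP => na; apply: ha; exists i.
  by move=> ia w s E; apply: no; exists i, a; split=> //; exists w, s.
have xa : x a = wprod w * s * x i.
  by rewrite -(nfK hG (x a)) Ex wprod_cat wprod_cons nfK /= mulgA.
have Rx : rword Gs (w ++ (i, s) :: nf (x i)) by rewrite -Ex; exact: nf_rword.
have [/= Hs _ _ _] := rword_catr Rx.
(* This element lies in [lb L i], and conjugating the factor [a] by it deletes the letter [s] from
   [x a = wprod w * s * x i]. *)
pose f b : G := if b == a then s^-1 ^ x i else 1.
have Hf b : lb L i (f b).
  rewrite HE conj_setE /f; case: eqP => _; last by rewrite conj1g; case: (sG i).
  by rewrite conjgK; have [_ _] := sG i; apply.
have fi : f i = 1 by rewrite /f (negbTE ia).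
have [L' EL'] := lab_move Hf fi.
exists L', (fun b => if b == a then wprod w * x i else x b); split.
- apply: rt_step; exists i, f; split=> // b _.
  by rewrite fi invg1 mulg1.
- move=> b; rewrite EL' /cj HE -conj_setM /f; case: eqP => [->|_]; last by rewrite mulg1.
  by rewrite xa conjgE !mulgA !mulgK.
- apply: upd_lt; rewrite Ex size_cat /=.
  have -> : wprod w * x i = wprod (w ++ nf (x i)) by rewrite wprod_cat nfK.
  have lwx : lw Gs (w ++ nf (x i)).
    move=> l; rewrite mem_cat => /orP[] lx.
      exact: (lw_rword (rword_catl Rx)).
    exact: (lw_rword (nf_rword hG (x i))).
  have := nf_size hG lwx; rewrite size_cat; lia.
Qed.

Lemma lab_connected (L0 L : lab Gs) : lb L0 = Gs -> conn L L0.
Proof.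
move=> E0.
have /choice[x xP] : forall a, exists g, lb L a = conj_set (Gs a) g.
  by case: L => H [].
have [m] := ubnP (\sum_a size (nf (x a))); elim: m L x xP => // m IHm L x xP xm.
have [red|nred] := pselect (nielsen_reduced x).
  suff -> : L = L0 by exact: rt_refl.
  apply: lab_inj; rewrite -/(lb L) -/(lb L0) E0; apply/funext => a.
  by rewrite xP (reduced_trivial red xP) conj_set1.
have [L' [y [LL' yP lt]]] := nielsen_step xP nred.
apply: (rt_trans _ _ _ _ _ LL'); apply: (IHm _ y) => //.
by apply: leq_trans lt _; rewrite -ltnS.
Qed.
End Connectivity.

(** * Labelled trees *)

Section Trees.
Variable n : nat.
Implicit Types S T X Y : btree n.

Lemma tree_parent_neq S (v : vert S) : is_tree S -> v <> base S -> parent v <> v.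
Proof.
move=> [_ +] vb vp => /(_ v)[k]; suff -> : iter k (@parent n S) v = v by [].
by elim: k => //= k ->.
Qed.

Lemma tree_parent2_neq S (v : vert S) : is_tree S -> v <> base S ->
  parent (parent v) <> v.
Proof.
move=> [pb +] vb vp => /(_ v)[k].
have pvb : parent v <> base S by move=> E; apply: vb; rewrite -vp E.
suff [->|->] : iter k (@parent n S) v = v \/ iter k (@parent n S) v = parent v by [].
by elim: k => [|k [] /= ->]; [left|right|left].
Qed.

Lemma iso_refl S : is_iso (id : vert S -> vert S).
Proof. by split=> //; exists id. Qed.

Lemma iso_comp S T X (f : vert S -> vert T) (g : vert T -> vert X) :
  is_iso f -> is_iso g -> is_iso (g \o f).
Proof.
move=> [bf fi fb fp] [bg gi gb gp]; split=> [|i||v] /=.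
- exact: bij_comp.
- by rewrite fi gi.
- by rewrite fb gb.
- by rewrite fp gp.
Qed.

Lemma iso_inv S T (f : vert S -> vert T) : is_iso f ->
  exists2 g : vert T -> vert S, is_iso g & cancel f g /\ cancel g f.
Proof.
move=> [[g fg gf] fi fb fp]; exists g => //; split.
- by exists f.
- by move=> i; rewrite -{1}(fi i) fg.
- by rewrite -fb fg.
- by move=> v; rewrite -{1}(gf v) -fp fg.
Qed.

Lemma iso_inr S T (f : vert S -> vert T) a : is_iso f -> exists b, f (inr a) = inr b.
Proof.
move=> [bf fi _ _]; case E: (f (inr a)) => [i|b]; last by exists b.
by have := bij_inj bf; rewrite -(fi i) in E => /(_ _ _ E).
Qed.

Lemma iso_ntriv S T (f : vert S -> vert T) : is_iso f -> ntriv S = ntriv T.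
Proof.
move=> [bf _ _ _]; have := bij_eq_card bf; rewrite !card_sum !card_ord.
exact: addnI.
Qed.

Definition triv S (v : vert S) : bool := if v is inr _ then true else false.

(** The part of [collapse_edge] that does not involve labels, to be checked on explicit shapes. *)
Definition tcol X Y (v : vert X) := [/\ v <> base X, triv v || triv (parent v) &
  exists f : vert X -> vert Y,
      [/\ set_surj setT setT f,
          forall x y, f x = f y <->
            [\/ x = y, x = v /\ y = parent v | x = parent v /\ y = v],
          forall i, f (inl i) = inl i,
          f (base X) = base Y &
          forall x, x <> v -> f (parent x) = parent (f x)]].

(** [w] is the trivial endpoint that disappears, [w'] the endpoint that stays, and [s] a section of
    the contraction returning every vertex other than [w]. With these data the fibres of [f] are
    determined. *)
Lemma tcol_intro X Y (v w w' : vert X) (f : vert X -> vert Y) (s : vert Y -> vert X) :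
  v <> base X -> triv w -> w <> w' -> (w = v /\ w' = parent v) \/ (w = parent v /\ w' = v) ->
  f w = f w' -> cancel s f -> (forall x, x <> w -> s (f x) = x) ->
  (forall i, f (inl i) = inl i) -> f (base X) = base Y ->
  (forall x, x <> v -> f (parent x) = parent (f x)) -> tcol Y v.
Proof.
move=> vb tw ww' wv fw sf fs fi fb fp; split=> //.
  by case: wv tw => -[-> _] ->; rewrite ?orbT.
exists f; split=> // [y _|x y]; first by exists (s y).
split=> [fxy|].
  have [xw|xw] := pselect (x = w); have [yw|yw] := pselect (y = w).
  - by constructor 1; rewrite xw yw.
  - have : y = w' by rewrite -(fs y) // -fxy xw fw fs //; exact/nesym.
    by case: wv xw => -[-> ->] -> ->; [constructor 2|constructor 3].
  - have : x = w' by rewrite -(fs x) // fxy yw fw fs //; exact/nesym.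
    by case: wv yw => -[-> ->] -> ->; [constructor 3|constructor 2].
  - by constructor 1; rewrite -(fs x) // fxy fs.
by case=> [->//|[-> ->]|[-> ->]]; case: wv fw => -[-> ->].
Qed.

Lemma tcol_ntriv X Y (v : vert X) : is_tree X -> tcol Y v -> ntriv X = (ntriv Y).+1.
Proof.
move=> tX [vb _ [f [fs fE fi fb fp]]].
have pv : parent v != v by apply/eqP; exact: tree_parent_neq.
have : #|[set: vert Y]| = #|[set~ v]|.
  rewrite -(card_in_imset (f := f) (D := mem [set~ v])%SET); last first.
    move=> x y; rewrite !inE => /eqP xv /eqP yv /fE[//|[/xv]//|[_ /yv]//].
  apply: eq_card => y; rewrite !inE; symmetry; apply/imsetP.
  have [x _ <-] := fs y I.
  have [->|xv] := eqVneq x v.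
    by exists (parent v); rewrite ?inE //; apply/fE; constructor 2.
  by exists x; rewrite ?inE.
have : (0 < #|{: vert X}|)%N by apply/card_gt0P; exists v.
rewrite cardsT cardsC1 !card_sum !card_ord; lia.
Qed.

End Trees.

(** * Equivalence of labelled trees and its compatibility with collapses *)

Section Classes.
Local Open Scope classical_set_scope.
Local Open Scope group_scope.
Variables (G : groupType) (n : nat) (Gs : 'I_n -> set G).
Implicit Types X Y Z : ltree Gs.

Lemma ltree_subgp X (v : vert X) : subgp (vgroup v).
Proof.
case: v => [i|a] /=; first by case: (labelP X) => _ fp; exact: fp_subgp fp i.
by split=> [//|x y -> ->|x ->]; rewrite ?mulg1 ?invg1.
Qed.

Lemma equiv_iso X Y (f : vert X -> vert Y) : is_iso f -> label Y = label X ->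
  ltree_equiv X Y.
Proof.
move=> isof E; exists f, (fun=> 1); split=> // [[i|a]|v _].
- by case: isof => _ -> _ _; rewrite conj_set1 /= E.
- by have [b ->] := iso_inr a isof; rewrite conj_set1.
- by rewrite invg1 mulg1; case: (ltree_subgp (parent v : vert X)).
Qed.

Lemma lequiv_refl X : ltree_equiv X X.
Proof. by apply: (@equiv_iso X X id) => //; exact: iso_refl. Qed.

Lemma lequiv_trans X Y Z : ltree_equiv X Y -> ltree_equiv Y Z -> ltree_equiv X Z.
Proof.
move=> [f [g [isof fg fe]]] [f' [g' [isof' fg' fe']]].
have [bf fi fb fp] := isof.
exists (f' \o f), (fun v => g v * g' (f v)); split=> [|v|v vb] /=.
- exact: iso_comp.
- by rewrite fg' fg conj_setM.
have fvb : f v <> base Y by rewrite -fb => /(bij_inj bf).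
have := fe' _ fvb; rewrite -fp fg conj_setE => h.
have := fe _ vb; rewrite invgM; set A := g v; set B := g _ in h *.
set A' := g' _ in h *; set B' := g' _ in h *; move=> h'.
have -> : A * A' * (B'^-1 * B^-1) = (A * B^-1) * ((A' * B'^-1) ^ B^-1).
  by rewrite conjgE invgK !mulgA mulgVK.
by have [_ M _] := ltree_subgp (parent v : vert X); exact: M.
Qed.

Lemma lequiv_sym X Y : ltree_equiv X Y -> ltree_equiv Y X.
Proof.
move=> [f [g [isof fg fe]]]; have [f' isof' [ff' f'f]] := iso_inv isof.
have [_ _ fb fp] := isof; have [_ _ fb' fp'] := isof'.
exists f', (fun v => (g (f' v))^-1); split=> // v.
  by rewrite -{2}(f'f v) fg conj_setK.
move=> vb; have f'vb : f' v <> base X by move=> E; apply: vb; rewrite -fb -E f'f.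
have [_ _ V] := ltree_subgp (parent (f' v) : vert X).
have := V _ (fe _ f'vb); rewrite invgM invgK => h.
rewrite -{1}(f'f (parent v)) fg fp' conj_setE conjgE !invgK.
by rewrite !mulgA mulgK.
Qed.

Lemma equiv_ntriv X Y : ltree_equiv X Y -> ntriv X = ntriv Y.
Proof. by move=> [f [g [/iso_ntriv]]]. Qed.

Lemma collapse_edgeP X Y (v : vert X) : collapse_edge Y v <-> label Y = label X /\ tcol Y v.
Proof.
have tE (u : vert X) : is_trivial u <-> triv u.
  by case: u => [i|a]; split=> //; [case|exists a].
split=> [[vb tv lE fP]|[lE [vb tv fP]]]; split=> //.
  split=> //; apply/orP; case: tv => /tE ->; by [left|right].
by case/orP: tv => /tE; [left|right].
Qed.

Lemma collapse_vgroup X Y (v w : vert X) (p : vert X -> vert Y) :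
  label Y = label X -> (forall i, p (inl i) = inl i) ->
  (forall x y, p x = p y ->
            [\/ x = y, x = v /\ y = parent v | x = parent v /\ y = v]) ->
  triv w -> w = v \/ w = parent v -> forall x, x <> w -> vgroup (p x) = vgroup x.
Proof.
move=> lY pi pE tw wv [i|a] aw; first by rewrite pi /= lY.
case E: (p (inr a)) => [i|//]; exfalso; rewrite -(pi i) in E.
case/pE: E => // -[E1 E2]; case: wv => wE; move: tw aw; rewrite wE;
  by [move=> _; apply; exact: E1|rewrite -E2].
Qed.

(** The section [s] picks preimages other than the trivial endpoint [w], and [g \o s] is the new
    family of conjugators. It is admissible because the condition on an edge below a trivial vertex
    forces equal conjugators at its two ends, so a child of [w] inherits the condition of [w]. *)
Lemma collapse_class X X' Y Y' (f : vert X -> vert X') (g : vert X -> G) (v : vert X) :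
  is_iso f -> (forall v, vgroup (f v) = conj_set (vgroup v) (g v)) ->
  (forall v, v <> base X -> vgroup (parent v : vert X) (g v * (g (parent v))^-1)) ->
  collapse_edge Y v -> collapse_edge Y' (f v) -> ltree_equiv Y Y'.
Proof.
move=> isof fg fe /collapse_edgeP[lY [vb tv [p [ps pE pi pb pp]]]].
move=> /collapse_edgeP[lY' [vb' tv' [p' [ps' pE' pi' pb' pp']]]].
have [bf fi fb fp] := isof; have finj := bij_inj bf.
have pvv : parent v <> v by exact: tree_parent_neq (treeP X) vb.
have ppv : parent (parent v) <> v by exact: tree_parent2_neq (treeP X) vb.
have [w [w' [tw ww' wv]]] : exists w w' : vert X, [/\ triv w, w <> w' &
    (w = v /\ w' = parent v) \/ (w = parent v /\ w' = v)].
  by case/orP: tv => tv; [exists v, (parent v)|exists (parent v), v]; split; auto.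
have pw : p w = p w' by apply/pE; case: wv => -[-> ->]; [constructor 2|constructor 3].
have sP y : exists x, p x = y /\ x <> w.
  have [x _ <-] := ps y I; have [->|xw] := pselect (x = w); last by exists x.
  by exists w'; split=> //; exact: nesym.
have [s sK] := choice sP.
have spE x : x <> w -> s (p x) = x.
  have [E sw] := sK (p x); move=> xw; case/pE: E => // -[E1 E2]; exfalso.
  - by case: wv => -[wE _]; [apply: sw|apply: xw]; rewrite wE.
  - by case: wv => -[wE _]; [apply: xw|apply: sw]; rewrite wE.
have spw : s (p w) = w' by rewrite pw spE //; exact: nesym.
pose q y := p' (f (s y)).
have qp x : q (p x) = p' (f x).
  rewrite /q; have [xw|xw] := pselect (x = w); last by rewrite spE.
  rewrite xw spw; apply/pE'; rewrite -fp.
  by case: wv => -[-> ->]; [constructor 3|constructor 2].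
have rep y : exists2 x, p x = y & x <> v.
  have [E sw] := sK y; have [sv|sv] := pselect (s y = v); last by exists (s y).
  exists (parent v) => //; rewrite -E sv; apply/pE; by constructor 3.
have isoq : is_iso q.
  split.
  - apply: (@inj_card_bij _ _ q).
      move=> y1 y2; have [x1 <- x1v] := rep y1; have [x2 <- x2v] := rep y2.
      rewrite !qp => /pE'[/finj->//|[/finj //]|[_ /finj //]].
    apply: eq_leq; rewrite !card_sum !card_ord; congr (_ + _)%N.
    have /collapse_edgeP[_ tY] : collapse_edge Y v.
      by apply/collapse_edgeP; split=> //; split=> //; exists p.
    have /collapse_edgeP[_ tY'] : collapse_edge Y' (f v).
      by apply/collapse_edgeP; split=> //; split=> //; exists p'.
    have := tcol_ntriv (treeP X) tY; rewrite (iso_ntriv isof) (tcol_ntriv (treeP X') tY').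
    by case.
  - by move=> i; rewrite -(pi i) qp fi pi'.
  - by rewrite -pb qp fb pb'.
  - move=> y; have [x <- xv] := rep y; rewrite -pp // !qp fp pp' //.
    by move=> /finj.
have wv' : w = v \/ w = parent v by case: wv => -[-> _]; [left|right].
have pgr x : x <> w -> vgroup (p x) = vgroup x.
  exact: (collapse_vgroup lY pi (fun x y => (pE x y).1) tw wv').
have pgr' x : x <> w -> vgroup (p' (f x)) = vgroup (f x).
  move=> xw; have tfw : triv (f w).
    by case: (w) tw => // a _; have [b ->] := iso_inr a isof.
  apply: (collapse_vgroup lY' pi' (fun x y => (pE' x y).1) tfw); last by move/finj.
  by rewrite -fp; case: wv' => ->; [left|right].
exists q, (g \o s); split=> [//|y|y yb] /=.
  have [sy sw] := sK y; have -> : vgroup y = vgroup (s y) by rewrite -{1}sy pgr.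
  by rewrite -fg /q pgr'.
have [M1 _ _] := ltree_subgp (parent y : vert Y).
have yp x : p x = y -> x <> base X by move=> E xb; apply: yb; rewrite -E xb pb.
have par x : x <> w -> x <> v -> p x = y -> parent x <> w ->
    vgroup (parent y) (g (s y) * (g (s (parent y)))^-1).
  move=> xw xv E pxw; rewrite -E spE // -pp // spE // pgr //.
  by apply: fe; apply: yp.
have [sy sw] := sK y.
have [sv|sv] := pselect (s y = v).
  have [wE wE'] : w = parent v /\ w' = v.
    by case: wv => -[wE wE']; [case: sw; rewrite sv wE|split].
  have ey : p (parent v) = y by rewrite -wE pw wE' -sv sy.
  have pvb : parent v <> base X by exact: yp.
  have ppw : parent (parent v) <> w.
    by rewrite wE; exact: tree_parent_neq (treeP X) pvb.
  rewrite sv -ey -pp // spE // pgr //.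
  have := fe _ pvb; have := fe _ vb; rewrite -[in vgroup (parent v)]wE.
  case: (w) tw => // a _ /= /eqP; rewrite mulg_eq1 invgK => /eqP <-.
  exact.
have [pxw|pxw] := pselect (parent (s y) = w); last exact: (par (s y)).
have ppy : parent y = p w by rewrite -{1}sy -pp // pxw.
have := fe _ (yp _ sy); rewrite ppy pxw spw.
have -> : vgroup w = [set 1] by case: (w) tw.
move=> /= /eqP; rewrite mulg_eq1 invgK => /eqP ->.
rewrite pw; case: wv => -[wE wE'].
  by rewrite pgr; [rewrite wE wE'; exact: fe|exact: nesym].
have := fe _ vb; rewrite -wE -wE'.
have -> : vgroup w = [set 1] by case: (w) tw.
move=> /= /eqP; rewrite mulg_eq1 invgK => /eqP ->; rewrite mulgV.
by case: (ltree_subgp (p w')).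
Qed.
End Classes.

Lemma inlE (A B : eqType) (a b : A) : (inl a == inl b :> A + B) = (a == b).
Proof. by []. Qed.
Lemma inrE (A B : eqType) (a b : B) : (inr a == inr b :> A + B) = (a == b).
Proof. by []. Qed.
Lemma inlrE (A B : eqType) (a : A) (b : B) : (inl a == inr b :> A + B) = false.
Proof. by []. Qed.
Lemma inrlE (A B : eqType) (a : A) (b : B) : (inr b == inl a :> A + B) = false.
Proof. by []. Qed.
Definition vE := (inlE, inrE, inlrE, inrlE).


(** Evaluates parent maps: each test between indices is settled by a disequality of the context or
    split into cases. *)
Ltac ifs :=
  repeat first
  [ progress rewrite /= ?vE ?eqxx
  | match goal with
    | H : is_true (?a != ?b) |- context [?a == ?b] => rewrite (negbTE H)
    | H : is_true (?a != ?b) |- context [?b == ?a] => rewrite (eq_sym b a) (negbTE H)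
    | |- context [?a == ?b] =>
      is_var a; let E := fresh "E" in
      have [E|E] := eqVneq a b; [subst a|]
    end ].


(** * The listed shapes as explicit trees *)

Section Shapes.
Variable n : nat.
Implicit Types (i j k l m a : 'I_n).
Notation t0 := (inr ord0).
Notation t1 := (inr ord_max).
Notation tree k b p := (@BTree n k b (p : 'I_n + 'I_k -> 'I_n + 'I_k)).

Definition alphaT := tree 1 t0 (fun=> t0).
Definition rhoT i j := tree 2 t0 [eta (fun=> t0) with inl i |-> t1, inl j |-> t1].
Definition sigmaT i j k l m := tree 2 (inl i)
  [eta (fun=> inl i) with inl j |-> t0, inl k |-> t0, inl l |-> t1, inl m |-> t1].
Definition tauT i j k l := tree 2 t0
  [eta (fun=> t0) with inl j |-> inl i, inl k |-> t1, inl l |-> t1].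
Definition betaT i j := tree 1 t0 [eta (fun=> t0) with inl j |-> inl i].
Definition gammaT i j k := tree 1 (inl i)
  [eta (fun=> inl i) with inl j |-> t0, inl k |-> t0].
Definition deltaT i j k l m := tree 1 (inl i)
  [eta (fun=> inl i) with inl k |-> inl j, inl l |-> t0, inl m |-> t0].
Definition epsT i j k l := tree 1 t0
  [eta (fun=> t0) with inl j |-> inl i, inl l |-> inl k].
Definition aT i := tree 0 (inl i) (fun=> inl i).
Definition bT i j k := tree 0 (inl i) [eta (fun=> inl i) with inl k |-> inl j].
Definition cT i j k l m := tree 0 (inl i)
  [eta (fun=> inl i) with inl k |-> inl j, inl m |-> inl l].

Lemma uniq2 i j : uniq [:: i; j] -> i != j.
Proof. by rewrite /= inE andbT. Qed.
Lemma uniq3 i j k : uniq [:: i; j; k] -> [/\ i != j, i != k & j != k].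
Proof. by rewrite /= !inE !negb_or !andbT -!andbA => /and3P. Qed.
Lemma uniq4 i j k l : uniq [:: i; j; k; l] ->
  [/\ i != j, i != k, i != l & j != k] /\ (j != l) /\ (k != l).
Proof.
rewrite /= !inE !negb_or !andbT -!andbA => /and5P[-> -> -> -> /andP[-> ->]].
by [].
Qed.
Lemma uniq5 i j k l m : uniq [:: i; j; k; l; m] ->
  [/\ i != j, i != k, i != l & i != m] /\ [/\ j != k, j != l & j != m] /\
  [/\ k != l, k != m & l != m].
Proof.
rewrite /= !inE !negb_or !andbT -!andbA => /and5P[-> -> -> -> /and5P[-> -> -> -> /andP[-> ->]]].
by [].
Qed.

Lemma is_tree3 (S : btree n) : parent (base S) = base S ->
  (forall v : vert S, parent (parent (parent v)) = base S) -> is_tree S.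
Proof. by move=> pb h; split=> // v; exists 3; exact: h. Qed.

Lemma ord2 (x : 'I_2) : x = ord0 \/ x = ord_max.
Proof. by case: x => [[|[|//]] h]; [left|right]; exact: val_inj. Qed.


Ltac shape_tree :=
  apply: is_tree3 => [|[a|x]]; rewrite /= ?vE //; ifs; by [].

Lemma listed_is_tree (S : btree n) : listed_tree S -> is_tree S.
Proof.
case=> [|i j /uniq2 ij|i j k l m /uniq5[[ij ik il im] [[jk jl jm] [kl km lm]]]
  |i j k l /uniq4[[ij ik il jk] [jl kl]]|i j /uniq2 ij|i j k /uniq3[ij ik jk]
  |i j k l m /uniq5[[ij ik il im] [[jk jl jm] [kl km lm]]]
  |i j k l /uniq4[[ij ik il jk] [jl kl]]|i|i j k /uniq3[ij ik jk]
  |i j k l m /uniq5[[ij ik il im] [[jk jl jm] [kl km lm]]]]; shape_tree.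
Qed.

End Shapes.

(** * Vertices of the complex and their rank *)

Section Vertices.
Local Open Scope classical_set_scope.
Local Open Scope group_scope.
Variables (G : groupType) (n : nat) (Gs : 'I_n -> set G).
Implicit Types (X Y Z : ltree Gs) (L : lab Gs) (S : btree n).

Definition mk S (hS : listed_tree S) L : ltree Gs :=
  LTree (listed_is_tree hS) (proj2_sig L).

Lemma mk_listed S (hS : listed_tree S) L : has_listed_shape (mk hS L).
Proof. by exists S => //; exists id; exact: iso_refl. Qed.

Definition V S (hS : listed_tree S) L : Cvertex Gs :=
  SigSub (mem_set (ex_intro2 _ _ (mk hS L) (mk_listed hS L) erefl)).

Lemma VP S (hS : listed_tree S) L X : val (V hS L) X <-> ltree_equiv (mk hS L) X.
Proof. by rewrite SubK. Qed.

Lemma class_eq X Y : ltree_equiv X Y -> ltree_class X = ltree_class Y.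
Proof.
move=> E; apply/seteqP; split=> Z h; first exact: (lequiv_trans (lequiv_sym E) h).
exact: (lequiv_trans E h).
Qed.

Lemma V_eq S S' (hS : listed_tree S) (hS' : listed_tree S') L L' :
  V hS L = V hS' L' <-> ltree_equiv (mk hS L) (mk hS' L').
Proof.
split=> [E|E]; last by apply: val_inj; rewrite !SubK; exact: class_eq.
apply: (VP hS L _).1; rewrite E; apply: (VP hS' L' _).2; exact: lequiv_refl.
Qed.

Lemma V_of (c : Cvertex Gs) X S (hS : listed_tree S) L :
  val c X -> ltree_equiv X (mk hS L) -> c = V hS L.
Proof.
move=> cX E; apply: val_inj; rewrite SubK -(class_eq E).
have /set_mem[Y _ YE] := valP c; rewrite -YE in cX *; exact: class_eq.
Qed.

Lemma V_ex (c : Cvertex Gs) : exists S (hS : listed_tree S) L, c = V hS L.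
Proof.
have /set_mem[X [S hS [f isof]] E] := valP c.
exists S, hS, (exist _ _ (labelP X)); apply: (@V_of _ X).
  by rewrite -E; exact: lequiv_refl.
by apply: lequiv_sym; exact: (@equiv_iso _ _ _ (mk hS _) X f).
Qed.

Lemma V_iso S S' (hS : listed_tree S) (hS' : listed_tree S') L (f : vert S -> vert S') :
  is_iso f -> V hS L = V hS' L.
Proof. by move=> isof; apply/V_eq; exact: (@equiv_iso _ _ _ (mk hS L) (mk hS' L) f). Qed.

Definition vg L S (v : vert S) : set G := if v is inl i then lb L i else [set 1].

Lemma V_relabel S (hS : listed_tree S) L L' (g : vert S -> G) :
  (forall i, lb L' i = conj_set (lb L i) (g (inl i))) ->
  (forall v, v <> base S -> vg L (parent v) (g v * (g (parent v))^-1)) ->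
  V hS L = V hS L'.
Proof.
move=> E e; apply/V_eq; exists id, g; split; [exact: iso_refl| |exact: e].
case=> [i|a]; first exact: E.
apply/seteqP; split=> z; rewrite conj_setE /=; first by move=> ->; rewrite conj1g.
by move=> /eqP; rewrite conjg_eq1 => /eqP.
Qed.

Lemma V_eq_inv S S' (hS : listed_tree S) (hS' : listed_tree S') L L' :
  V hS L = V hS' L' -> (exists f : vert S -> vert S', is_iso f) /\ exists g : vert S -> G,
  (forall i, lb L' i = conj_set (lb L i) (g (inl i))) /\
  (forall v, v <> base S -> vg L (parent v) (g v * (g (parent v))^-1)).
Proof.
move/V_eq => [f [g [isof fg fe]]]; split; first by exists f.
exists g; split=> [i|v vb]; last exact: fe.
by have := fg (inl i); case: isof => _ -> _ _.
Qed.

(** A grading of the complex: the number of trivial vertices is invariant under equivalence, and a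
    single collapse lowers it by one. *)
Definition rk (c : Cvertex Gs) := ntriv (projT1 (cid (V_ex c))).

Lemma rkP (c : Cvertex Gs) X : val c X -> ntriv X = rk c.
Proof.
rewrite /rk; case: cid => S /= [hS [L ->]] /VP /equiv_ntriv <-.
by [].
Qed.

Lemma rkV S (hS : listed_tree S) L : rk (V hS L) = ntriv S.
Proof. by rewrite -(@rkP _ (mk hS L)) //; apply/VP; exact: lequiv_refl. Qed.

(** The drop in the number of trivial vertices counts the single collapses of the chain. *)
Lemma collapse_chain X Y : is_collapse X Y -> (ntriv Y < ntriv X)%N /\
  (ntriv X = (ntriv Y).+1 -> exists v, @collapse_edge _ _ _ X Y v) /\
  (ntriv X = (ntriv Y).+2 -> exists Z v w,
    @collapse_edge _ _ _ X Z v /\ @collapse_edge _ _ _ Z Y w).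
Proof.
elim=> {X Y} [X Y [v h]|X Z Y _ [lt1 [h1 _]] _ [lt2 [h2 _]]].
  have /collapse_edgeP[_ /(tcol_ntriv (treeP X)) E] := h.
  by rewrite E; split=> //; split=> [_|]; [exists v|lia].
split; first exact: ltn_trans lt2 lt1.
split=> E; first by lia.
have [v hv] : exists v, @collapse_edge _ _ _ X Z v by apply: h1; lia.
have [w hw] : exists w, @collapse_edge _ _ _ Z Y w by apply: h2; lia.
by exists Z, v, w.
Qed.

Lemma CadjC (c d : Cvertex Gs) : Cadj c d -> Cadj d c.
Proof. by move=> [X [Y [cX dY h]]]; exists Y, X; split=> //; case: h; [right|left]. Qed.

Lemma Cadj_rk (c d : Cvertex Gs) : Cadj c d -> rk c != rk d.
Proof.
move=> [X [Y [cX dY [|] /collapse_chain[lt _]]]]; rewrite -(rkP cX) -(rkP dY); lia.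
Qed.

Lemma V_adj1 S S' (hS : listed_tree S) (hS' : listed_tree S') L (v : vert S) :
  tcol S' v -> Cadj (V hS L) (V hS' L).
Proof.
move=> h; exists (mk hS L), (mk hS' L); split; try by apply/VP; exact: lequiv_refl.
by left; apply: t_step; exists v; apply/collapse_edgeP.
Qed.

Lemma V_adj2 S S1 S' (hS : listed_tree S) (hS1 : listed_tree S1) (hS' : listed_tree S')
  L (v : vert S) (w : vert S1) :
  tcol S1 v -> tcol S' w -> Cadj (V hS L) (V hS' L).
Proof.
move=> h h'; exists (mk hS L), (mk hS' L); split; try by apply/VP; exact: lequiv_refl.
left; apply: (@t_trans _ _ _ (mk hS1 L)); apply: t_step.
  by exists v; apply/collapse_edgeP.
by exists w; apply/collapse_edgeP.
Qed.

(** [Q] is an upper bound for the one-edge collapses of [S]: each collapsible edge has an outcome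
    that is a listed tree in [Q]. *)
Definition edge_collapses S (Q : btree n -> Prop) := forall v : vert S, v <> base S ->
  triv v || triv (parent v) -> exists S', [/\ listed_tree S', Q S' & tcol S' v].

Lemma down_class S (hS : listed_tree S) L X Y v Q : edge_collapses S Q ->
  ltree_equiv (mk hS L) X -> @collapse_edge _ _ _ X Y v ->
  exists S' (hS' : listed_tree S'), Q S' /\ ltree_equiv (mk hS' L) Y.
Proof.
move=> en [f [g [isof fg fe]]] h.
have [f' isof' [ff' f'f]] := iso_inv isof.
have /collapse_edgeP[_ [vb tv _]] := h; have [_ _ fb' fp'] := isof'.
have tr (u : vert X) : triv u -> triv (f' u).
  by case: u => // a _; have [b ->] := iso_inr a isof'.
have v'b : f' v <> base S.
  by have [_ _ fb _] := isof => E; apply: vb; rewrite -(f'f v) E; exact: fb.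
have [S' [hS' QS' tS']] : exists S', [/\ listed_tree S', Q S' & @tcol n S S' (f' v)].
  apply: en => //; have fp'' := fp' v; rewrite -[X in _ || triv X]fp''.
  by case/orP: tv => /tr ->; rewrite ?orbT.
exists S', hS'; split=> //.
apply: (@collapse_class _ _ _ (mk hS L) X (mk hS' L) Y f g (f' v) isof fg fe).
  by apply/collapse_edgeP.
by rewrite f'f.
Qed.

(** Adjacency speaks of some representatives only. By [collapse_class], the collapse can be carried
    out on the explicit tree, so the lower neighbour has the same labelling [L]. *)
Lemma down1 S (hS : listed_tree S) L Q d : edge_collapses S Q -> Cadj (V hS L) d ->
  ntriv S = (rk d).+1 -> exists S' (hS' : listed_tree S'), Q S' /\ d = V hS' L.
Proof.
move=> en [X [Y [cX dY h]]] E.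
have cX' := rkP cX; have dY' := rkP dY; rewrite rkV in cX'.
case: h => /collapse_chain[lt [h1 _]]; last by exfalso; lia.
have [|v hv] := h1; first by lia.
move/VP: cX => cX; have [S' [hS' [QS' eq]]] := down_class en cX hv.
by exists S', hS'; split=> //; apply: V_of dY _; exact: lequiv_sym.
Qed.

Lemma down2 S (hS : listed_tree S) L Q Q' d : edge_collapses S Q -> (forall S', Q S' ->
  edge_collapses S' Q') ->
  Cadj (V hS L) d -> ntriv S = (rk d).+2 ->
  exists S' (hS' : listed_tree S'), Q' S' /\ d = V hS' L.
Proof.
move=> en en' [X [Y [cX dY h]]] E.
have cX' := rkP cX; have dY' := rkP dY; rewrite rkV in cX'.
case: h => /collapse_chain[lt [_ h2]]; last by exfalso; lia.
have [|Z [v [w [hv hw]]]] := h2; first by lia.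
move/VP: cX => cX; have [S1 [hS1 [QS1 eq1]]] := down_class en cX hv.
have [S' [hS' [QS' eq]]] := down_class (en' _ QS1) eq1 hw.
by exists S', hS'; split=> //; apply: V_of dY _; exact: lequiv_sym.
Qed.

End Vertices.

(** * Single-edge collapses of each shape *)

Section Collapses.
Variable n : nat.
Implicit Types (i j k l m a : 'I_n).
Notation t0 := (inr ord0).
Notation t1 := (inr ord_max).

(** Templates for the contractions ([con1], [con2]) and their sections ([sec0], [sec1]); [z] and
    [z'] say where the trivial vertices go. *)
Definition con1 (k : nat) (z : 'I_n + 'I_k) (x : 'I_n + 'I_1) : 'I_n + 'I_k :=
  if x is inl a then inl a else z.
Definition con2 (z z' : 'I_n + 'I_1) (x : 'I_n + 'I_2) : 'I_n + 'I_1 :=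
  match x with inl a => inl a | inr o => if o == ord0 then z else z' end.
Definition sec0 (y : 'I_n + 'I_0) : 'I_n + 'I_1 :=
  if y is inl a then inl a else t0.
Definition sec1 (z : 'I_n + 'I_2) (y : 'I_n + 'I_1) : 'I_n + 'I_2 :=
  if y is inl a then inl a else z.

Ltac vcase x := let y := fresh "y" in
  case: x => [?|y]; [|first [case: (ord2 y) => -> | rewrite (ord1 y) | by case: y]].

Ltac cfin := rewrite /con1 /con2 /sec0 /sec1 /= ?vE; ifs;
  solve [ by [] | by case | by move=> /eqP; rewrite ?vE; ifs | by move=> ?; congruence ].

Ltac col w w' f s :=
  lazymatch goal with |- @tcol _ ?X ?Y ?v =>
    apply: (@tcol_intro _ X Y v w w' f s) end;
  first [ by [] | by [left; split; cfin | right; split; cfin] | cfin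
        | let x := fresh "x" in move=> x; vcase x; cfin ].


Ltac uniqs := rewrite /= ?inE; ifs; by [].

Section Rho.
Variables i j : 'I_n.
Hypothesis ij : i != j.
Lemma col_rho_alpha : tcol (X := rhoT i j) (alphaT n) t1.
Proof. col (t1 : 'I_n + 'I_2) (t0 : 'I_n + 'I_2) (con2 t0 t0) (sec1 t0). Qed.
Lemma col_rho_beta : tcol (X := rhoT i j) (betaT i j) (inl i).
Proof. col (t1 : 'I_n + 'I_2) (inl i : 'I_n + 'I_2) (con2 t0 (inl i)) (sec1 t0). Qed.
Lemma col_rho_beta' : tcol (X := rhoT i j) (betaT j i) (inl j).
Proof. col (t1 : 'I_n + 'I_2) (inl j : 'I_n + 'I_2) (con2 t0 (inl j)) (sec1 t0). Qed.
Lemma col_rho_gamma a : a != i -> a != j -> tcol (X := rhoT i j) (gammaT a i j) (inl a).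
Proof. move=> ai aj; col (t0 : 'I_n + 'I_2) (inl a : 'I_n + 'I_2) (con2 (inl a) t0) (sec1 t1).
  Qed.

Lemma enum_rho : edge_collapses (rhoT i j) (fun S => [\/ S = (alphaT n), S = betaT i j,
  S = betaT j i |
  exists a, [/\ a != i, a != j & S = gammaT a i j]]).
Proof.
case=> [a|x] /= vb; rewrite /= ?vE.
  have [ai|ai] := eqVneq a i.
    exists (betaT i j); split; [by apply: Beta; uniqs|by constructor 2|].
    by rewrite ai; exact: col_rho_beta.
  have [aj|aj] := eqVneq a j.
    exists (betaT j i); split; [by apply: Beta; uniqs|by constructor 3|].
    by rewrite aj; exact: col_rho_beta'.
  move=> _; exists (gammaT a i j); split; [by apply: Gamma; uniqs|constructor 4|].
    by exists a.
  exact: col_rho_gamma.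
case: (ord2 x) vb => -> // vb _.
exists (alphaT n); split; [exact: Alpha|by constructor 1|exact: col_rho_alpha].
Qed.
End Rho.

Section Sigma.
Variables i j k l m : 'I_n.
Hypothesis u : uniq [:: i; j; k; l; m].

Lemma col_sigma_gamma : tcol (X := sigmaT i j k l m) (gammaT i j k) t1.
Proof. case/uniq5: u => [[ij ik il im] [[jk jl jm]
  [kl km lm]]]. col (t1 : 'I_n + 'I_2) (inl i : 'I_n + 'I_2) (con2 t0 (inl i)) (sec1 t0). Qed.
Lemma col_sigma_gamma' : tcol (X := sigmaT i j k l m) (gammaT i l m) t0.
Proof. case/uniq5: u => [[ij ik il im] [[jk jl jm]
  [kl km lm]]]. col (t0 : 'I_n + 'I_2) (inl i : 'I_n + 'I_2) (con2 (inl i) t0) (sec1 t1). Qed.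
Lemma col_sigma_j : tcol (X := sigmaT i j k l m) (deltaT i j k l m) (inl j).
Proof. case/uniq5: u => [[ij ik il im] [[jk jl jm]
  [kl km lm]]]. col (t0 : 'I_n + 'I_2) (inl j : 'I_n + 'I_2) (con2 (inl j) t0) (sec1 t1). Qed.
Lemma col_sigma_k : tcol (X := sigmaT i j k l m) (deltaT i k j l m) (inl k).
Proof. case/uniq5: u => [[ij ik il im] [[jk jl jm]
  [kl km lm]]]. col (t0 : 'I_n + 'I_2) (inl k : 'I_n + 'I_2) (con2 (inl k) t0) (sec1 t1). Qed.
Lemma col_sigma_l : tcol (X := sigmaT i j k l m) (deltaT i l m j k) (inl l).
Proof. case/uniq5: u => [[ij ik il im] [[jk jl jm]
  [kl km lm]]]. col (t1 : 'I_n + 'I_2) (inl l : 'I_n + 'I_2) (con2 t0 (inl l)) (sec1 t0). Qed.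
Lemma col_sigma_m : tcol (X := sigmaT i j k l m) (deltaT i m l j k) (inl m).
Proof. case/uniq5: u => [[ij ik il im] [[jk jl jm]
  [kl km lm]]]. col (t1 : 'I_n + 'I_2) (inl m : 'I_n + 'I_2) (con2 t0 (inl m)) (sec1 t0). Qed.

Lemma enum_sigma : edge_collapses (sigmaT i j k l m) (fun S =>
  [\/ S = gammaT i j k, S = gammaT i l m | 
      [\/ S = deltaT i j k l m, S = deltaT i k j l m, S = deltaT i l m j k |
        S = deltaT i m l j k]]).
Proof.
have [[ij ik il im] [[jk jl jm] [kl km lm]]] := uniq5 u.
case=> [a|x] /= vb; rewrite /= ?vE.
  have [aj|aj] := eqVneq a j.
    exists (deltaT i j k l m); split; [by apply: Delta; uniqs|by constructor 3; constructor 1|].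
    by rewrite aj; exact: col_sigma_j.
  have [ak|ak] := eqVneq a k.
    exists (deltaT i k j l m); split; [by apply: Delta; uniqs|by constructor 3; constructor 2|].
    by rewrite ak; exact: col_sigma_k.
  have [al|al] := eqVneq a l.
    exists (deltaT i l m j k); split; [by apply: Delta; uniqs|by constructor 3; constructor 3|].
    by rewrite al; exact: col_sigma_l.
  have [am|//] := eqVneq a m.
    exists (deltaT i m l j k); split; [by apply: Delta; uniqs|by constructor 3; constructor 4|].
    by rewrite am; exact: col_sigma_m.
case: (ord2 x) vb => -> // vb _.
  exists (gammaT i l m); split; [by apply: Gamma; uniqs|by constructor 2|exact: col_sigma_gamma'].
exists (gammaT i j k); split; [by apply: Gamma; uniqs|by constructor 1|exact: col_sigma_gamma].
Qed.
End Sigma.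

Section Tau.
Variables i j k l : 'I_n.
Hypothesis u : uniq [:: i; j; k; l].

Lemma col_tau_gamma : tcol (X := tauT i j k l) (gammaT i k l) (inl i).
Proof. case/uniq4: u => [[ij ik il jk]
  [jl kl]]. col (t0 : 'I_n + 'I_2) (inl i : 'I_n + 'I_2) (con2 (inl i) t0) (sec1 t1). Qed.
Lemma col_tau_beta : tcol (X := tauT i j k l) (betaT i j) t1.
Proof. case/uniq4: u => [[ij ik il jk]
  [jl kl]]. col (t1 : 'I_n + 'I_2) (t0 : 'I_n + 'I_2) (con2 t0 t0) (sec1 t0). Qed.
Lemma col_tau_k : tcol (X := tauT i j k l) (epsT i j k l) (inl k).
Proof. case/uniq4: u => [[ij ik il jk]
  [jl kl]]. col (t1 : 'I_n + 'I_2) (inl k : 'I_n + 'I_2) (con2 t0 (inl k)) (sec1 t0). Qed.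
Lemma col_tau_l : tcol (X := tauT i j k l) (epsT i j l k) (inl l).
Proof. case/uniq4: u => [[ij ik il jk]
  [jl kl]]. col (t1 : 'I_n + 'I_2) (inl l : 'I_n + 'I_2) (con2 t0 (inl l)) (sec1 t0). Qed.
Lemma col_tau_delta a : uniq [:: a; i; j; k; l] ->
  tcol (X := tauT i j k l) (deltaT a i j k l) (inl a).
Proof. case/uniq5 => [[ai aj ak al] [[ij ik il]
  [jk jl kl]]]. col (t0 : 'I_n + 'I_2) (inl a : 'I_n + 'I_2) (con2 (inl a) t0) (sec1 t1). Qed.

Lemma enum_tau : edge_collapses (tauT i j k l) (fun S =>
  [\/ S = gammaT i k l, S = betaT i j, (S = epsT i j k l \/ S = epsT i j l k) |
      exists a, uniq [:: a; i; j; k; l] /\ S = deltaT a i j k l]).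
Proof.
have [[ij ik il jk] [jl kl]] := uniq4 u.
case=> [a|x] /= vb; rewrite /= ?vE.
  have [ai|ai] := eqVneq a i.
    exists (gammaT i k l); split; [by apply: Gamma; uniqs|by constructor 1|].
    by rewrite ai; exact: col_tau_gamma.
  have [//|aj] := eqVneq a j.
  have [ak|ak] := eqVneq a k.
    exists (epsT i j k l); split; [by apply: Epsilon; uniqs|by constructor 3; left|].
    by rewrite ak; exact: col_tau_k.
  have [al|al] := eqVneq a l.
    exists (epsT i j l k); split; [by apply: Epsilon; uniqs|by constructor 3; right|].
    by rewrite al; exact: col_tau_l.
  have ua : uniq [:: a; i; j; k; l] by uniqs.
  exists (deltaT a i j k l); split; [exact: Delta|by constructor 4; exists a|].
  exact: col_tau_delta.
case: (ord2 x) vb => -> // vb _.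
exists (betaT i j); split; [by apply: Beta; uniqs|by constructor 2|exact: col_tau_beta].
Qed.
End Tau.

Lemma col_alpha a : tcol (X := (alphaT n)) (aT a) (inl a).
Proof. col (t0 : 'I_n + 'I_1) (inl a : 'I_n + 'I_1) (con1 (inl a : 'I_n + 'I_0)) sec0. Qed.

Lemma enum_alpha : edge_collapses (alphaT n) (fun S => exists a, S = aT a).
Proof.
case=> [a|x] /= vb; last by case: vb; rewrite (ord1 x).
by exists (aT a); split; [exact: ShapeA|exists a|exact: col_alpha].
Qed.

Section Beta.
Variables i j : 'I_n.
Hypothesis ij : i != j.
Lemma col_beta_a : tcol (X := betaT i j) (aT i) (inl i).
Proof. col (t0 : 'I_n + 'I_1) (inl i : 'I_n + 'I_1) (con1 (inl i : 'I_n + 'I_0)) sec0. Qed.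
Lemma col_beta_b a : a != i -> a != j -> tcol (X := betaT i j) (bT a i j) (inl a).
Proof. move=> ai aj; col (t0 : 'I_n + 'I_1) (inl a : 'I_n + 'I_1) (con1 (inl a : 'I_n + 'I_0))
  sec0. Qed.
Lemma enum_beta : edge_collapses (betaT i j) (fun S => S = aT i \/
  exists a, [/\ a != i, a != j & S = bT a i j]).
Proof.
case=> [a|x] /= vb; last by case: vb; rewrite (ord1 x).
rewrite /= ?vE; have [//|aj] := eqVneq a j.
have [ai|ai] := eqVneq a i => _.
  by exists (aT i); split; [exact: ShapeA|left|rewrite ai; exact: col_beta_a].
exists (bT a i j); split; [by apply: ShapeB; uniqs|by right; exists a|exact: col_beta_b].
Qed.
End Beta.

Section Gamma.
Variables i j k : 'I_n.
Hypothesis u : uniq [:: i; j; k].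
Lemma col_gamma_a : tcol (X := gammaT i j k) (aT i) t0.
Proof. case/uniq3: u => [ij ik jk];
  col (t0 : 'I_n + 'I_1) (inl i : 'I_n + 'I_1) (con1 (inl i : 'I_n + 'I_0)) sec0. Qed.
Lemma col_gamma_j : tcol (X := gammaT i j k) (bT i j k) (inl j).
Proof. case/uniq3: u => [ij ik jk];
  col (t0 : 'I_n + 'I_1) (inl j : 'I_n + 'I_1) (con1 (inl j : 'I_n + 'I_0)) sec0. Qed.
Lemma col_gamma_k : tcol (X := gammaT i j k) (bT i k j) (inl k).
Proof. case/uniq3: u => [ij ik jk];
  col (t0 : 'I_n + 'I_1) (inl k : 'I_n + 'I_1) (con1 (inl k : 'I_n + 'I_0)) sec0. Qed.
Lemma enum_gamma : edge_collapses (gammaT i j k) (fun S => [\/ S = aT i, S = bT i j k |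
  S = bT i k j]).
Proof.
have [ij ik jk] := uniq3 u.
case=> [a|x] /= vb; rewrite /= ?vE.
  have [aj|aj] := eqVneq a j.
    exists (bT i j k); split; [by apply: ShapeB; uniqs|by constructor 2|].
    by rewrite aj; exact: col_gamma_j.
  have [ak|//] := eqVneq a k.
  exists (bT i k j); split; [by apply: ShapeB; uniqs|by constructor 3|].
  by rewrite ak; exact: col_gamma_k.
exists (aT i); split; [exact: ShapeA|by constructor 1|].
by rewrite (ord1 x); exact: col_gamma_a.
Qed.
End Gamma.

Section Delta.
Variables i j k l m : 'I_n.
Hypothesis u : uniq [:: i; j; k; l; m].
Lemma col_delta_b : tcol (X := deltaT i j k l m) (bT i j k) t0.
Proof. case/uniq5: u => [[ij ik il im] [[jk jl jm] [kl km lm]]];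
  col (t0 : 'I_n + 'I_1) (inl i : 'I_n + 'I_1) (con1 (inl i : 'I_n + 'I_0)) sec0. Qed.
Lemma col_delta_l : tcol (X := deltaT i j k l m) (cT i j k l m) (inl l).
Proof. case/uniq5: u => [[ij ik il im] [[jk jl jm] [kl km lm]]];
  col (t0 : 'I_n + 'I_1) (inl l : 'I_n + 'I_1) (con1 (inl l : 'I_n + 'I_0)) sec0. Qed.
Lemma col_delta_m : tcol (X := deltaT i j k l m) (cT i j k m l) (inl m).
Proof. case/uniq5: u => [[ij ik il im] [[jk jl jm] [kl km lm]]];
  col (t0 : 'I_n + 'I_1) (inl m : 'I_n + 'I_1) (con1 (inl m : 'I_n + 'I_0)) sec0. Qed.
Lemma enum_delta : edge_collapses (deltaT i j k l m) (fun S =>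
  [\/ S = bT i j k, S = cT i j k l m | S = cT i j k m l]).
Proof.
have [[ij ik il im] [[jk jl jm] [kl km lm]]] := uniq5 u.
case=> [a|x] /= vb; rewrite /= ?vE.
  have [//|ak] := eqVneq a k.
  have [al|al] := eqVneq a l.
    exists (cT i j k l m); split; [exact: ShapeC|by constructor 2|].
    by rewrite al; exact: col_delta_l.
  have [am|//] := eqVneq a m.
  exists (cT i j k m l); split; [by apply: ShapeC; uniqs|by constructor 3|].
  by rewrite am; exact: col_delta_m.
exists (bT i j k); split; [by apply: ShapeB; uniqs|by constructor 1|].
by rewrite (ord1 x); exact: col_delta_b.
Qed.
End Delta.

Section Eps.
Variables i j k l : 'I_n.
Hypothesis u : uniq [:: i; j; k; l].
Lemma col_eps_i : tcol (X := epsT i j k l) (bT i k l) (inl i).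
Proof. case/uniq4: u => [[ij ik il jk] [jl kl]];
  col (t0 : 'I_n + 'I_1) (inl i : 'I_n + 'I_1) (con1 (inl i : 'I_n + 'I_0)) sec0. Qed.
Lemma col_eps_k : tcol (X := epsT i j k l) (bT k i j) (inl k).
Proof. case/uniq4: u => [[ij ik il jk] [jl kl]];
  col (t0 : 'I_n + 'I_1) (inl k : 'I_n + 'I_1) (con1 (inl k : 'I_n + 'I_0)) sec0. Qed.
Lemma col_eps_c a : uniq [:: a; i; j; k; l] -> tcol (X := epsT i j k l) (cT a i j k l) (inl a).
Proof. case/uniq5 => [[ai aj ak al] [[ij ik il] [jk jl kl]]];
  col (t0 : 'I_n + 'I_1) (inl a : 'I_n + 'I_1) (con1 (inl a : 'I_n + 'I_0)) sec0. Qed.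
Lemma enum_eps : edge_collapses (epsT i j k l) (fun S => [\/ S = bT i k l, S = bT k i j |
  exists a, uniq [:: a; i; j; k; l] /\ S = cT a i j k l]).
Proof.
have [[ij ik il jk] [jl kl]] := uniq4 u.
case=> [a|x] /= vb; last by case: vb; rewrite (ord1 x).
rewrite /= ?vE; have [//|aj] := eqVneq a j.
have [//|al] := eqVneq a l.
have [ai|ai] := eqVneq a i.
  exists (bT i k l); split; [by apply: ShapeB; uniqs|by constructor 1|].
  by rewrite ai; exact: col_eps_i.
have [ak|ak] := eqVneq a k.
  exists (bT k i j); split; [by apply: ShapeB; uniqs|by constructor 2|].
  by rewrite ak; exact: col_eps_k.
move=> _; have ua : uniq [:: a; i; j; k; l] by uniqs.
by exists (cT a i j k l); split; [exact: ShapeC|constructor 3; exists a|exact: col_eps_c].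
Qed.
End Eps.

End Collapses.

(** * Cocycles on the complex *)

Section Cocycle.
Local Open Scope classical_set_scope.
Local Open Scope group_scope.
Variables (G : groupType) (n : nat) (Gs : 'I_n -> set G).
Implicit Types (L : lab Gs) (S : btree n) (i j k l m a b : 'I_n).

Notation vx := (@V G n Gs _).

(* The junk value for a shape that is not listed is the class of the star. *)
Definition Vx S L : Cvertex Gs :=
  match pselect (listed_tree S) with left h => vx h L | right _ => vx (Alpha n) L end.

Lemma VxE S (hS : listed_tree S) L : Vx S L = vx hS L.
Proof.
rewrite /Vx; case: pselect => // hS'; apply: (@V_iso _ _ _ _ _ hS' hS L id).
exact: iso_refl.
Qed.

(** Reflexive adjacency, so that degenerate triangles fall under the cocycle identity [eT]. *)
Definition adjeq (c d : Cvertex Gs) := c = d \/ Cadj c d.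

Lemma adjeq_refl c : adjeq c c. Proof. by left. Qed.
Lemma adjeq_sym c d : adjeq c d -> adjeq d c.
Proof. by case=> [->|/CadjC h]; [left|right]. Qed.

Lemma R1 S S' L (v : vert S) : listed_tree S -> listed_tree S' -> tcol S' v ->
  adjeq (Vx S L) (Vx S' L).
Proof. by move=> hS hS' h; rewrite (VxE hS) (VxE hS'); right; exact: V_adj1 h. Qed.

Lemma R2 S S1 S' L (v : vert S) (w : vert S1) : listed_tree S -> listed_tree S1 ->
  listed_tree S' -> tcol S1 v -> tcol S' w -> adjeq (Vx S L) (Vx S' L).
Proof.
move=> hS hS1 hS' h h'; rewrite (VxE hS) (VxE hS').
by right; exact: (V_adj2 hS hS1 hS' L h h').
Qed.

Lemma Vx_relabel S L L' (g : vert S -> G) : listed_tree S ->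
  (forall i, lb L' i = conj_set (lb L i) (g (inl i))) ->
  (forall v, v <> base S -> vg L (parent v) (g v * (g (parent v))^-1)) ->
  Vx S L = Vx S L'.
Proof. by move=> hS E e; rewrite !(VxE hS); exact: V_relabel E e. Qed.

Lemma Vx_relabel_inv S L L' : listed_tree S -> Vx S L = Vx S L' -> exists g : vert S -> G,
  (forall i, lb L' i = conj_set (lb L i) (g (inl i))) /\
  (forall v, v <> base S -> vg L (parent v) (g v * (g (parent v))^-1)).
Proof. by move=> hS; rewrite !(VxE hS) => /V_eq_inv[]. Qed.

Lemma Vx_iso S S' L (f : vert S -> vert S') : listed_tree S -> listed_tree S' ->
  is_iso f -> Vx S L = Vx S' L.
Proof. by move=> hS hS' isof; rewrite (VxE hS) (VxE hS'); exact: V_iso isof. Qed.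

Notation alpha := (Vx (alphaT n)).
Notation rho i j := (Vx (rhoT i j)).
Notation sigma i j k l m := (Vx (sigmaT i j k l m)).
Notation tau i j k l := (Vx (tauT i j k l)).
Notation beta i j := (Vx (betaT i j)).
Notation gamma i j k := (Vx (gammaT i j k)).
Notation delta i j k l m := (Vx (deltaT i j k l m)).
Notation Av i := (Vx (aT i)).
Notation Bv i j k := (Vx (bT i j k)).
Notation Cv i j k l m := (Vx (cT i j k l m)).

Ltac uq := rewrite /= ?inE; ifs; by [].
Ltac lst := first [ exact: Alpha | exact: ShapeA | by apply: Rho; uq | by apply: Sigma; uq
  | by apply: Tau; uq | by apply: Beta; uq | by apply: Gamma; uq | by apply: Delta; uq
  | by apply: Epsilon; uq | by apply: ShapeB; uq | by apply: ShapeC; uq ].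

Lemma R_alpha_A i L : adjeq (alpha L) (Av i L).
Proof. by apply: (R1 L _ _ (col_alpha i)); lst. Qed.

Lemma R_beta_A i j L : i != j -> adjeq (beta i j L) (Av i L).
Proof. by move=> ij; apply: (R1 L _ _ (col_beta_a ij)); lst. Qed.

Lemma R_beta_B a i j L : uniq [:: a; i; j] -> adjeq (beta i j L) (Bv a i j L).
Proof. by move/uniq3=> [ai aj ij]; apply: (R1 L _ _ (col_beta_b ai aj)); lst. Qed.

Lemma R_gamma_A i j k L : uniq [:: i; j; k] -> adjeq (gamma i j k L) (Av i L).
Proof. by move=> u; have [ij ik jk] := uniq3 u; apply: (R1 L _ _ (col_gamma_a u)); lst. Qed.

Lemma R_gamma_B i j k L : uniq [:: i; j; k] -> adjeq (gamma i j k L) (Bv i j k L).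
Proof. by move=> u; have [ij ik jk] := uniq3 u; apply: (R1 L _ _ (col_gamma_j u)); lst. Qed.

Lemma R_rho_alpha i j L : i != j -> adjeq (rho i j L) (alpha L).
Proof. by move=> ij; apply: (R1 L _ _ (col_rho_alpha i j)); lst. Qed.

Lemma R_rho_beta i j L : i != j -> adjeq (rho i j L) (beta i j L).
Proof. by move=> ij; apply: (R1 L _ _ (col_rho_beta ij)); lst. Qed.

Lemma R_rho_gamma i j k L : uniq [:: i; j; k] -> adjeq (rho j k L) (gamma i j k L).
Proof. by move/uniq3=> [ij ik jk]; apply: (R1 L _ _ (col_rho_gamma ij ik)); lst. Qed.

Lemma R_rho_A i j a L : i != j -> adjeq (rho i j L) (Av a L).
Proof. by move=> ij; apply: (R2 L _ _ _ (col_rho_alpha i j) (col_alpha a)); lst. Qed.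

Lemma R_rho_B i j k L : uniq [:: i; j; k] -> adjeq (rho j k L) (Bv i j k L).
Proof.
move=> u; have [ij ik jk] := uniq3 u.
by apply: (R2 L _ _ _ (col_rho_gamma ij ik) (col_gamma_j u)); lst.
Qed.

Section FiveIndices.
Variables i j k l m : 'I_n.
Hypothesis u : uniq [:: i; j; k; l; m].
Let u3 : uniq [:: i; j; k].
Proof. by have [[ij ik il im] [[jk jl jm] [kl km lm]]] := uniq5 u; uq. Qed.
Let u4 : uniq [:: j; k; l; m].
Proof. by have [[ij ik il im] [[jk jl jm] [kl km lm]]] := uniq5 u; uq. Qed.

Ltac five := have [[ij ik il im] [[jk jl jm] [kl km lm]]] := uniq5 u.

Lemma R_sigma_gamma L : adjeq (sigma i j k l m L) (gamma i j k L).
Proof. by five; apply: (R1 L _ _ (col_sigma_gamma u)); lst. Qed.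

Lemma R_sigma_delta L : adjeq (sigma i j k l m L) (delta i j k l m L).
Proof. by five; apply: (R1 L _ _ (col_sigma_j u)); lst. Qed.

Lemma R_sigma_A L : adjeq (sigma i j k l m L) (Av i L).
Proof. by five; apply: (R2 L _ _ _ (col_sigma_gamma u) (col_gamma_a u3)); lst. Qed.

Lemma R_sigma_B L : adjeq (sigma i j k l m L) (Bv i j k L).
Proof. by five; apply: (R2 L _ _ _ (col_sigma_gamma u) (col_gamma_j u3)); lst. Qed.

Lemma R_sigma_C L : adjeq (sigma i j k l m L) (Cv i j k l m L).
Proof. by five; apply: (R2 L _ _ _ (col_sigma_j u) (col_delta_l u)); lst. Qed.

Lemma R_delta_B L : adjeq (delta i j k l m L) (Bv i j k L).
Proof. by five; apply: (R1 L _ _ (col_delta_b u)); lst. Qed.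

Lemma R_delta_C L : adjeq (delta i j k l m L) (Cv i j k l m L).
Proof. by five; apply: (R1 L _ _ (col_delta_l u)); lst. Qed.

Lemma R_tau_delta L : adjeq (tau j k l m L) (delta i j k l m L).
Proof. by five; apply: (R1 L _ _ (col_tau_delta u)); lst. Qed.

Lemma R_tau_C L : adjeq (tau j k l m L) (Cv i j k l m L).
Proof. by five; apply: (R2 L _ _ _ (col_tau_delta u) (col_delta_l u)); lst. Qed.
End FiveIndices.

Section FourIndices.
Variables i j k l : 'I_n.
Hypothesis u : uniq [:: i; j; k; l].
Let u3 : uniq [:: i; k; l].
Proof. by have [[ij ik il jk] [jl kl]] := uniq4 u; uq. Qed.
Ltac four := have [[ij ik il jk] [jl kl]] := uniq4 u.

Lemma R_tau_A L : adjeq (tau i j k l L) (Av i L).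
Proof. by four; apply: (R2 L _ _ _ (col_tau_gamma u) (col_gamma_a u3)); lst. Qed.

Lemma R_tau_beta L : adjeq (tau i j k l L) (beta i j L).
Proof. by four; apply: (R1 L _ _ (col_tau_beta u)); lst. Qed.

Lemma R_tau_gamma L : adjeq (tau i j k l L) (gamma i k l L).
Proof. by four; apply: (R1 L _ _ (col_tau_gamma u)); lst. Qed.

Lemma R_tau_B' L : adjeq (tau i j k l L) (Bv i k l L).
Proof. by four; apply: (R2 L _ _ _ (col_tau_gamma u) (col_gamma_j u3)); lst. Qed.

Lemma R_tau_B a L : a != i -> a != j -> adjeq (tau i j k l L) (Bv a i j L).
Proof. by four => ai aj; apply: (R2 L _ _ _ (col_tau_beta u) (col_beta_b ai aj)); lst. Qed.
End FourIndices.

Section Symmetries.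
Variable L : lab Gs.

Lemma rho_sym i j : i != j -> rho i j L = rho j i L.
Proof.
move=> ij; apply: (@Vx_iso _ _ L (id : vert (rhoT i j) -> vert (rhoT j i))); [lst|lst|].
split=> //; first by exists id.
by case=> [a|x] //=; rewrite /= ?vE; ifs.
Qed.

Lemma tau_sym i j k l : uniq [:: i; j; k; l] -> tau i j k l L = tau i j l k L.
Proof.
move/uniq4 => [[ij ik il jk] [jl kl]].
apply: (@Vx_iso _ _ L (id : vert (tauT i j k l) -> vert (tauT i j l k))); [lst|lst|].
split=> //; first by exists id.
by case=> [a|x] //=; rewrite /= ?vE; ifs.
Qed.

Lemma sigma_sym1 i j k l m : uniq [:: i; j; k; l; m] -> sigma i j k l m L = sigma i k j l m L.
Proof.
move/uniq5 => [[ij ik il im] [[jk jl jm] [kl km lm]]].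
apply: (@Vx_iso _ _ L (id : vert (sigmaT i j k l m) -> vert (sigmaT i k j l m))); [lst|lst|].
split=> //; first by exists id.
by case=> [a|x] //=; rewrite /= ?vE; ifs.
Qed.

Lemma sigma_sym2 i j k l m : uniq [:: i; j; k; l; m] -> sigma i j k l m L = sigma i l m j k L.
Proof.
move/uniq5 => [[ij ik il im] [[jk jl jm] [kl km lm]]].
pose f (x : 'I_n + 'I_2) : 'I_n + 'I_2 := match x with inl a => inl a
  | inr o => inr (if o == ord0 then ord_max else ord0) end.
apply: (@Vx_iso _ _ L (f : vert (sigmaT i j k l m) -> vert (sigmaT i l m j k))); [lst|lst|].
split=> //; first by exists f => -[a|x] //=; case: (ord2 x) => ->.
by case=> [a|x] //=; rewrite /= ?vE; ifs.
Qed.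

Lemma C_sym i j k l m : uniq [:: i; j; k; l; m] -> Cv i j k l m L = Cv i l m j k L.
Proof.
move/uniq5 => [[ij ik il im] [[jk jl jm] [kl km lm]]].
apply: (@Vx_iso _ _ L (id : vert (cT i j k l m) -> vert (cT i l m j k))); [lst|lst|].
split=> //; first by exists id.
by case=> [a|x] //=; rewrite /= ?vE; ifs.
Qed.
End Symmetries.


Variables (Pi : groupType) (e : Cvertex Gs -> Cvertex Gs -> Pi).
Hypothesis eT : forall x y z, adjeq x y -> adjeq y z -> adjeq x z -> e x y * e y z = e x z.

Lemma e1 x : e x x = 1.
Proof. by apply: (mulgI (e x x)); rewrite mulg1 eT //; exact: adjeq_refl. Qed.

Lemma eV x y : adjeq x y -> e y x = (e x y)^-1.
Proof.
move=> xy; apply: (mulgI (e x y)); rewrite mulgV eT ?e1 //; first exact: adjeq_sym.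
exact: adjeq_refl.
Qed.

(* Two triangles [x y b], [y b r], ... with common vertex [y], completed by the
   cone from [r] on [a], [b], [y] and [z]. *)
Lemma e_cone (x y a b r z : Cvertex Gs) : adjeq x y -> adjeq x a -> adjeq x b -> adjeq y a ->
  adjeq y b -> adjeq r y ->
  adjeq r a -> adjeq r b -> adjeq r z -> adjeq a z -> e x a * e a z = e x b * e b r * e r z.
Proof.
move=> xy xa xb ya yb ry ra rb rz az.
rewrite -(eT xy ya xa) -(eT xy yb xb) -!mulgA; congr (_ * _).
have -> : e a z = e a r * e r z by rewrite eT //; exact: adjeq_sym.
by rewrite !mulgA (eT ya (adjeq_sym ra) (adjeq_sym ry)) (eT yb (adjeq_sym rb) (adjeq_sym ry)).
Qed.

(** Fixed routes from the vertices of shapes B and C to the star with the same labelling; for shape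
    A the route is an edge. The lemmas that follow show that the shapes [gamma], [beta], [sigma] and
    [tau] see the same value along the route through A as along these. *)
Definition pathB i j k L := e (Bv i j k L) (rho j k L) * e (rho j k L) (alpha L).
Definition pathC i j k l m L :=
  e (Cv i j k l m L) (sigma i j k l m L) * e (sigma i j k l m L) (Av i L) * e (Av i L) (alpha L).

Lemma gamma_B i j k L : uniq [:: i; j; k] ->
  e (gamma i j k L) (Av i L) * e (Av i L) (alpha L) =
  e (gamma i j k L) (Bv i j k L) * pathB i j k L.
Proof.
move=> u; have [ij ik jk] := uniq3 u; rewrite /pathB mulgA.
apply: (e_cone (y := gamma i j k L)); try exact: adjeq_refl.
- exact: R_gamma_A.
- exact: R_gamma_B.
- exact: R_gamma_A.
- exact: R_gamma_B.
- exact: R_rho_gamma.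
- exact: R_rho_A.
- exact: R_rho_B.
- exact: R_rho_alpha.
- exact/adjeq_sym/R_alpha_A.
Qed.

Lemma beta_B a i j L : uniq [:: a; i; j] ->
  e (beta i j L) (Av i L) * e (Av i L) (alpha L) =
  e (beta i j L) (Bv a i j L) * pathB a i j L.
Proof.
move=> u; have [ai aj ij] := uniq3 u; rewrite /pathB mulgA.
apply: (e_cone (y := beta i j L)); try exact: adjeq_refl.
- exact: R_beta_A.
- exact: R_beta_B.
- exact: R_beta_A.
- exact: R_beta_B.
- exact: R_rho_beta.
- exact: R_rho_A.
- exact: R_rho_B.
- exact: R_rho_alpha.
- exact/adjeq_sym/R_alpha_A.
Qed.

Lemma sigma_B i j k l m L : uniq [:: i; j; k; l; m] ->
  e (sigma i j k l m L) (Av i L) * e (Av i L) (alpha L) =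
  e (sigma i j k l m L) (Bv i j k L) * pathB i j k L.
Proof.
move=> u; have [[ij ik il im] [[jk jl jm] [kl km lm]]] := uniq5 u.
have u3 : uniq [:: i; j; k] by uq.
rewrite -(eT (R_sigma_gamma u L) (R_gamma_A L u3) (R_sigma_A u L)) -mulgA gamma_B //.
by rewrite mulgA (eT (R_sigma_gamma u L) (R_gamma_B L u3) (R_sigma_B u L)).
Qed.

Lemma tau_B a i j k l L : uniq [:: i; j; k; l] -> a != i -> a != j ->
  e (tau i j k l L) (Av i L) * e (Av i L) (alpha L) =
  e (tau i j k l L) (Bv a i j L) * pathB a i j L.
Proof.
move=> u ai aj; have [[ij ik il jk] [jl kl]] := uniq4 u.
have u3 : uniq [:: a; i; j] by uq.
rewrite -(eT (R_tau_beta u L) (R_beta_A L ij) (R_tau_A u L)) -mulgA (beta_B _ u3).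
by rewrite mulgA (eT (R_tau_beta u L) (R_beta_B L u3) (R_tau_B u L ai aj)).
Qed.

Lemma tau_B' i j k l L : uniq [:: i; j; k; l] ->
  e (tau i j k l L) (Av i L) * e (Av i L) (alpha L) =
  e (tau i j k l L) (Bv i k l L) * pathB i k l L.
Proof.
move=> u; have [[ij ik il jk] [jl kl]] := uniq4 u.
have u3 : uniq [:: i; k; l] by uq.
rewrite -(eT (R_tau_gamma u L) (R_gamma_A L u3) (R_tau_A u L)) -mulgA gamma_B //.
by rewrite mulgA (eT (R_tau_gamma u L) (R_gamma_B L u3) (R_tau_B' u L)).
Qed.

(** [tau] and [sigma] share the collapse [delta], and with it a B and a C. Triangles containing
    [delta] replace the route through B, known from [tau_B] and [sigma_B], by the route through
    C. *)
Lemma tau_C i j k l m L : uniq [:: i; j; k; l; m] ->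
  e (tau j k l m L) (Av j L) * e (Av j L) (alpha L) =
  e (tau j k l m L) (Cv i j k l m L) * pathC i j k l m L.
Proof.
move=> u; have [[ij ik il im] [[jk jl jm] [kl km lm]]] := uniq5 u.
have u4 : uniq [:: j; k; l; m] by uq.
rewrite (tau_B _ u4 ij ik) /pathC -[X in _ = _ * X]mulgA (sigma_B _ u) !mulgA; congr (_ * _ * _).
have td := R_tau_delta u L; have ds := adjeq_sym (R_sigma_delta u L).
have dC := R_delta_C u L; have dB := R_delta_B u L.
rewrite -(eT td dC (R_tau_C u L)) -(mulgA (e _ _)).
rewrite (eT dC (adjeq_sym (R_sigma_C u L)) ds) -(mulgA (e _ _)).
rewrite (eT ds (R_sigma_B u L) dB) (eT td dB) //.
by apply: R_tau_B.
Qed.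

(* The holonomy between the stars of two labellings in the same class of shape A. *)
Definition step i L L' := e (alpha L) (Av i L) * e (Av i L) (alpha L').

Lemma step_beta a j k L L' : uniq [:: a; j; k] -> beta j k L = beta j k L' ->
  Av j L = Av j L' -> Bv a j k L = Bv a j k L' ->
  pathB a j k L * step j L L' = pathB a j k L'.
Proof.
move=> u Eb EA EB; have [aj ak jk] := uniq3 u; have := beta_B L' u; have := beta_B L u.
rewrite -Eb -EA -EB => H1 H2; apply: (mulgI (e (beta j k L) (Bv a j k L))).
rewrite mulgA -H1 -H2 -mulgA; congr (_ * _); rewrite /step.
by rewrite mulgA (eT (adjeq_sym (R_alpha_A j L)) (R_alpha_A j L)) ?e1 ?mul1g //;
  exact: adjeq_refl.
Qed.

Lemma step_gamma i j k L L' : uniq [:: i; j; k] -> gamma i j k L = gamma i j k L' ->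
  Av i L = Av i L' -> Bv i j k L = Bv i j k L' ->
  pathB i j k L * step i L L' = pathB i j k L'.
Proof.
move=> u Eb EA EB; have := gamma_B L' u; have := gamma_B L u.
rewrite -Eb -EA -EB => H1 H2; apply: (mulgI (e (gamma i j k L) (Bv i j k L))).
rewrite mulgA -H1 -H2 -mulgA; congr (_ * _); rewrite /step.
by rewrite mulgA (eT (adjeq_sym (R_alpha_A i L)) (R_alpha_A i L)) ?e1 ?mul1g //;
  exact: adjeq_refl.
Qed.

Lemma step_tau i j k l m L L' : uniq [:: i; j; k; l; m] -> tau j k l m L = tau j k l m L' ->
  Av j L = Av j L' -> Cv i j k l m L = Cv i j k l m L' ->
  pathC i j k l m L * step j L L' = pathC i j k l m L'.
Proof.
move=> u Eb EA EB; have := tau_C L' u; have := tau_C L u.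
rewrite -Eb -EA -EB => H1 H2; apply: (mulgI (e (tau j k l m L) (Cv i j k l m L))).
rewrite mulgA -H1 -H2 -mulgA; congr (_ * _); rewrite /step.
by rewrite mulgA (eT (adjeq_sym (R_alpha_A j L)) (R_alpha_A j L)) ?e1 ?mul1g //;
  exact: adjeq_refl.
Qed.

Lemma step_sigma i j k l m L L' : sigma i j k l m L = sigma i j k l m L' ->
  Av i L = Av i L' -> Cv i j k l m L = Cv i j k l m L' ->
  pathC i j k l m L * step i L L' = pathC i j k l m L'.
Proof.
move=> Eb EA EB; rewrite /pathC -Eb -EA -EB /step -!mulgA; congr (_ * (_ * _)).
by rewrite mulgA (eT (adjeq_sym (R_alpha_A i L)) (R_alpha_A i L)) ?e1 ?mul1g //;
  exact: adjeq_refl.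
Qed.

Lemma pathC_sym i j k l m L : uniq [:: i; j; k; l; m] ->
  pathC i l m j k L = pathC i j k l m L.
Proof. by move=> u; rewrite /pathC (C_sym L u) (sigma_sym2 L u). Qed.


Lemma step_trans i L M N : Av i L = Av i M -> step i L M * step i M N = step i L N.
Proof.
move=> E; rewrite /step -E !mulgA -[_ * _ * e (alpha M) _]mulgA.
have aA : adjeq (alpha M) (Av i L) by rewrite E; exact: R_alpha_A.
by rewrite (eT (adjeq_sym aA) aA (adjeq_refl _)) e1 mulg1.
Qed.

Lemma step_alpha i L L' : alpha L = alpha L' -> step i L L' = 1.
Proof.
move=> E; rewrite /step -E.
by rewrite (eT (R_alpha_A i L) (adjeq_sym (R_alpha_A i L)) (adjeq_refl _)) e1.
Qed.

Lemma stepV i L L' : Av i L = Av i L' -> step i L' L = (step i L L')^-1.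
Proof.
by move=> E; apply: (mulgI (step i L L')); rewrite step_trans // step_alpha // mulgV.
Qed.

Lemma adjA_Av i L L' : adjA i L L' <-> Av i L = Av i L'.
Proof.
split=> [[g [Hg E]]|/Vx_relabel_inv].
  apply: (@Vx_relabel (aT i) _ _ (fun v => if v is inl a then g a else 1)) => [|a|]; first by lst.
    by rewrite E.
  by case=> [a|[]//] /= ai; apply: Hg; apply/eqP => ai'; apply: ai; rewrite ai'.
move=> /(_ (ShapeA i))[g [E Hg]]; exists (fun a => g (inl a)); split.
  by move=> a ai; apply: (Hg (inl a)) => -[ai']; rewrite ai' eqxx in ai.
by apply/funext => a; exact: E.
Qed.

Lemma eqA_alpha L L' : eqA L L' -> alpha L = alpha L'.
Proof.
move=> [g E]; apply: (@Vx_relabel (alphaT n) _ _ (fun=> g)) => [|a|v _]; first by lst.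
  by rewrite E.
by rewrite mulgV; case: (parent v) => [a|//]; case: (lab_subgp L a).
Qed.

Definition one a (x : G) (c : 'I_n) : G := if c == a then x else 1.

(** In each of the trees concerned [a] is a leaf attached to [i], so conjugating [a] alone by an
    element of [H i] stays within the class. *)
Lemma step_one m i a k l (x : G) L L' : uniq [:: m; i; a; k; l] -> lb L i x ->
  lb L' = cj (lb L) (one a x) ->
  pathC m i a k l L * step i L L' = pathC m i a k l L'.
Proof.
move=> u Hx E; have [[mi ma mk ml] [[ia ik il] [ak al kl]]] := uniq5 u.
have sL b : lb L b 1 by case: (lab_subgp L b).
pose gx (S : btree n) (v : vert S) := if v is inl b then one a x b else 1.
have E' (S : btree n) c : lb L' c = conj_set (lb L c) (gx S (inl c)) by rewrite E.
apply: step_tau => //.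
- apply: (Vx_relabel (g := gx (tauT i a k l)) _ (E' _)); first by lst.
  case=> [c|y] /= _; rewrite /gx /one /= ?vE; last by rewrite mulgV.
  by ifs; rewrite ?invg1 ?mulg1 ?mulgV //=.
- apply: (Vx_relabel (g := gx (aT i)) _ (E' _)); first by lst.
  by case=> [c|[]//] /= _; rewrite /gx /one /= ?vE; ifs; rewrite ?invg1 ?mulg1.
- apply: (Vx_relabel (g := gx (cT m i a k l)) _ (E' _)); first by lst.
  by case=> [c|[]//] /= _; rewrite /gx /one /= ?vE; ifs; rewrite ?invg1 ?mulg1.
Qed.

Definition square i j (f g : 'I_n -> G) := forall L L1 L2 L3,
  (forall a, lb L i (f a)) -> (forall a, lb L j (g a)) ->
  lb L1 = cj (lb L) f -> lb L2 = cj (lb L) g -> lb L3 = cj (lb L) (fun a => f a * g a) ->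
  step i L L1 * step j L1 L3 = step j L L2 * step i L2 L3.

Lemma square_sym i j f g : disj f g -> square j i g f -> square i j f g.
Proof.
move=> d sq L L1 L2 L3 Hf Hg E1 E2 E3; symmetry; apply: sq => //.
by rewrite E3; congr cj; apply/funext => a; exact: disj_comm.
Qed.

(** All four corners define the same vertex of shape C, with basepoint [m] and branches [i - a] and
    [j - b]. Along each side [pathC] is multiplied by the [step] of that side, so both ways around
    give the same product. *)
Lemma square_one m i j a b (x y : G) : uniq [:: m; i; a; j; b] ->
  square i j (one a x) (one b y).
Proof.
move=> u; have [[mi ma mj mb] [[ia ij ib] [aj ab jb]]] := uniq5 u.
have u' : uniq [:: m; j; b; i; a] by uq.
move=> L L1 L2 L3 Hf Hg E1 E2 E3.
have Hx : lb L i x by have := Hf a; rewrite /one eqxx.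
have Hy : lb L j y by have := Hg b; rewrite /one eqxx.
have Hx2 : lb L2 i x by rewrite E2 /cj /one (negbTE ib) conj_set1.
have Hy1 : lb L1 j y by rewrite E1 /cj /one (eq_sym j) (negbTE aj) conj_set1.
have E13 : lb L3 = cj (lb L1) (one b y) by rewrite E1 cjM.
have E23 : lb L3 = cj (lb L2) (one a x).
  rewrite E2 cjM E3; congr cj; apply/funext => c; rewrite /one.
  by case: (eqVneq c a) => [->|]; rewrite ?(negbTE ab) ?mulg1 ?mul1g.
apply: (mulgI (pathC m i a j b L)); rewrite [LHS]mulgA [RHS]mulgA (step_one u Hx E1).
rewrite -(pathC_sym _ u) (step_one u' Hy1 E13) -(pathC_sym _ u) (step_one u' Hy E2).
by rewrite !(pathC_sym _ u) (step_one u Hx2 E23).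
Qed.

Lemma move_Av i f L L' : (forall a, lb L i (f a)) -> f i = 1 -> lb L' = cj (lb L) f ->
  Av i L = Av i L'.
Proof.
by move=> Hf fi E; apply/adjA_Av; exists f; split=> // a _; rewrite fi invg1 mulg1.
Qed.

(** Induction on the support of [f]: one factor [a] is split off, and the square of this
    single-factor move is pasted to the square of the rest along the side from [M] to [N]. *)
Lemma square_ind i j f g : i != j -> disj f g -> f i = 1 -> f j = 1 -> g i = 1 -> g j = 1 ->
  (forall a (x : G), a != i -> a != j -> g a = 1 -> square i j (one a x) g) -> square i j f g.
Proof.
move=> ij d fi fj gi gj one_sq.
have [k] := ubnP #|[pred a | f a != 1]|; elim: k f fi fj d => // k IHk f fi fj d fk.
move=> L L1 L2 L3 Hf Hg E1 E2 E3.
have [a /= fa|f1] := pickP [pred a | f a != 1]; last first.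
  have {}f1 a : f a = 1 by have /negbFE/eqP := f1 a.
  have -> : L1 = L by apply: lab_inj; rewrite -/(lb L1) E1 -[RHS]cj1; congr cj; exact/funext.
  have -> : L3 = L2.
    apply: lab_inj; rewrite -/(lb L3) -/(lb L2) E3 E2; congr cj; apply/funext => a.
    by rewrite f1 mul1g.
  by rewrite !(step_alpha _ (erefl _)) mul1g mulg1.
have ai : a != i by apply/eqP => ai; rewrite /= ai fi eqxx in fa.
have aj : a != j by apply/eqP => aj; rewrite /= aj fj eqxx in fa.
have ga : g a = 1 by case: (d a) => // fa1; rewrite /= fa1 eqxx in fa.
pose f1 := one a (f a); pose f2 b := if b == a then 1 else f b.
have f12 b : f1 b * f2 b = f b.
  by rewrite /f1 /f2 /one; case: eqP => [->|_]; rewrite ?mulg1 ?mul1g.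
have H1 b : lb L i (f1 b).
  by rewrite /f1 /one; case: eqP => // _; case: (lab_subgp L i).
have f1i : f1 i = 1 by rewrite /f1 /one eq_sym (negbTE ai).
have f1j : f1 j = 1 by rewrite /f1 /one eq_sym (negbTE aj).
have [M EM] := lab_move H1 f1i.
have H2i b : lb L i (f2 b).
  by rewrite /f2; case: eqP => // _; case: (lab_subgp L i).
have HM b : lb M i (f2 b) by rewrite EM /cj f1i conj_set1.
have HgM b : lb M j (g b) by rewrite EM /cj f1j conj_set1.
have H1' b : lb L2 i (f1 b) by rewrite E2 /cj gi conj_set1.
have [N EN] := lab_move H1' f1i.
have d1 b : f1 b = 1 \/ g b = 1.
  by rewrite /f1 /one; case: eqP => [->|_]; [right|left].
have d2 : disj f2 g by move=> b; rewrite /f2; case: eqP => [_|_]; [left|].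
have f2i : f2 i = 1 by rewrite /f2 eq_sym (negbTE ai).
have f2j : f2 j = 1 by rewrite /f2 eq_sym (negbTE aj).
have EN' : lb N = cj (lb L) (fun b => f1 b * g b).
  by rewrite EN E2 cjM; congr cj; apply/funext => b; rewrite (disj_comm _ d1).
have EL1 : lb L1 = cj (lb M) f2.
  by rewrite EM cjM E1; congr cj; apply/funext => b; rewrite f12.
have ENM : lb N = cj (lb M) g by rewrite EN' EM cjM.
have EL3 : lb L3 = cj (lb M) (fun b => f2 b * g b).
  by rewrite EM cjM E3; congr cj; apply/funext => b; rewrite mulgA f12.
have EL3N : lb L3 = cj (lb N) f2.
  rewrite ENM EL3 cjM; congr cj; apply/funext => b; rewrite (disj_comm _ d2) //.
have HN b : lb N i (f2 b) by rewrite EN' /cj f1i gi mulg1 conj_set1.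
have sq1 := one_sq a (f a) ai aj ga L M L2 N H1 Hg EM E2 EN'.
have sq2 : step i M L1 * step j L1 L3 = step j M N * step i N L3.
  apply: (IHk f2 f2i f2j d2 _ M L1 N L3 HM HgM EL1 ENM EL3).
  rewrite -ltnS; apply: leq_trans fk; rewrite ltnS [leqRHS](cardD1 a) inE fa ltnS.
  apply: subset_leq_card; apply/fintype.subsetP => b; rewrite !inE /f2.
  by case: (eqVneq b a) => [_|_] /=; rewrite ?eqxx.
have A1 : Av i L = Av i M by apply: move_Av EM.
have A2 : Av i L2 = Av i N by apply: move_Av EN.
by rewrite -(step_trans _ A1) -mulgA sq2 mulgA sq1 -mulgA (step_trans _ A2).
Qed.

Lemma squareT i j f g : (5 <= n)%N -> i != j -> disj f g ->
  f i = 1 -> f j = 1 -> g i = 1 -> g j = 1 -> square i j f g.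
Proof.
move=> n5 ij d fi fj gi gj; apply: square_ind => // a x ai aj ga.
have ji : j != i by rewrite eq_sym.
have one1 c (z : G) b : b != c -> one c z b = 1 by rewrite /one => /negbTE->.
have ia : one a x i = 1 by rewrite one1 // eq_sym.
have ja : one a x j = 1 by rewrite one1 // eq_sym.
have da : disj (one a x) g by move=> b; rewrite /one; case: eqP => [->|_]; [right|left].
apply: square_sym => //; apply: square_ind => //; first exact: disjC.
move=> b y bj bi xb.
(* A repeated index makes [x] trivial by [xb], and the square degenerates. *)
have [ab|ab] := eqVneq b a.
  have -> : one a x = one a 1.
    by apply/funext => c; rewrite /one; case: eqP => // ca; move: xb; rewrite ab /one eqxx.
  move=> L L1 L2 L3 Hf Hg E1 E2 E3.
  have -> : L2 = L.
    apply: lab_inj; rewrite -/(lb L2) E2 -[RHS]cj1; congr cj; apply/funext => c.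
    by rewrite /one; case: eqP.
  have -> : L3 = L1.
    apply: lab_inj; rewrite -/(lb L3) -/(lb L1) E3 E1; congr cj; apply/funext => c.
    by rewrite {2}/one; case: ifP; rewrite mulg1.
  by rewrite !(step_alpha _ (erefl _)) mul1g mulg1.
(* A fifth index to serve as the basepoint of the tree of shape C; this is where [n5] enters. *)
have [m /and5P[mi ma mj mb _]] : exists m, [&& m != i, m != a, m != j, m != b & true].
  apply/existsP; rewrite -[X in is_true X]negbK negb_exists; apply/negP => /forallP none.
  suff : (n <= 4)%N by rewrite leqNgt n5.
  rewrite -(card_ord n) -[4%N]/(size [:: i; a; j; b]); apply: leq_trans (card_size _).
  apply: subset_leq_card; apply/fintype.subsetP => m _; have := none m.
  by rewrite !inE !negb_and !negbK orbF !orbA.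
have ab' : a != b by rewrite eq_sym.
by apply: (@square_one m) => //; uq.
Qed.


Hypothesis hG : is_free_product Gs.
Hypothesis hnt : forall i, Gs i <> [set 1].
Hypothesis n5 : (5 <= n)%N.

(* The norm of the first labelling is not bounded by [b]: a walk may start at a
   peak. *)
Inductive walk (b : nat) : lab Gs -> lab Gs -> Pi -> Prop :=
| Walk0 L : walk b L L 1
| WalkS i L M L' t of Av i L = Av i M & (norm M < b)%N & walk b M L' t :
  walk b L L' (step i L M * t).

Lemma walk_mono (b b' : nat) L L' t : (b <= b')%N -> walk b L L' t -> walk b' L L' t.
Proof.
move=> bb; elim=> {L L' t} [L|i L M L' t A lt _ IH]; first exact: Walk0.
by apply: WalkS => //; exact: leq_trans lt bb.
Qed.

Lemma walk_inv (b : nat) L L' t : walk b L L' t -> L = L' \/ exists i M t',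
  [/\ Av i L = Av i M, (norm M < b)%N, walk b M L' t' & t = step i L M * t'].
Proof. by case=> [M|i M N M' t' *]; [left|right; exists i, N, t']. Qed.

Lemma walk_cat (b : nat) L M N t t' : walk b L M t -> walk b M N t' -> walk b L N (t * t').
Proof.
elim=> {L M t} [L|i L M L' t A lt _ IH] h; first by rewrite mul1g.
by rewrite -mulgA; apply: WalkS => //; exact: IH.
Qed.

Lemma alpha_Av i L M : alpha L = alpha M -> Av i L = Av i M.
Proof.
move=> /(Vx_relabel_inv (Alpha n))[g [E Hg]]; apply/adjA_Av.
exists (fun a => g (inl a)); split=> [a ai|]; last by apply/funext => a; exact: E.
have ga b : g (inl b) = g (inr ord0).
  by have /eqP := Hg (inl b) (fun h => ltac:(discriminate h)); rewrite mulg_eq1 invgK => /eqP.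
by rewrite !ga mulgV; case: (lab_subgp L i).
Qed.

Lemma step_alphal i L M N : alpha L = alpha M -> step i L N = step i M N.
Proof. by move=> E; rewrite -(step_trans N (M := M)) ?(step_alpha i E) ?mul1g //;
  exact: alpha_Av. Qed.

(** The induction hypothesis already keeps the walk after [M] below [b]. If [norm M = b], the next
    labelling [K] is strictly lower while the previous one is only known to be at most [b], which is
    the asymmetric situation of [peak]. The detour through [M1], [M3] and [M2] replaces [M]. *)
Lemma walk_lower (b : nat) L L' t : walk b.+1 L L' t -> (norm L <= b)%N -> (norm L' < b)%N ->
  walk b L L' t.
Proof.
elim=> {L L' t} [L|i L M L' t AM ltM wM IH] Lb L'b; first exact: Walk0.
have {IH} wM' : walk b M L' t by apply: IH.
have [Mb|Mb] := ltnP (norm M) b; first exact: WalkS.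
have {Mb ltM} Mb : norm M = b by apply/eqP; rewrite eqn_leq Mb -ltnS ltM.
case/walk_inv: wM' => [E|[j [K [t' [AK ltK wK E]]]]]; first by rewrite -E Mb ltnn in L'b.
rewrite {}E; move: t' wK => {wM}t wK.
have [ij|ij] := eqVneq i j.
  rewrite -ij mulgA step_trans //; apply: WalkS => //.
  by rewrite AM ij.
have A1 : adjA i M L by apply/adjA_Av.
have A2 : adjA j M K by apply/adjA_Av.
rewrite -Mb in Lb ltK.
have [f [g [M1 [M2 [M3 [[Hf Hg d] [[fi fj gi gj] [[E1 E2 E3] [N1 N2 N3]]]]]]]]]
  := peak hnt ij A1 A2 Lb ltK.
have sq := squareT n5 ij d fi fj gi gj Hf Hg E1 E2 E3.
have AM1 : Av i M = Av i M1 by exact: move_Av Hf fi E1.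
have AM2 : Av j M = Av j M2 by exact: move_Av Hg gj E2.
have AM13 : Av j M1 = Av j M3.
  apply: (move_Av (f := g)) => //; last by rewrite E1 cjM E3.
  by move=> a; rewrite E1 /cj fj conj_set1.
have AM23 : Av i M2 = Av i M3.
  apply: (move_Av (f := f)) => //; last first.
    by rewrite E2 cjM E3; congr cj; apply/funext => a; exact: disj_comm.
  by move=> a; rewrite E2 /cj gi conj_set1.
have -> : step i L M * (step j M K * t) =
    step i L M1 * (step j M1 M3 * (step i M3 M2 * (step j M2 K * t))).
  rewrite -(step_trans M (M := M1)) ?AM // (stepV AM1) -(step_trans K AM2).
  rewrite (stepV AM23); move: sq.
  move: (step i L M1) (step i M M1) (step j M1 M3) (step j M M2) (step i M2 M3) (step j M2 K) =>
    s1 s2 s3 s4 s5 s6 sq.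
  rewrite -!mulgA; congr (_ * _); rewrite !mulgA; congr (_ * _ * _).
  by apply: (mulgI s2); apply: (mulIg s5); rewrite !mulgA mulgV mul1g mulgVK.
have w2 : walk b M2 L' (step j M2 K * t).
  by apply: WalkS => //; rewrite -?Mb // -AM2.
have w3 : walk b M3 L' (step i M3 M2 * (step j M2 K * t)).
  by apply: WalkS => //; rewrite -Mb.
have w1 N : Av j N = Av j M3 -> walk b N L' (step j N M3 * (step i M3 M2 * (step j M2 K * t))).
  by move=> AN; apply: WalkS => //; rewrite -Mb.
(* In the first alternative the norm of [M1] may equal [b], but its star is that of [L], so the walk
   can leave directly for [M3]. *)
case: N1 => [/eqA_alpha E|N1].
  rewrite (step_alpha i (esym E)) mul1g (step_alphal j _ E); apply: w1.
  by rewrite -(alpha_Av j E).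
apply: WalkS; [by rewrite AM|by rewrite -Mb|exact: w1].
Qed.

(** All labellings met have norm zero, hence the same star by [norm0_trivial], and every step is
    trivial. *)
Lemma walk_norm0 L L' t : walk 1 L L' t -> norm L = 0%N -> t = 1.
Proof.
elim=> {L L' t} [//|i L M L' t AM ltM _ IH] L0.
have M0 : norm M = 0%N by case: (norm M) ltM.
have n3 : (3 <= n)%N by apply: leq_trans n5.
rewrite (IH M0) mulg1; apply: step_alpha; apply: eqA_alpha.
have [g Eg] := norm0_trivial n3 L0; have [h Eh] := norm0_trivial n3 M0.
exists (g^-1 * h); rewrite Eg cjM Eh; congr cj; apply/funext => a.
by rewrite mulVKg.
Qed.

(** * The potential on the vertices of the complex *)

Section Potential.
Variable L0 : lab Gs.
Hypothesis E0 : lb L0 = Gs.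

Lemma norm_base : norm L0 = 0%N.
Proof.
rewrite (normE hnt (x := fun=> 1)); last by move=> i; rewrite conj_set1 E0.
apply: big1 => p _; apply: big1 => q pq; apply/eqP; rewrite -leqn0.
apply: (@dist_le _ _ _ (lab_fp L0) p q _ [::] 1 1) => //.
- by case: (lab_subgp L0 p).
- by case: (lab_subgp L0 q).
- by rewrite wprod0 !mulg1 mulgV.
Qed.

Lemma walk_closed (b : nat) t : walk b L0 L0 t -> t = 1.
Proof.
case: b => [|b].
  by move/(walk_mono (leqnSn 0)) => /walk_norm0; apply; exact: norm_base.
elim: b => [|b IHb] w; first by apply: walk_norm0 w _; exact: norm_base.
by apply: IHb; apply: walk_lower w _ _; rewrite norm_base.
Qed.

Definition wk L L' t := exists b : nat, walk b L L' t.

Lemma wk_cat L M N t t' : wk L M t -> wk M N t' -> wk L N (t * t').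
Proof.
move=> [b w] [b' w']; exists (maxn b b'); apply: walk_cat.
- exact: walk_mono (leq_maxl _ _) w.
- exact: walk_mono (leq_maxr _ _) w'.
Qed.

Lemma wk_step i L M : Av i L = Av i M -> wk L M (step i L M).
Proof. by move=> A; exists (norm M).+1; rewrite -[step _ _ _]mulg1; apply: WalkS => //;
  exact: Walk0. Qed.

Lemma wk_inv L L' t : wk L L' t -> wk L' L t^-1.
Proof.
move=> [b]; elim=> {L L' t} [L|i L M L' t AM _ _ IH]; first by rewrite invg1; exists 0;
  exact: Walk0.
by rewrite invgM -stepV //; apply: wk_cat IH _; exact: wk_step.
Qed.

Lemma wk_ex L : exists t, wk L0 L t.
Proof.
suff [t w] : exists t, wk L L0 t by exists t^-1; exact: wk_inv.
have := lab_connected hG hnt L E0.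
elim=> {L} [L M [i /adjA_Av A]|L|L M N _ [t w] _ [t' w']].
- by exists (step i L M); exact: wk_step.
- by exists 1, 0; exact: Walk0.
- by exists (t * t'); exact: wk_cat w w'.
Qed.

(** The product along some walk from [L0]. The walk is chosen arbitrarily, and [walk_closed] makes
    the value independent of it. *)
Definition pot L := projT1 (cid (wk_ex L)).

Lemma pot_step i L M : Av i L = Av i M -> pot L * step i L M = pot M.
Proof.
move=> A; rewrite /pot; case: (cid (wk_ex L)) => t /= w; case: (cid (wk_ex M)) => t' /= w'.
have [b] := wk_cat (wk_cat w (wk_step A)) (wk_inv w').
by move/walk_closed => /eqP; rewrite mulg_eq1 invgK => /eqP.
Qed.

(** A relation, because a vertex has many presentations by a shape and a labelling; [pot0_uniq]
    shows that it is functional. *)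
Inductive pot0 : Cvertex Gs -> Pi -> Prop :=
| PotA i L : pot0 (Av i L) (pot L * e (alpha L) (Av i L))
| PotB i j k L of uniq [:: i; j; k] : pot0 (Bv i j k L) (pot L * (pathB i j k L)^-1)
| PotC i j k l m L of uniq [:: i; j; k; l; m] :
  pot0 (Cv i j k l m L) (pot L * (pathC i j k l m L)^-1).


Lemma pot_path i L M (P P' : Pi) : Av i L = Av i M -> P * step i L M = P' ->
  pot L * P^-1 = pot M * P'^-1.
Proof. by move=> A <-; rewrite -(pot_step A) invgM mulgA mulgK. Qed.

Lemma lab_adj i L (g : 'I_n -> G) : (forall a, a != i -> lb L i (g a * (g i)^-1)) ->
  exists M : lab Gs, lb M = cj (lb L) g.
Proof.
move=> Hg; pose f a := g a * (g i)^-1.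
have fi : f i = 1 by rewrite /f mulgV.
have Hf a : lb L i (f a).
  by have [->|/Hg //] := eqVneq a i; rewrite fi; case: (lab_subgp L i).
have [M EM] := lab_move Hf fi; have [N EN] := lab_conj M (g i).
by exists N; rewrite EN EM cjM; congr cj; apply/funext => a; rewrite /f mulgVK.
Qed.

Lemma step_oneB i j k (x : G) L L' : uniq [:: i; j; k] -> lb L j x ->
  lb L' = cj (lb L) (one k x) ->
  pathB i j k L * step j L L' = pathB i j k L'.
Proof.
move=> u Hx E; have [ij ik jk] := uniq3 u.
have sL b : lb L b 1 by case: (lab_subgp L b).
pose gx (S : btree n) (v : vert S) := if v is inl b then one k x b else 1.
have E' (S : btree n) c : lb L' c = conj_set (lb L c) (gx S (inl c)) by rewrite E.
apply: step_beta => //.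
- apply: (Vx_relabel (g := gx (betaT j k)) _ (E' _)); first by lst.
  case=> [c|y] /= _; rewrite /gx /one /= ?vE; last by rewrite mulgV.
  by ifs; rewrite ?invg1 ?mulg1 ?mulgV //=.
- apply: (Vx_relabel (g := gx (aT j)) _ (E' _)); first by lst.
  by case=> [c|[]//] /= _; rewrite /gx /one /= ?vE; ifs; rewrite ?invg1 ?mulg1.
- apply: (Vx_relabel (g := gx (bT i j k)) _ (E' _)); first by lst.
  by case=> [c|[]//] /= _; rewrite /gx /one /= ?vE; ifs; rewrite ?invg1 ?mulg1.
Qed.

Lemma pot_A i L M : Av i L = Av i M ->
  pot L * e (alpha L) (Av i L) = pot M * e (alpha M) (Av i M).
Proof.
move=> A; rewrite -(pot_step A) /step -A !mulgA -(mulgA _ (e (Av i L) _)).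
have aA : adjeq (alpha M) (Av i L) by rewrite A; exact: R_alpha_A.
by rewrite (eT (adjeq_sym aA) aA (adjeq_refl _)) e1 mulg1.
Qed.

(** An equivalence of shape B factors in two. First [h] carries [k] along with [j]: a move of
    operating factor [i] that preserves the class of [gamma]. Then [k] alone is conjugated by an
    element of the factor [j], which preserves the class of [beta]. *)
Lemma pot_B i j k L M : uniq [:: i; j; k] -> Bv i j k L = Bv i j k M ->
  pot L * (pathB i j k L)^-1 = pot M * (pathB i j k M)^-1.
Proof.
move=> u EB; have [ij ik jk] := uniq3 u.
have hB : listed_tree (bT i j k) by lst.
have [g' [E Hg]] := Vx_relabel_inv hB EB; pose g a := g' (inl a).
have {}E a : lb M a = conj_set (lb L a) (g a) by exact: E.
have gk : lb L j (g k * (g j)^-1).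
  by have /= := Hg (inl k); rewrite /= ?vE; ifs; apply; case=> ki; rewrite ki eqxx in ik.
have ga a : a != i -> a != k -> lb L i (g a * (g i)^-1).
  move=> ai ak; have /= := Hg (inl a); rewrite /= ?vE; ifs; apply.
  by case=> ai'; rewrite ai' eqxx in ai.
pose h a := if a == k then g j else g a.
have hj : h j = g j by rewrite /h (negbTE jk).
have hi : h i = g i by rewrite /h (negbTE ik).
have Hh a : a != i -> lb L i (h a * (h i)^-1).
  move=> ai; rewrite hi /h; case: eqP => [_|/eqP ak]; apply: ga => //.
  by rewrite eq_sym.
have [N EN] := lab_adj Hh.
have AN : Av i L = Av i N by apply/adjA_Av; exists h; split.
have sL b : lb L b 1 by case: (lab_subgp L b).
have E1 : pathB i j k L * step i L N = pathB i j k N.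
  apply: step_gamma => //.
    apply: (Vx_relabel (g := fun v : vert (gammaT i j k) => if v is inl a then h a else g j)).
    - by lst.
    - by move=> a; rewrite EN.
    case=> [a|y] /= vb; rewrite /= ?vE; last first.
      by rewrite -hj; apply: Hh; rewrite eq_sym.
    have ai : a != i by apply/eqP => ai; apply: vb; rewrite ai.
    have [aj|aj] := eqVneq a j; first by rewrite aj hj mulgV.
    have [ak|ak] := eqVneq a k; first by rewrite ak /h eqxx mulgV.
    exact: Hh.
  apply: (Vx_relabel (g := fun v : vert (bT i j k) => if v is inl a then h a else 1)).
  - by lst.
  - by move=> a; rewrite EN.
  case=> [a|[]//] /= vb; rewrite /= ?vE.
  have ai : a != i by apply/eqP => ai; apply: vb; rewrite ai.
  have [ak|ak] := eqVneq a k; first by rewrite ak hj /h eqxx mulgV; exact: sL.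
  exact: Hh.
rewrite (pot_path AN E1); pose x := (g j)^-1 * g k.
have Hx : lb N j x.
  have := cj_mem h gk; rewrite hj EN (_ : _ ^ g j = x) //.
  by rewrite conjgE mulgVK.
have EM : lb M = cj (lb N) (one k x).
  rewrite EN cjM; apply/funext => a; rewrite E /cj /one /h; congr conj_set.
  by case: eqP => [->|_]; rewrite ?mulg1 // mulVKg.
have jk' : one k x j = 1 by rewrite /one (negbTE jk).
have Hone a : lb N j (one k x a).
  by rewrite /one; case: eqP => // _; case: (lab_subgp N j).
exact: pot_path (move_Av Hone jk' EM) (step_oneB u Hx EM).
Qed.

(** Three moves: [h] carries [k] with [j] and [m] with [l], preserving the class of [sigma]; then
    [k] is conjugated by the factor [j], and [m] by the factor [l], as in [step_one]. *)
Lemma pot_C i j k l m L M : uniq [:: i; j; k; l; m] -> Cv i j k l m L = Cv i j k l m M ->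
  pot L * (pathC i j k l m L)^-1 = pot M * (pathC i j k l m M)^-1.
Proof.
move=> u EC; have [[ij ik il im] [[jk jl jm] [kl km lm]]] := uniq5 u.
have hC : listed_tree (cT i j k l m) by lst.
have [g' [E Hg]] := Vx_relabel_inv hC EC; pose g a := g' (inl a).
have {}E a : lb M a = conj_set (lb L a) (g a) by exact: E.
have gk : lb L j (g k * (g j)^-1).
  by have /= := Hg (inl k); rewrite /= ?vE; ifs; apply; case=> ki; rewrite ki eqxx in ik.
have gm : lb L l (g m * (g l)^-1).
  by have /= := Hg (inl m); rewrite /= ?vE; ifs; apply; case=> ki; rewrite ki eqxx in im.
have ga a : a != i -> a != k -> a != m -> lb L i (g a * (g i)^-1).
  move=> ai ak am; have /= := Hg (inl a); rewrite /= ?vE; ifs; apply.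
  by case=> ai'; rewrite ai' eqxx in ai.
pose h a := if a == k then g j else if a == m then g l else g a.
have hj : h j = g j by rewrite /h (negbTE jk) (negbTE jm).
have hl : h l = g l by rewrite /h eq_sym (negbTE kl) (negbTE lm).
have hi : h i = g i by rewrite /h (negbTE ik) (negbTE im).
have hk : h k = g j by rewrite /h eqxx.
have hm : h m = g l by rewrite /h eq_sym (negbTE km) eqxx.
have Hh a : a != i -> lb L i (h a * (h i)^-1).
  move=> ai; rewrite hi /h; case: eqP => [_|/eqP ak]; first by apply: ga => //; rewrite eq_sym.
  by case: eqP => [_|/eqP am]; apply: ga => //; rewrite eq_sym.
have [N EN] := lab_adj Hh.
have AN : Av i L = Av i N by apply/adjA_Av; exists h; split.
have E1 : pathC i j k l m L * step i L N = pathC i j k l m N.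
  apply: step_sigma => //.
    apply: (Vx_relabel (g := fun v : vert (sigmaT i j k l m) => match v with
      | inl a => h a | inr o => if o == ord0 then g j else g l end)).
    - by lst.
    - by move=> a; rewrite EN.
    case=> [a|y] /= vb; rewrite /= ?vE; last first.
      by case: (ord2 y) => -> /=; rewrite -?hj -?hl; apply: Hh; rewrite eq_sym.
    have ai : a != i by apply/eqP => ai; apply: vb; rewrite ai.
    have [aj|aj] := eqVneq a j; first by rewrite aj hj mulgV.
    have [ak|ak] := eqVneq a k; first by rewrite ak hk mulgV.
    have [al|al] := eqVneq a l; first by rewrite al hl mulgV.
    have [am|am] := eqVneq a m; first by rewrite am hm mulgV.
    exact: Hh.
  apply: (Vx_relabel (g := fun v : vert (cT i j k l m) => if v is inl a then h a else 1)).
  - by lst.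
  - by move=> a; rewrite EN.
  case=> [a|[]//] /= vb; rewrite /= ?vE.
  have ai : a != i by apply/eqP => ai; apply: vb; rewrite ai.
  have [ak|ak] := eqVneq a k.
    by rewrite ak hk hj mulgV; case: (lab_subgp L j).
  have [am|am] := eqVneq a m.
    by rewrite am hm hl mulgV; case: (lab_subgp L l).
  exact: Hh.
rewrite (pot_path AN E1); pose x := (g j)^-1 * g k; pose y := (g l)^-1 * g m.
have Hx : lb N j x.
  have := cj_mem h gk; rewrite hj EN (_ : _ ^ g j = x) //.
  by rewrite conjgE mulgVK.
have Hy : lb N l y.
  have := cj_mem h gm; rewrite hl EN (_ : _ ^ g l = y) //.
  by rewrite conjgE mulgVK.
have one_k : one k x j = 1 by rewrite /one (negbTE jk).
have one_m : one m y l = 1 by rewrite /one (negbTE lm).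
have Hone a : lb N j (one k x a).
  by rewrite /one; case: eqP => // _; case: (lab_subgp N j).
have [K EK] := lab_move Hone one_k.
have Hy' : lb K l y by rewrite EK /cj /one eq_sym (negbTE kl) conj_set1.
have EM : lb M = cj (lb K) (one m y).
  rewrite EK EN !cjM; apply/funext => a; rewrite E /cj /one /h; congr conj_set.
  have [->|ak] := eqVneq a k; first by rewrite (negbTE km) mulg1 mulVKg.
  by rewrite mul1g; case: eqP => [->|_]; rewrite ?mulg1 // mulVKg.
have Hone' a : lb K l (one m y a).
  by rewrite /one; case: eqP => // _; case: (lab_subgp K l).
have u' : uniq [:: i; l; m; j; k] by uq.
rewrite (pot_path (move_Av Hone one_k EK) (step_one u Hx EK)) -!(pathC_sym _ u).
exact: pot_path (move_Av Hone' one_m EM) (step_one u' Hy' EM).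
Qed.

Lemma Vx_iso0 S S' L L' : listed_tree S -> listed_tree S' -> Vx S L = Vx S' L' ->
  exists f : vert S -> vert S', is_iso f.
Proof. by move=> hS hS'; rewrite (VxE hS) (VxE hS') => /V_eq_inv[]. Qed.

Lemma iso_parent (S S' : btree n) (f : vert S -> vert S') a b : is_iso f ->
  parent (inl a : vert S) = inl b -> parent (inl a : vert S') = inl b.
Proof. by move=> [_ fi _ fp] E; rewrite -(fi a) -fp E fi. Qed.

Lemma iso_base (S S' : btree n) (f : vert S -> vert S') a : is_iso f ->
  base S = inl a -> base S' = inl a.
Proof. by move=> [_ fi fb _] E; rewrite -fb E fi. Qed.

Lemma A_inj i i' L L' : Av i L = Av i' L' -> i = i'.
Proof.
move=> /Vx_iso0[|| f isof]; [lst|lst|].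
by have [->] := iso_base isof (erefl (inl i)).
Qed.

Lemma AB_neq i i' j' k' L L' : uniq [:: i'; j'; k'] -> Av i L <> Bv i' j' k' L'.
Proof.
move=> /uniq3[ij ik jk] /Vx_iso0[|| f isof]; [lst|lst|].
have [ii] := iso_base isof (erefl (inl i)).
have := iso_parent isof (erefl : parent (inl k' : vert (aT i)) = inl i).
by rewrite /= ?vE; ifs => -[ji]; rewrite ii -ji eqxx in ij.
Qed.

Lemma AC_neq i i' j' k' l' m' L L' : uniq [:: i'; j'; k'; l'; m'] ->
  Av i L <> Cv i' j' k' l' m' L'.
Proof.
move=> /uniq5[[ij ik il im] [[jk jl jm] [kl km lm]]] /Vx_iso0[|| f isof]; [lst|lst|].
have [ii] := iso_base isof (erefl (inl i)).
have := iso_parent isof (erefl : parent (inl k' : vert (aT i)) = inl i).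
by rewrite /= ?vE; ifs => -[ji]; rewrite ii -ji eqxx in ij.
Qed.

Lemma B_inj i j k i' j' k' L L' : uniq [:: i; j; k] -> uniq [:: i'; j'; k'] ->
  Bv i j k L = Bv i' j' k' L' -> [/\ i = i', j = j' & k = k'].
Proof.
move=> /uniq3[ij ik jk] /uniq3[ij' ik' jk'] /Vx_iso0[|| f isof]; [lst|lst|].
have [ii] := iso_base isof (erefl (inl i)).
have /(iso_parent isof) : parent (inl k : vert (bT i j k)) = inl j by rewrite /= ?vE; ifs.
rewrite /= ?vE; case: (eqVneq k k') => [kk [jj]|_ [ji]]; first by rewrite -ii jj kk.
by rewrite -ii ji eqxx in ij.
Qed.

Lemma BC_neq i j k i' j' k' l' m' L L' : uniq [:: i; j; k] -> uniq [:: i'; j'; k'; l'; m'] ->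
  Bv i j k L <> Cv i' j' k' l' m' L'.
Proof.
move=> /uniq3[ij ik jk] /uniq5[[ij' ik' il' im'] [[jk' jl' jm'] [kl' km' lm']]].
move=> /esym/Vx_iso0[|| f isof]; [lst|lst|].
have [ii] := iso_base isof (erefl (inl i')).
have /(iso_parent isof) : parent (inl k' : vert (cT i' j' k' l' m')) = inl j'.
  by rewrite /= ?vE; ifs.
have /(iso_parent isof) : parent (inl m' : vert (cT i' j' k' l' m')) = inl l'.
  by rewrite /= ?vE; ifs.
rewrite /= ?vE; case: (eqVneq m' k) => [mk _|_ [li]]; last by rewrite -ii li eqxx in il'.
case: (eqVneq k' k) => [kk _|_ [ji]]; last by rewrite -ii ji eqxx in ij'.
by rewrite kk mk eqxx in km'.
Qed.

Lemma C_inj i j k l m i' j' k' l' m' L L' : uniq [:: i; j; k; l; m] ->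
  uniq [:: i'; j'; k'; l'; m'] -> Cv i j k l m L = Cv i' j' k' l' m' L' ->
  i = i' /\ ([/\ j = j', k = k', l = l' & m = m'] \/ [/\ j = l', k = m', l = j' & m = k']).
Proof.
move=> /uniq5[[ij ik il im] [[jk jl jm] [kl km lm]]].
move=> /uniq5[[ij' ik' il' im'] [[jk' jl' jm'] [kl' km' lm']]].
move=> /Vx_iso0[|| f isof]; [lst|lst|].
have [ii] := iso_base isof (erefl (inl i)).
have /(iso_parent isof) : parent (inl k : vert (cT i j k l m)) = inl j.
  by rewrite /= ?vE; ifs.
have /(iso_parent isof) : parent (inl m : vert (cT i j k l m)) = inl l.
  by rewrite /= ?vE; ifs.
rewrite /= ?vE ii.
case: (eqVneq m k') => [mk [lj]|mk]; case: (eqVneq k k') => [kk|kk].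
- by rewrite kk mk eqxx in km.
- case: (eqVneq k m') => [km1 [jl1]|_ [ji]]; last by rewrite ji eqxx in ij.
  by split=> //; right.
- case: (eqVneq m m') => [mm [ll]|_ [li]]; last by rewrite li eqxx in il.
  by move=> [jj]; split=> //; left.
- case: (eqVneq m m') => [mm [ll]|_ [li]]; last by rewrite li eqxx in il.
  case: (eqVneq k m') => [km1|_ [ji]]; last by rewrite ji eqxx in ij.
  by rewrite km1 mm eqxx in km.
Qed.

Lemma pot0_inv d t : pot0 d t ->
  [\/ exists i L, d = Av i L /\ t = pot L * e (alpha L) (Av i L),
      exists i j k L, [/\ uniq [:: i; j; k], d = Bv i j k L & t = pot L * (pathB i j k L)^-1] |
      exists i j k l m L, [/\ uniq [:: i; j; k; l; m], d = Cv i j k l m L &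
        t = pot L * (pathC i j k l m L)^-1]].
Proof.
case=> [i L|i j k L u|i j k l m L u].
- by constructor 1; exists i, L.
- by constructor 2; exists i, j, k, L.
- by constructor 3; exists i, j, k, l, m, L.
Qed.

(** The vertex determines its shape and its indices, except that the two branches of shape C can be
    exchanged, which [pathC_sym] absorbs. *)
Lemma pot0_uniq d t t' : pot0 d t -> pot0 d t' -> t = t'.
Proof.
move=> /pot0_inv[[i [L [dE ->]]]|[i [j [k [L [u dE ->]]]]]|[i [j [k [l [m [L [u dE ->]]]]]]]].
- move=> /pot0_inv[[i' [L' [E ->]]]|[i' [j' [k' [L' [u' E ->]]]]]|[i' [j' [k' [l' [m' [L' [u' E
  ->]]]]]]]].
  + rewrite {}dE in E; have ii := A_inj E; rewrite -{}ii in E *; exact: pot_A.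
  + by case: (AB_neq u' (etrans (esym dE) E)).
  + by case: (AC_neq u' (etrans (esym dE) E)).
- move=> /pot0_inv[[i' [L' [E ->]]]|[i' [j' [k' [L' [u' E ->]]]]]|[i' [j' [k' [l' [m' [L' [u' E
  ->]]]]]]]].
  + by case: (AB_neq u (etrans (esym E) dE)).
  + rewrite {}dE in E; have [ii jj kk] := B_inj u u' E.
    rewrite -{}ii -{}jj -{}kk in E *; exact: pot_B.
  + by case: (BC_neq u u' (etrans (esym dE) E)).
- move=> /pot0_inv[[i' [L' [E ->]]]|[i' [j' [k' [L' [u' E ->]]]]]|[i' [j' [k' [l' [m' [L' [u' E
  ->]]]]]]]].
  + by case: (AC_neq u (etrans (esym E) dE)).
  + by case: (BC_neq u' u (etrans (esym E) dE)).
  + rewrite {}dE in E; have [ii [[jj kk ll mm]|[jl km lj mk]]] := C_inj u u' E.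
      by rewrite -{}ii -{}jj -{}kk -{}ll -{}mm in E *; exact: pot_C.
    rewrite -{}ii -{}jl -{}km -{}lj -{}mk in E *; rewrite -(C_sym L' u) in E.
    by rewrite (pathC_sym _ u); exact: pot_C.
Qed.

Lemma tree_rank0 S : listed_tree S -> ntriv S = 0%N -> [\/ exists i, S = aT i,
  exists i j k, uniq [:: i; j; k] /\ S = bT i j k |
  exists i j k l m, uniq [:: i; j; k; l; m] /\ S = cT i j k l m].
Proof.
case=> // [i|i j k u|i j k l m u] _.
- by constructor 1; exists i.
- by constructor 2; exists i, j, k.
- by constructor 3; exists i, j, k, l, m.
Qed.

Lemma pot0_ex d : rk d = 0%N -> exists t, pot0 d t.
Proof.
have [S [hS [L ->]]] := V_ex d; rewrite rkV -VxE => /(tree_rank0 hS).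
case=> [[i ->]|[i [j [k [u ->]]]]|[i [j [k [l [m [u ->]]]]]]]; eexists.
- exact: PotA.
- exact: PotB u.
- exact: PotC u.
Qed.

Lemma edge_collapsesI S Q : edge_collapses S Q ->
  edge_collapses S (fun S' => Q S' /\ exists v, @tcol n S S' v).
Proof.
move=> h v vb tv; have [S' [hS' QS' t]] := h v vb tv.
by exists S'; split=> //; split=> //; exists v.
Qed.

Lemma edge_collapses_sub S (Q Q' : btree n -> Prop) : edge_collapses S Q ->
  (forall S', Q S' -> Q' S') -> edge_collapses S Q'.
Proof.
move=> h QQ v vb tv; have [S' [hS' QS' t]] := h v vb tv.
by exists S'; split=> //; exact: QQ.
Qed.

Definition low_rho i j S := (exists a, S = aT a) \/
  exists a, [/\ a != i, a != j & S = bT a i j \/ S = bT a j i].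

Lemma low_rhoP i j S : i != j ->
  [\/ S = alphaT n, S = betaT i j, S = betaT j i |
      exists a, [/\ a != i, a != j & S = gammaT a i j]] ->
  edge_collapses S (low_rho i j).
Proof.
move=> ij; have ji : j != i by rewrite eq_sym.
case=> [->|->|->|[a [ai aj ->]]].
- by apply: (edge_collapses_sub (@enum_alpha n)) => S' [a ->]; left; exists a.
- apply: (edge_collapses_sub (enum_beta ij)) => S' [->|[a [ai aj ->]]]; first by left; exists i.
  by right; exists a; split=> //; left.
- apply: (edge_collapses_sub (enum_beta ji)) => S' [->|[a [ai aj ->]]]; first by left; exists j.
  by right; exists a; split=> //; right.
- have u : uniq [:: a; i; j] by uq.
  apply: (edge_collapses_sub (enum_gamma u)) => S' [->|->|->]; first by left; exists a.
    by right; exists a; split=> //; left.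
  by right; exists a; split=> //; right.
Qed.

Lemma pot2_rho i j L d t : i != j -> Cadj (rho i j L) d -> rk d = 0%N -> pot0 d t ->
  t * e d (rho i j L) = pot L * e (alpha L) (rho i j L).
Proof.
move=> ij h d0 p; have hS : listed_tree (rhoT i j) by lst.
have h' := h; rewrite (VxE hS) in h'.
have [|S [hS' [QS dE]]] := down2 (enum_rho ij) (fun S => @low_rhoP i j S ij) h'.
  by rewrite d0.
have rd : adjeq d (rho i j L) by right; exact: CadjC.
rewrite -VxE in dE; case: QS => [[a Sa]|[a [ai aj [Sa|Sa]]]]; rewrite {S hS'}Sa in dE hS'.
- rewrite dE in p rd *; rewrite (pot0_uniq p (PotA a L)) -mulgA eT //; first exact: R_alpha_A.
  exact/adjeq_sym/R_rho_alpha.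
- have u : uniq [:: a; i; j] by uq.
  rewrite dE in p rd *; rewrite (pot0_uniq p (PotB L u)) /pathB invgM -!mulgA; congr (_ * _).
  by rewrite -(eV rd) (eT (adjeq_sym rd) rd (adjeq_refl _)) e1 mulg1 -eV //; exact: R_rho_alpha.
- have ji : j != i by rewrite eq_sym.
  have u : uniq [:: a; j; i] by uq.
  rewrite (rho_sym L ij) in rd *.
  rewrite dE in p rd *; rewrite (pot0_uniq p (PotB L u)) /pathB invgM -!mulgA; congr (_ * _).
  by rewrite -(eV rd) (eT (adjeq_sym rd) rd (adjeq_refl _)) e1 mulg1 -eV //; exact: R_rho_alpha.
Qed.

Lemma pot2_A i L x d t : adjeq d x -> adjeq x (Av i L) -> d = Av i L -> pot0 d t ->
  t * e d x = pot L * (e x (Av i L) * e (Av i L) (alpha L))^-1.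
Proof.
move=> dx xA dE p; rewrite dE in dx p *; rewrite (pot0_uniq p (PotA i L)).
by rewrite invgM -!mulgA (eV dx) (eV (R_alpha_A i L)) !invgK.
Qed.

Lemma pot2_path x d z (P q t : Pi) : adjeq x d -> t = q * P^-1 -> z = e x d * P ->
  t * e d x = q * z^-1.
Proof. by move=> xd -> ->; rewrite invgM mulgA -(eV xd). Qed.

(** In the cases B and C the indices are known only up to the symmetries of [sigma]. The last
    component records that the renamed indices give the same [sigma], so that one computation serves
    all the symmetric cases. *)
Definition low_sigma i j k l m S := [\/ S = aT i,
  exists x y z w, [/\ uniq [:: i; x; y; z; w], S = bT i x y &
    forall L, sigma i x y z w L = sigma i j k l m L] |
  exists x y z w, [/\ uniq [:: i; x; y; z; w], S = cT i x y z w &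
    forall L, sigma i x y z w L = sigma i j k l m L]].

Lemma low_sigmaP i j k l m S : uniq [:: i; j; k; l; m] ->
  [\/ S = gammaT i j k, S = gammaT i l m |
      [\/ S = deltaT i j k l m, S = deltaT i k j l m, S = deltaT i l m j k |
          S = deltaT i m l j k]] ->
  edge_collapses S (low_sigma i j k l m).
Proof.
move=> u; have [[ij ik il im] [[jk jl jm] [kl km lm]]] := uniq5 u.
have ikjlm : uniq [:: i; k; j; l; m] by uq.
have ilmjk : uniq [:: i; l; m; j; k] by uq.
have imljk : uniq [:: i; m; l; j; k] by uq.
have ijkml : uniq [:: i; j; k; m; l] by uq.
have ikjml : uniq [:: i; k; j; m; l] by uq.
have ilmkj : uniq [:: i; l; m; k; j] by uq.
have imlkj : uniq [:: i; m; l; k; j] by uq.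
have s1 L : sigma i k j l m L = sigma i j k l m L by rewrite -(sigma_sym1 L u).
have s2 L : sigma i l m j k L = sigma i j k l m L by rewrite -(sigma_sym2 L u).
have s3 L : sigma i m l j k L = sigma i j k l m L by rewrite -(sigma_sym1 L ilmjk).
have s4 L : sigma i j k m l L = sigma i j k l m L by rewrite -s3 (sigma_sym2 L ijkml).
have s5 L : sigma i k j m l L = sigma i j k l m L by rewrite -(sigma_sym1 L ijkml).
have s6 L : sigma i l m k j L = sigma i j k l m L by rewrite -(sigma_sym2 L ikjlm).
have s7 L : sigma i m l k j L = sigma i j k l m L by rewrite -(sigma_sym1 L ilmkj).
have ijk : uniq [:: i; j; k] by uq.
have ilm : uniq [:: i; l; m] by uq.
case=> [->|->|[->|->|->|->]].
- apply: (edge_collapses_sub (enum_gamma ijk)) => S' [->|->|->]; first by constructor 1.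
    by constructor 2; exists j, k, l, m.
  by constructor 2; exists k, j, l, m.
- apply: (edge_collapses_sub (enum_gamma ilm)) => S' [->|->|->]; first by constructor 1.
    by constructor 2; exists l, m, j, k.
  by constructor 2; exists m, l, j, k.
- apply: (edge_collapses_sub (enum_delta u)) => S' [->|->|->].
  + by constructor 2; exists j, k, l, m.
  + by constructor 3; exists j, k, l, m.
  + by constructor 3; exists j, k, m, l.
- apply: (edge_collapses_sub (enum_delta ikjlm)) => S' [->|->|->].
  + by constructor 2; exists k, j, l, m.
  + by constructor 3; exists k, j, l, m.
  + by constructor 3; exists k, j, m, l.
- apply: (edge_collapses_sub (enum_delta ilmjk)) => S' [->|->|->].
  + by constructor 2; exists l, m, j, k.
  + by constructor 3; exists l, m, j, k.
  + by constructor 3; exists l, m, k, j.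
- apply: (edge_collapses_sub (enum_delta imljk)) => S' [->|->|->].
  + by constructor 2; exists m, l, j, k.
  + by constructor 3; exists m, l, j, k.
  + by constructor 3; exists m, l, k, j.
Qed.

Lemma pot2_sigma i j k l m L d t : uniq [:: i; j; k; l; m] ->
  Cadj (sigma i j k l m L) d -> rk d = 0%N -> pot0 d t ->
  t * e d (sigma i j k l m L) =
  pot L * (e (sigma i j k l m L) (Av i L) * e (Av i L) (alpha L))^-1.
Proof.
move=> u h d0 p; have hS : listed_tree (sigmaT i j k l m) by exact: Sigma.
have h' := h; rewrite (VxE hS) in h'.
have [|S [hS' [QS dE]]] := down2 (enum_sigma u) (fun S => @low_sigmaP i j k l m S u) h'.
  by rewrite d0.
have rd : adjeq d (sigma i j k l m L) by right; exact: CadjC.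
rewrite -VxE in dE; case: QS => [Sa|[x [y [z [w [u' Sa sE]]]]]|[x [y [z [w [u' Sa sE]]]]]];
  rewrite {S hS'}Sa in dE hS'.
- by apply: pot2_A => //; exact: R_sigma_A.
- have [[ix iy iz iw] [[xy xz xw] [yz yw zw]]] := uniq5 u'.
  have u3 : uniq [:: i; x; y] by uq.
  rewrite dE in p rd *; rewrite -sE in rd *.
  by apply: (pot2_path (adjeq_sym rd) (pot0_uniq p (PotB L u3))); exact: sigma_B.
- rewrite dE in p rd *; rewrite -sE in rd *.
  apply: (pot2_path (adjeq_sym rd) (pot0_uniq p (PotC L u'))).
  rewrite /pathC !mulgA (eT (adjeq_sym rd) rd (adjeq_refl _)) e1 mul1g //.
Qed.

Definition low_tau i j k l S := [\/ S = aT i,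
  exists a, [/\ a != i, a != j & S = bT a i j],
  exists x y, [/\ uniq [:: i; j; x; y], S = bT i x y & forall L, tau i j x y L = tau i j k l L] |
  exists a x y, [/\ uniq [:: a; i; j; x; y], S = cT a i j x y &
    forall L, tau i j x y L = tau i j k l L]].

Lemma low_tauP i j k l S : uniq [:: i; j; k; l] ->
  [\/ S = gammaT i k l, S = betaT i j, (S = epsT i j k l \/ S = epsT i j l k) |
      exists a, uniq [:: a; i; j; k; l] /\ S = deltaT a i j k l] ->
  edge_collapses S (low_tau i j k l).
Proof.
move=> u; have [[ij ik il jk] [jl kl]] := uniq4 u.
have u' : uniq [:: i; j; l; k] by uq.
have s1 L : tau i j l k L = tau i j k l L by rewrite -(tau_sym L u).
have ikl : uniq [:: i; k; l] by uq.
case=> [->|->|[->|->]|[a [ua ->]]].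
- apply: (edge_collapses_sub (enum_gamma ikl)) => S' [->|->|->]; first by constructor 1.
    by constructor 3; exists k, l.
  by constructor 3; exists l, k.
- apply: (edge_collapses_sub (enum_beta ij)) => S' [->|[a [ai aj ->]]]; first by constructor 1.
  by constructor 2; exists a.
- apply: (edge_collapses_sub (enum_eps u)) => S' [->|->|[a [ua ->]]].
  + by constructor 3; exists k, l.
  + by constructor 2; exists k; split=> //; rewrite eq_sym.
  + by constructor 4; exists a, k, l.
- apply: (edge_collapses_sub (enum_eps u')) => S' [->|->|[a [ua ->]]].
  + by constructor 3; exists l, k.
  + by constructor 2; exists l; split=> //; rewrite eq_sym.
  + by constructor 4; exists a, l, k.
- have [[ai aj ak al] _] := uniq5 ua.
  have ua' : uniq [:: a; i; j; l; k] by uq.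
  apply: (edge_collapses_sub (enum_delta ua)) => S' [->|->|->].
  + by constructor 2; exists a.
  + by constructor 4; exists a, k, l.
  + by constructor 4; exists a, l, k.
Qed.

Lemma pot2_tau i j k l L d t : uniq [:: i; j; k; l] ->
  Cadj (tau i j k l L) d -> rk d = 0%N -> pot0 d t ->
  t * e d (tau i j k l L) =
  pot L * (e (tau i j k l L) (Av i L) * e (Av i L) (alpha L))^-1.
Proof.
move=> u h d0 p; have hS : listed_tree (tauT i j k l) by exact: Tau.
have h' := h; rewrite (VxE hS) in h'.
have [|S [hS' [QS dE]]] := down2 (enum_tau u) (fun S => @low_tauP i j k l S u) h'.
  by rewrite d0.
have [[ij ik il jk] [jl kl]] := uniq4 u.
have rd : adjeq d (tau i j k l L) by right; exact: CadjC.
rewrite -VxE in dE; case: QS => [Sa|[a [ai aj Sa]]|[x [y [u' Sa sE]]]|[a [x [y [u' Sa sE]]]]];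
  rewrite {S hS'}Sa in dE hS'.
- by apply: pot2_A => //; exact: R_tau_A.
- have u3 : uniq [:: a; i; j] by uq.
  rewrite dE in p rd *.
  by apply: (pot2_path (adjeq_sym rd) (pot0_uniq p (PotB L u3))); exact: tau_B.
- have [[_ ix iy jx] [jy xy]] := uniq4 u'.
  have u3 : uniq [:: i; x; y] by uq.
  rewrite dE in p rd *; rewrite -sE in rd *.
  by apply: (pot2_path (adjeq_sym rd) (pot0_uniq p (PotB L u3))); exact: tau_B'.
- rewrite dE in p rd *; rewrite -sE in rd *.
  by apply: (pot2_path (adjeq_sym rd) (pot0_uniq p (PotC L u'))); exact: tau_C.
Qed.

(** By [down2] the neighbours [d] of rank 0 have the labelling of [c], and for each shape the
    earlier identities turn all their routes to the star into one that depends on [c] only. *)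
Lemma pot2 c : rk c = 2%N -> exists t, forall d t0, Cadj c d -> rk d = 0%N -> pot0 d t0 ->
  t0 * e d c = t.
Proof.
have [S [hS [L ->]]] := V_ex c; rewrite rkV.
case: hS => // [i j u|i j k l m u|i j k l u] _; rewrite -VxE; eexists => d t0.
- exact: pot2_rho (uniq2 u).
- exact: pot2_sigma.
- exact: pot2_tau.
Qed.


Lemma rk_le2 (c : Cvertex Gs) : (rk c <= 2)%N.
Proof. by have [S [hS [L ->]]] := V_ex c; rewrite rkV; case: hS. Qed.

Lemma collapses_tcol S : listed_tree S -> (0 < ntriv S)%N ->
  edge_collapses S (fun S' => exists v, @tcol n S S' v).
Proof.
have sub Q : edge_collapses S Q -> edge_collapses S (fun S' => exists v, @tcol n S S' v).
  by move=> /edge_collapsesI h; apply: (edge_collapses_sub h) => S' [].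
move=> hS; case: hS sub => // [|i j u|i j k l m u|i j k l u|i j u|i j k u|i j k l m u|i j k l u]
  sub _;
  apply: sub.
- exact: enum_alpha.
- exact: enum_rho (uniq2 u).
- exact: enum_sigma u.
- exact: enum_tau u.
- exact: enum_beta (uniq2 u).
- exact: enum_gamma u.
- exact: enum_delta u.
- exact: enum_eps u.
Qed.

(** The two adjacencies may use different representatives of [y]; [down1] realises both on collapses
    of a single explicit tree. *)
Lemma Cadj_trans (x y z : Cvertex Gs) : rk x = 2%N -> rk y = 1%N -> rk z = 0%N ->
  Cadj x y -> Cadj y z -> Cadj x z.
Proof.
move=> x2 y1 z0; have [S [hS [L xE]]] := V_ex x; rewrite {x}xE in x2 *.
rewrite rkV in x2; move=> xy.
have tS : (0 < ntriv S)%N by rewrite x2.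
have [|S1 [hS1 [[v tv] yE]]] := down1 (collapses_tcol hS tS) xy; first by rewrite y1 x2.
rewrite {y xy}yE in y1 *; rewrite rkV in y1 => yz.
have tS1 : (0 < ntriv S1)%N by rewrite y1.
have [|S2 [hS2 [[w tw] ->]]] := down1 (collapses_tcol hS1 tS1) yz; first by rewrite z0 y1.
exact: (V_adj2 hS hS1 hS2 L tv tw).
Qed.

Lemma up1 (c : Cvertex Gs) : rk c = 1%N -> exists2 m, rk m = 2%N & Cadj m c.
Proof.
have up S S' (hS : listed_tree S) (hS' : listed_tree S') L v : ntriv S = 2%N ->
    @tcol n S S' v -> exists2 m, rk m = 2%N & Cadj m (V hS' L).
  by move=> S2 tv; exists (V hS L); rewrite ?rkV //; exact: V_adj1 tv.
have [S [hS [L ->]]] := V_ex c; rewrite rkV.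
case: hS => // [|i j u|i j k u|i j k l m u|i j k l u] _.
- pose i0 := Ordinal (ltn_trans (isT : 0 < 3) (ltn_trans (isT : 3 < 4) n5)).
  pose i1 := Ordinal (ltn_trans (isT : 1 < 3) (ltn_trans (isT : 3 < 4) n5)).
  have u : uniq [:: i0; i1] by [].
  exact: (up _ _ (Rho u) _ _ _ erefl (col_rho_alpha i0 i1)).
- exact: (up _ _ (Rho u) _ _ _ erefl (col_rho_beta (uniq2 u))).
- have [ij ik jk] := uniq3 u; have u2 : uniq [:: j; k] by uq.
  exact: (up _ _ (Rho u2) _ _ _ erefl (col_rho_gamma ij ik)).
- exact: (up _ _ (Sigma u) _ _ _ erefl (col_sigma_j u)).
- exact: (up _ _ (Tau u) _ _ _ erefl (col_tau_k u)).
Qed.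

Lemma low1 S : listed_tree S -> ntriv S = 1%N ->
  exists S' w, [/\ listed_tree S', ntriv S' = 0%N & @tcol n S S' w].
Proof.
have lt0 : (0 < n)%N by apply: leq_trans n5.
case=> // [|i j u|i j k u|i j k l m u|i j k l u] _.
- exists (aT (Ordinal lt0)), (inl (Ordinal lt0)).
  by split=> //; [exact: ShapeA|exact: col_alpha].
- by exists (aT i), (inl i); split=> //; [exact: ShapeA|exact: col_beta_a (uniq2 u)].
- by exists (aT i), (inr ord0); split=> //; [exact: ShapeA|exact: col_gamma_a u].
- by exists (cT i j k l m), (inl l); split=> //; [exact: ShapeC|exact: col_delta_l u].
- have [[ij ik il jk] [jl kl]] := uniq4 u.
  by exists (bT i k l), (inl i); split=> //; [apply: ShapeB; uq|exact: col_eps_i u].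
Qed.

Lemma low_ex (c : Cvertex Gs) : (0 < rk c)%N -> exists2 d, rk d = 0%N & Cadj c d.
Proof.
have [S [hS [L ->]]] := V_ex c; rewrite rkV => S0; have : (ntriv S <= 2)%N by case: hS {S0}.
rewrite leq_eqVlt ltnS => /orP[/eqP S2|S1]; last first.
  have [S' [w [hS' S'0 tw]]] := low1 hS (eqP (etrans (eqn_leq _ _) (introT andP (conj S1 S0)))).
  by exists (V hS' L); rewrite ?rkV //; exact: V_adj1 tw.
have [v [vb tv]] : exists v : vert S, v <> base S /\ triv v || triv (parent v).
  case: hS {S0} S2 => // [i j u|i j k l m u|i j k l u] _.
  - by exists (inr ord_max).
  - by exists (inr ord_max).
  - by exists (inr ord_max).
have S0' : (0 < ntriv S)%N by rewrite S2.
have [S1 [hS1 _ tS1]] := collapses_tcol hS S0' vb tv.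
have [|S' [w [hS' S'0 tw]]] := low1 hS1.
  by have := tcol_ntriv (listed_is_tree hS) tS1; rewrite S2 => -[].
by exists (V hS' L); rewrite ?rkV //; exact: (V_adj2 hS hS1 hS' L tS1 tw).
Qed.

(** [phi] is prescribed in rank 0 and transported upwards along an arbitrary edge. In rank 2 the
    choice is immaterial by [pot2]. A vertex of rank 1 is adjacent to some [m] of rank 2 by [up1],
    and its independence of the choice is inherited from [m]. *)
Theorem potential_ex : exists phi : Cvertex Gs -> Pi,
  forall x y, Cadj x y -> phi x * e x y = phi y.
Proof.
have ex0 (d : Cvertex Gs) : exists t, rk d = 0%N -> pot0 d t.
  by have [/pot0_ex[t p]|d0] := pselect (rk d = 0%N); [exists t|exists 1].
have exlow (c : Cvertex Gs) : exists d, (0 < rk c)%N -> rk d = 0%N /\ Cadj c d.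
  have [/low_ex[d d0 cd]|c0] := pselect (0 < rk c)%N; first by exists d.
  by exists c.
have [phi0 phi0P] := choice ex0; have [low lowP] := choice exlow.
pose phi c := if rk c == 0%N then phi0 c else phi0 (low c) * e (low c) c.
have Rc c d : Cadj c d -> adjeq d c by move=> h; right; exact: CadjC.
have key c d : (0 < rk c)%N -> rk d = 0%N -> Cadj c d -> phi0 d * e d c = phi c.
  move=> c0 d0 cd; rewrite /phi -(negbK (rk c == 0%N)) -lt0n c0 /=.
  have [l0 cl] := lowP c c0.
  have [c2|c2] := eqVneq (rk c) 2%N.
    have [t Ht] := pot2 c2.
    by rewrite (Ht d) ?(Ht (low c)) //; exact: phi0P.
  have c1 : rk c = 1%N by have := rk_le2 c; move: c0 c2; case: (rk c) => [|[|[|]]].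
  have [m m2 mc] := up1 c1.
  have md := Cadj_trans m2 c1 d0 mc cd; have ml := Cadj_trans m2 c1 l0 mc cl.
  have mc' : adjeq m c by right.
  rewrite -(eT (Rc _ _ md) mc' (Rc _ _ cd)) -(eT (Rc _ _ ml) mc' (Rc _ _ cl)) !mulgA.
  have [t Ht] := pot2 m2.
  by rewrite (Ht d) ?(Ht (low c)) //; exact: phi0P.
have up x y : (rk x < rk y)%N -> Cadj x y -> phi x * e x y = phi y.
  move=> lt xy; have [x0|x0] := eqVneq (rk x) 0%N.
    rewrite {1}/phi x0 eqxx; apply: key => //; last exact: CadjC.
    by rewrite -x0.
  have x1 : rk x = 1%N by have := rk_le2 y; lia.
  have y2 : rk y = 2%N by have := rk_le2 y; lia.
  have xp : (0 < rk x)%N by rewrite x1.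
  have [d0 xd] := lowP x xp.
  have yd := Cadj_trans y2 x1 d0 (CadjC xy) xd.
  have yp : (0 < rk y)%N by rewrite y2.
  rewrite -(key x (low x)) // -(key y (low x)) // -mulgA eT //; try exact: Rc.
  by right.
exists phi => x y xy; have := Cadj_rk xy; rewrite neq_ltn => /orP[lt|lt]; first exact: up.
rewrite -(up y x lt (CadjC xy)) -mulgA eT ?e1 ?mulg1 //; [by right; exact: CadjC|by right|].
exact: adjeq_refl.
Qed.

Lemma adjeq_connected (x y : Cvertex Gs) : clos_refl_trans _ adjeq x y.
Proof.
have to_alpha c : exists L, clos_refl_trans _ adjeq c (alpha L).
  have low0 d : rk d = 0%N -> exists L, clos_refl_trans _ adjeq d (alpha L).
    have [S [hS [L ->]]] := V_ex d; rewrite rkV -VxE => /(tree_rank0 hS) hd; exists L.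
    case: hd => [[i ->]|[i [j [k [u ->]]]]|[i [j [k [l [m [u ->]]]]]]].
    - by apply: rt_step; exact/adjeq_sym/R_alpha_A.
    - apply: (rt_trans _ _ _ (rho j k L)); apply: rt_step; first exact/adjeq_sym/R_rho_B.
      by have [_ _ jk] := uniq3 u; exact: R_rho_alpha.
    - apply: (rt_trans _ _ _ (Av i L)); last by apply: rt_step; exact/adjeq_sym/R_alpha_A.
      apply: (rt_trans _ _ _ (sigma i j k l m L)); apply: rt_step.
        exact/adjeq_sym/R_sigma_C.
      exact: R_sigma_A.
  have [c0|c0] := eqVneq (rk c) 0%N; first exact: low0.
  have [|d d0 cd] := low_ex (c := c); first by rewrite lt0n.
  have [L h] := low0 d d0; exists L; apply: rt_trans h; by apply: rt_step; right.
have sym c d : clos_refl_trans _ adjeq c d -> clos_refl_trans _ adjeq d c.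
  elim=> {c d} [c d /adjeq_sym h|c|c d f _ h _ h']; [exact: rt_step|exact: rt_refl|].
  exact: rt_trans h' h.
have to_base L : clos_refl_trans _ adjeq (alpha L) (alpha L0).
  have := lab_connected hG hnt L E0.
  elim=> {L} [L M [i /adjA_Av A]|L|L M N _ h _ h'].
  - apply: (rt_trans _ _ _ (Av i L)); apply: rt_step; first exact: R_alpha_A.
    by rewrite A; exact/adjeq_sym/R_alpha_A.
  - exact: rt_refl.
  - exact: rt_trans h h'.
have [L h] := to_alpha x; have [M h'] := to_alpha y.
apply: rt_trans h _; apply: rt_trans (to_base L) _; apply: sym.
exact: rt_trans h' (to_base M).
Qed.

End Potential.

End Cocycle.

(** * Homotopies *)

Section Homotopy.
Import Order.TTheory GRing.Theory Num.Theory numFieldNormedType.Exports.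
Local Open Scope classical_set_scope.
Local Open Scope ring_scope.
Variable R : realType.

(** Pasting lemma for the closed sets on which [c] is at most, respectively at least, [k]. *)
Lemma paste (T X : topologicalType) (c : T -> R) (k : R) (f g : T -> X) :
  continuous c -> continuous f -> continuous g ->
  (forall t, c t = k -> f t = g t) ->
  continuous (fun t => if c t <= k then f t else g t).
Proof.
move=> cc cf cg fg t.
have near_lt : forall U : set X, nbhs (f t) U -> c t < k ->
    \forall t' \near t, U (if c t' <= k then f t' else g t').
  move=> U Ut ct; near=> t'; rewrite ifT; first by near: t'; exact: (cf t U Ut).
  by apply: ltW; near: t'; exact: (cc t _ (lt_nbhsl ct)).
have near_gt : forall U : set X, nbhs (g t) U -> k < c t ->
    \forall t' \near t, U (if c t' <= k then f t' else g t').
  move=> U Ut ct; near=> t'; rewrite ifF; first by near: t'; exact: (cg t U Ut).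
  by apply/negbTE; rewrite -ltNge; near: t'; exact: (cc t _ (lt_nbhsr ct)).
move=> U /=; case: (ltgtP (c t) k) => ct Ut; [exact: near_lt|exact: near_gt|].
have Ug : nbhs (g t) U by rewrite -fg.
have near2 : \forall t' \near t, U (f t') /\ U (g t').
  by near=> t'; split; near: t'; [exact: (cf t U Ut)|exact: (cg t U Ug)].
by apply: filterS near2 => t' /= [? ?]; case: ifP.
Unshelve. all: by end_near.
Qed.

Lemma cont_comp (T U V : topologicalType) (g : T -> U) (f : U -> V) :
  continuous f -> continuous g -> continuous (fun t => f (g t)).
Proof. by move=> cf cg t; apply: continuous_comp; [exact: cg|exact: cf]. Qed.

Lemma cont_pair (T U V : topologicalType) (f : T -> U) (g : T -> V) :
  continuous f -> continuous g -> continuous (fun t => (f t, g t)).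
Proof. by move=> cf cg t; apply: cvg_pair; [exact: cf|exact: cg]. Qed.

Lemma cont_cst (T U : topologicalType) (x : U) : continuous (fun _ : T => x).
Proof. by move=> t; exact: cvg_cst. Qed.

Lemma cont_id (T : topologicalType) : continuous (@id T).
Proof. by move=> t; exact: cvg_id. Qed.

Lemma cont_fst (T U : topologicalType) : continuous (@fst T U).
Proof. by move=> t; exact: cvg_fst. Qed.

Lemma cont_snd (T U : topologicalType) : continuous (@snd T U).
Proof. by move=> t; exact: cvg_snd. Qed.

Lemma contD (T : topologicalType) (V : normedModType R) (f g : T -> V) :
  continuous f -> continuous g -> continuous (fun t => f t + g t).
Proof. by move=> cf cg t; apply: cvgD; [exact: cf|exact: cg]. Qed.

Lemma contZ (T : topologicalType) (V : normedModType R) (f : T -> R) (g : T -> V) :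
  continuous f -> continuous g -> continuous (fun t => f t *: g t).
Proof. by move=> cf cg t; apply: cvgZ; [exact: cf|exact: cg]. Qed.

Lemma contM (T : topologicalType) (f g : T -> R) :
  continuous f -> continuous g -> continuous (fun t => f t * g t).
Proof. by move=> cf cg t; apply: cvgM; [exact: cf|exact: cg]. Qed.

Lemma cont_affine (T : topologicalType) (a b : R) (f : T -> R) :
  continuous f -> continuous (fun t => a * f t + b).
Proof. by move=> cf; apply: contD; [apply: contM; [exact: cont_cst|]|exact: cont_cst]. Qed.

Lemma contB1 (T : topologicalType) (f : T -> R) :
  continuous f -> continuous (fun t => 1 - f t).
Proof. by move=> cf t; apply: cvgB; [exact: cvg_cst|exact: cf]. Qed.

(** Retraction of the line onto the unit interval. Composition with it makes paths continuous on the
    whole line, so that subspace topologies are avoided. *)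
Definition clamp (t : R) : R := if t <= 0 then 0 else if t <= 1 then t else 1.

Lemma clamp_continuous : continuous clamp.
Proof.
have [ci cc] := (@cont_id R, fun x : R => @cont_cst R R x).
apply: (@paste _ _ id 0 _ _ ci (cc 0)); last by move=> t ->; rewrite ler01.
exact: (@paste _ _ id 1 _ _ ci ci (cc 1)).
Qed.

Lemma clamp_itv t : 0 <= clamp t <= 1.
Proof. by rewrite /clamp; case: ifP => [|/negbT]; [|case: ifP]; rewrite -?ltNge; lra. Qed.

Lemma clampE t : 0 <= t <= 1 -> clamp t = t.
Proof. by case/andP=> t0 t1; rewrite /clamp t1; case: ifP => // h; lra. Qed.

Lemma clamp0 : clamp 0 = 0. Proof. by apply: clampE; lra. Qed.
Lemma clamp1 : clamp 1 = 1. Proof. by apply: clampE; lra. Qed.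

Section Paths.
Variable X : topologicalType.
Implicit Types p q r : R -> X.

Definition homot p q := exists h : R * R -> X,
  [/\ continuous h, forall t, h (t, 0) = p t, forall t, h (t, 1) = q t &
      forall s, h (0, s) = p 0 /\ h (1, s) = p 1].

Definition pcat p q t := if 2 * t <= 1 then p (2 * t) else q (2 * t - 1).
Definition pflip p t := p (1 - t).

Lemma pcat_continuous p q : continuous p -> continuous q -> p 1 = q 0 ->
  continuous (pcat p q).
Proof.
move=> cp cq pq; have c2 := @contM R _ _ (@cont_cst R R 2) (@cont_id R).
apply: (@paste _ _ (fun t : R => 2 * t) 1 (fun t => p (2 * t)) (fun t => q (2 * t - 1))) => //.
- exact: cont_comp.
- by apply: cont_comp cq _; exact: (@cont_affine _ 2 (-1) _ (@cont_id R)).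
- by move=> t ->; rewrite subrr.
Qed.

Lemma pcat0 p q : pcat p q 0 = p 0. Proof. by rewrite /pcat mulr0 ler01. Qed.
Lemma pcat1 p q : pcat p q 1 = q 1.
Proof. by rewrite /pcat ifF; [congr q; lra|apply/negbTE; rewrite -ltNge; lra]. Qed.

Lemma pflip_continuous p : continuous p -> continuous (pflip p).
Proof.
move=> cp; apply: cont_comp cp _; exact: contB1 (@cont_id R).
Qed.

Lemma pflip0 p : pflip p 0 = p 1. Proof. by rewrite /pflip subr0. Qed.
Lemma pflip1 p : pflip p 1 = p 0. Proof. by rewrite /pflip subrr. Qed.

Lemma homot_end p q : homot p q -> p 0 = q 0 /\ p 1 = q 1.
Proof. by case=> h [_ _ h1 he]; rewrite -(h1 0) -(h1 1) (he 1).1 (he 1).2. Qed.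

Lemma homot_sym p q : homot p q -> homot q p.
Proof.
move=> pq; have [e0 e1] := homot_end pq; have [h [ch h0 h1 he]] := pq.
exists (fun z => h (z.1, 1 - z.2)); split=> /= [z|t|t|s]; rewrite ?subr0 ?subrr ?h0 ?h1 //.
  move: z; apply: cont_comp ch _; apply: cont_pair; first exact: cont_fst.
  exact: contB1 (@cont_snd _ _).
by rewrite -e0 -e1.
Qed.

Lemma homot_trans q p r : homot p q -> homot q r -> homot p r.
Proof.
move=> pq; have [e0 e1] := homot_end pq; case: pq => h [ch h0 h1 he] [k [ck k0 k1 ke]].
exists (fun z => if 2 * z.2 <= 1 then h (z.1, 2 * z.2) else k (z.1, 2 * z.2 - 1)).
have c2 : continuous (fun z : R * R => 2 * z.2).
  by apply: contM; [exact: cont_cst|exact: cont_snd].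
split=> [|t|t|s] /=.
- apply: (@paste _ _ (fun z : R * R => 2 * z.2)) => //.
  + by apply: cont_comp ch _; apply: cont_pair; first exact: cont_fst.
  + apply: cont_comp ck _; apply: cont_pair; first exact: cont_fst.
    exact: (@cont_affine _ 2 (-1) _ (@cont_snd _ _)).
  + by move=> z ->; rewrite subrr h1 k0.
- by rewrite mulr0 ler01.
- by rewrite ifF; [rewrite -k1; congr (k (_, _)); lra|apply/negbTE; rewrite -ltNge; lra].
- by case: ifP => _; rewrite ?e0 ?e1; [rewrite -e0 -e1|].
Qed.

Lemma homot_cat p p' q q' : p 1 = q 0 -> homot p p' -> homot q q' ->
  homot (pcat p q) (pcat p' q').
Proof.
move=> pq [h [ch h0 h1 he]] [k [ck k0 k1 ke]].
exists (fun z => if 2 * z.1 <= 1 then h (2 * z.1, z.2) else k (2 * z.1 - 1, z.2)).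
have c2 : continuous (fun z : R * R => 2 * z.1).
  by apply: contM; [exact: cont_cst|exact: cont_fst].
split=> [|t|t|s] /=.
- apply: (@paste _ _ (fun z : R * R => 2 * z.1)) => //.
  + by apply: cont_comp ch _; apply: cont_pair; last exact: cont_snd.
  + apply: cont_comp ck _; apply: cont_pair; last exact: cont_snd.
    exact: (@cont_affine _ 2 (-1) _ (@cont_fst _ _)).
  + by move=> z ->; rewrite subrr (he _).2 (ke _).1.
- by rewrite h0 k0.
- by rewrite h1 k1.
- rewrite pcat0 pcat1 mulr0 ler01 (he s).1; split=> //.
  by rewrite ifF; [rewrite -(ke s).2; congr (k (_, _)); lra|apply/negbTE; rewrite -ltNge; lra].
Qed.

(** [f] transports the straight-line homotopy between [a] and [b]. With [V] the line this yields
    reparametrisations, and with [V] the plane the deformation in [star_homot]. *)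
Lemma homot_convex (V : normedModType R) (f : V -> X) (a b : R -> V) :
  continuous f -> continuous a -> continuous b -> a 0 = b 0 -> a 1 = b 1 ->
  homot (f \o a) (f \o b).
Proof.
move=> cf ca cb e0 e1; exists (fun z => f ((1 - z.2) *: a z.1 + z.2 *: b z.1)).
split=> /= [z|t|t|s].
- move: z; apply: cont_comp cf _; apply: contD; apply: contZ.
  + exact: contB1 (@cont_snd _ _).
  + exact: cont_comp ca (@cont_fst _ _).
  + exact: cont_snd.
  + exact: cont_comp cb (@cont_fst _ _).
- by rewrite subr0 scale1r scale0r addr0.
- by rewrite subrr scale1r scale0r add0r.
- by rewrite -e0 -e1 -!scalerDl subrK !scale1r.
Qed.

Lemma homot_refl p : continuous p -> homot p p.
Proof. by move=> cp; apply: (@homot_convex R^o p id id cp) => // ? ?. Qed.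

Lemma homot_reparam p (a b : R -> R) : continuous p -> continuous a ->
  continuous b -> a 0 = b 0 -> a 1 = b 1 -> homot (p \o a) (p \o b).
Proof. exact: (@homot_convex R^o p a b). Qed.

Lemma cont_pl (a b c d : R) : a + 2 * b = c + 2 * d ->
  continuous (fun t : R => if 2 * t <= 1 then a * t + b else c * t + d).
Proof.
move=> e; apply: (@paste _ _ (fun t : R => 2 * t) 1 (fun t => a * t + b) (fun t => c * t + d)).
- by apply: contM; [exact: cont_cst|exact: cont_id].
- exact: (@cont_affine _ a b _ (@cont_id R)).
- exact: (@cont_affine _ c d _ (@cont_id R)).
- move=> t t1; have -> : t = 2^-1 by lra.
  by lra.
Qed.

Ltac leps := repeat match goal with |- context [(?a <= ?b)%R] => case: (leP a b) => ? end.

(* Both sides are reparametrisations of a function on the whole line. *)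
Lemma pcatA p q r : continuous p -> continuous q -> continuous r ->
  p 1 = q 0 -> q 1 = r 0 -> homot (pcat (pcat p q) r) (pcat p (pcat q r)).
Proof.
move=> cp cq cr pq qr.
pose w t := if t <= 1 then p t else if t <= 2 then q (t - 1) else r (t - 2).
have shift (f : R -> X) (b : R) : continuous f -> continuous (fun t : R => f (t + b)).
  move=> cf; apply: cont_comp cf _; apply: contD; [exact: cont_id|exact: cont_cst].
have cw : continuous w.
  have ci := @cont_id R.
  apply: (@paste _ _ id 1 p (fun t => if t <= 2 then q (t - 1) else r (t - 2))) => //.
    apply: (@paste _ _ id 2 (fun t => q (t - 1)) (fun t => r (t - 2))); [done|exact: shift..|].
    by move=> t ->; rewrite subrr -qr; congr q; lra.
  by move=> t ->; rewrite subrr ifT //; lra.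
have -> : pcat (pcat p q) r = w \o (fun t => if 2 * t <= 1 then 4 * t + 0 else 2 * t + 1).
  apply/funext => t /=; rewrite /w /pcat; clear pq qr; leps; first [exfalso; lra|congr (_ _);
    lra].
have -> : pcat p (pcat q r) = w \o (fun t => if 2 * t <= 1 then 2 * t + 0 else 4 * t + (-1)).
  apply/funext => t /=; rewrite /w /pcat; clear pq qr; leps; first [exfalso; lra|congr (_ _);
    lra].
apply: homot_reparam => //; try (apply: cont_pl; lra); leps; lra.
Qed.

Lemma pcat_cstl p : continuous p -> homot (pcat (fun=> p 0) p) p.
Proof.
move=> cp.
have -> : pcat (fun=> p 0) p = p \o (fun t => if 2 * t <= 1 then 0 * t + 0 else 2 * t + (-1)).
  apply/funext => t /=; rewrite /pcat; case: leP => ?; congr (_ _); lra.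
by apply: (@homot_reparam p _ id) => //; try (apply: cont_pl; lra);
  try exact: cont_id; case: leP => ?; lra.
Qed.

Lemma pcat_cstr p : continuous p -> homot (pcat p (fun=> p 1)) p.
Proof.
move=> cp.
have -> : pcat p (fun=> p 1) = p \o (fun t => if 2 * t <= 1 then 2 * t + 0 else 0 * t + 1).
  apply/funext => t /=; rewrite /pcat; case: leP => ?; congr (_ _); lra.
by apply: (@homot_reparam p _ id) => //; try (apply: cont_pl; lra);
  try exact: cont_id; case: leP => ?; lra.
Qed.

Lemma pcat_revr p : continuous p -> homot (pcat p (pflip p)) (fun=> p 0).
Proof.
move=> cp.
have -> : pcat p (pflip p) = p \o (fun t => if 2 * t <= 1 then 2 * t + 0 else (-2) * t + 2).
  apply/funext => t /=; rewrite /pcat /pflip; case: leP => ?; congr (_ _); lra.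
by apply: (@homot_reparam p _ (fun=> 0)) => //; try (apply: cont_pl; lra);
  try exact: cont_cst; case: leP => ?; lra.
Qed.

Lemma pflipK p : pflip (pflip p) = p.
Proof. by apply/funext => t; rewrite /pflip subKr. Qed.

Lemma pcat_revl p : continuous p -> homot (pcat (pflip p) p) (fun=> p 1).
Proof.
move=> cp; have := pcat_revr (pflip_continuous cp).
by rewrite pflipK pflip0.
Qed.

Lemma homot_cancelr p q r : continuous p -> continuous q -> continuous r ->
  p 1 = r 0 -> q 1 = r 0 -> homot (pcat p r) (pcat q r) -> homot p q.
Proof.
move=> cp cq cr pr qr h; have cr' := pflip_continuous cr.
have step (f : R -> X) : continuous f -> f 1 = r 0 -> homot (pcat (pcat f r) (pflip r)) f.
  move=> cf fr; apply: homot_trans (pcatA cf cr cr' fr _) _; first by rewrite pflip0.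
  apply: homot_trans (pcat_cstr cf); rewrite fr.
  by apply: homot_cat (homot_refl cf) (pcat_revr cr); rewrite pcat0.
apply: homot_trans (homot_sym (step _ cp pr)) _.
apply: homot_trans (step _ cq qr).
by apply: homot_cat h (homot_refl cr'); rewrite pcat1 pflip0.
Qed.

Lemma homot_cancell p q r : continuous p -> continuous q -> continuous r ->
  r 1 = p 0 -> r 1 = q 0 -> homot (pcat r p) (pcat r q) -> homot p q.
Proof.
move=> cp cq cr rp rq h; have cr' := pflip_continuous cr.
have step (f : R -> X) : continuous f -> r 1 = f 0 -> homot (pcat (pflip r) (pcat r f)) f.
  move=> cf rf; apply: homot_trans (homot_sym (pcatA cr' cr cf _ rf)) _; first by rewrite pflip1.
  apply: homot_trans (pcat_cstl cf); rewrite -rf.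
  by apply: homot_cat (pcat_revl cr) (homot_refl cf); rewrite pcat1.
apply: homot_trans (homot_sym (step _ cp rp)) _.
apply: homot_trans (step _ cq rq).
by apply: homot_cat (homot_refl cr') h; rewrite pcat0 pflip1.
Qed.

(** * The fundamental group *)

Section Pi1.
Variable x0 : X.

Definition is_loop p := [/\ continuous p, p 0 = x0 & p 1 = x0].

(** A class is stored as the set of all paths homotopic to some loop, so that equality of classes is
    equality of sets. *)
Record pi1 := Pi1 {
  pi1_set : set (R -> X);
  pi1P : exists p, is_loop p /\ pi1_set = homot p }.

HB.instance Definition _ := gen_eqMixin pi1.
HB.instance Definition _ := gen_choiceMixin pi1.

Definition pi1_repr (c : pi1) : R -> X := projT1 (cid (pi1P c)).

Lemma pi1_reprP c : is_loop (pi1_repr c).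
Proof. by rewrite /pi1_repr; case: cid => p []. Qed.

Lemma is_loop_cst : is_loop (fun=> x0).
Proof. by split=> //; exact: cont_cst. Qed.

(* The junk value at a path that is not a loop is the unit. *)
Definition pi1_class p : pi1 :=
  match pselect (is_loop p) with
  | left h => Pi1 (ex_intro _ p (conj h erefl))
  | right _ => Pi1 (ex_intro _ _ (conj is_loop_cst erefl))
  end.

Lemma pi1_classE p q : is_loop p -> is_loop q ->
  pi1_class p = pi1_class q <-> homot p q.
Proof.
move=> hp hq; rewrite /pi1_class; case: pselect => // {}hp; case: pselect => // {}hq.
have [cp cq] : continuous p /\ continuous q by case: hp; case: hq.
split=> [[e]|pq]; first by rewrite e; exact: homot_refl.
have e : homot p = homot q :> set _.
  apply/funext => r; apply/propext; split; apply: homot_trans => //; exact: homot_sym.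
by move: (ex_intro _ p _) (ex_intro _ q _); rewrite e => h h'; congr Pi1; exact: Prop_irrelevance.
Qed.

Lemma pi1_reprK c : pi1_class (pi1_repr c) = c.
Proof.
have hp := pi1_reprP c; rewrite /pi1_class; case: pselect => // {}hp.
have e : homot (pi1_repr c) = pi1_set c :> set _ by rewrite /pi1_repr; case: cid => q [].
case: c hp e => A hA hp /= e; move: (ex_intro _ _ _); rewrite e => h.
by congr Pi1; exact: Prop_irrelevance.
Qed.

Lemma pi1_class_repr p : is_loop p -> homot (pi1_repr (pi1_class p)) p.
Proof.
by move=> hp; apply/(pi1_classE (pi1_reprP _) hp); exact: pi1_reprK.
Qed.

Lemma is_loop_cat p q : is_loop p -> is_loop q -> is_loop (pcat p q).
Proof.
move=> [cp p0 p1] [cq q0 q1]; split; rewrite ?pcat0 ?pcat1 //.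
by apply: pcat_continuous => //; rewrite p1 q0.
Qed.

Lemma is_loop_rev p : is_loop p -> is_loop (pflip p).
Proof. by case=> cp p0 p1; split; rewrite ?pflip0 ?pflip1 //; exact: pflip_continuous. Qed.

Definition pi1_mul (c d : pi1) := pi1_class (pcat (pi1_repr c) (pi1_repr d)).
Definition pi1_one := pi1_class (fun=> x0).
Definition pi1_inv (c : pi1) := pi1_class (pflip (pi1_repr c)).

Lemma pi1_class_cat p q : is_loop p -> is_loop q ->
  pi1_class (pcat p q) = pi1_mul (pi1_class p) (pi1_class q).
Proof.
move=> hp hq; apply/pi1_classE; rewrite -?/(pi1_mul _ _); try (apply: is_loop_cat => //;
  exact: pi1_reprP).
apply: homot_cat; try (apply: homot_sym; exact: pi1_class_repr).
by case: hp => _ _ ->; case: hq.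
Qed.

Lemma pi1_class_ex c : exists2 p, is_loop p & c = pi1_class p.
Proof. by exists (pi1_repr c); [exact: pi1_reprP|rewrite pi1_reprK]. Qed.

Lemma pi1_mulA : associative pi1_mul.
Proof.
move=> c d e; have [[[p hp ->] [q hq ->]] [r hr ->]] := (pi1_class_ex c, pi1_class_ex d,
  pi1_class_ex e).
have [hpq hqr] := (is_loop_cat hp hq, is_loop_cat hq hr).
rewrite -!pi1_class_cat //; apply/pi1_classE; try exact: is_loop_cat.
case: hp hq hr => [cp _ p1] [cq q0 q1] [cr r0 _].
by apply: homot_sym; apply: pcatA; rewrite // ?p1 ?q1.
Qed.

Lemma pi1_mul1c : left_id pi1_one pi1_mul.
Proof.
move=> c; have [p hp ->] := pi1_class_ex c; have h1 := is_loop_cst.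
rewrite -pi1_class_cat //; apply/pi1_classE => //; first exact: is_loop_cat.
by case: hp => cp <- _; exact: pcat_cstl.
Qed.

Lemma pi1_mulc1 : right_id pi1_one pi1_mul.
Proof.
move=> c; have [p hp ->] := pi1_class_ex c; have h1 := is_loop_cst.
rewrite -pi1_class_cat //; apply/pi1_classE => //; first exact: is_loop_cat.
by case: hp => cp _ <-; exact: pcat_cstr.
Qed.

Lemma pi1_mulVc : left_inverse pi1_one pi1_inv pi1_mul.
Proof.
move=> c; rewrite -{2}[c]pi1_reprK /pi1_inv; have hp := pi1_reprP c.
have hp' := is_loop_rev hp; have h1 := is_loop_cst.
rewrite -pi1_class_cat //; apply/pi1_classE => //; first exact: is_loop_cat.
by move: (hp) => [cp _ p1]; have := pcat_revl cp; rewrite p1.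
Qed.

Lemma pi1_mulcV : right_inverse pi1_one pi1_inv pi1_mul.
Proof.
move=> c; rewrite -{1}[c]pi1_reprK /pi1_inv; have hp := pi1_reprP c.
have hp' := is_loop_rev hp; have h1 := is_loop_cst.
rewrite -pi1_class_cat //; apply/pi1_classE => //; first exact: is_loop_cat.
by move: (hp) => [cp p0 _]; have := pcat_revr cp; rewrite p0.
Qed.

HB.instance Definition _ := isGroup.Build pi1
  pi1_mulA pi1_mul1c pi1_mulc1 pi1_mulVc pi1_mulcV.

End Pi1.

Lemma homot_cont p q : homot p q -> continuous q.
Proof.
case=> h [ch _ h1 _]; rewrite (_ : q = fun t => h (t, 1)); last exact/funext.
by apply: cont_comp ch _; apply: cont_pair; [exact: cont_id|exact: cont_cst].
Qed.

(** [D p] is the class of the loop that follows a chosen path from [x0] to [p 0], then [p], then a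
    chosen path from [p 1] back. The statement hides the base point and the chosen paths, and keeps
    only the three properties used on the realization. *)
Lemma fundamental_functor (x0 : X) :
  (forall x, exists p, [/\ continuous p, p 0 = x0 & p 1 = x]) ->
  exists (Pi : groupType) (D : (R -> X) -> Pi),
  [/\ forall p q, continuous p -> continuous q -> p 1 = q 0 -> D (pcat p q) = (D p * D q)%g,
      forall p q, continuous p -> homot p q -> D p = D q &
      forall p, continuous p -> p 0 = p 1 -> D p = 1%g -> homot p (fun=> p 0)].
Proof.
move=> /choice[th thP].
have ct x : continuous (th x) by case: (thP x).
have t0 x : th x 0 = x0 by case: (thP x).
have t1 x : th x 1 = x by case: (thP x).
have ct' x := pflip_continuous (ct x).
have t0' x : pflip (th x) 0 = x by rewrite pflip0.
have t1' x : pflip (th x) 1 = x0 by rewrite pflip1.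
pose lp p := pcat (th (p 0)) (pcat p (pflip (th (p 1)))).
have cpt' p : continuous p -> continuous (pcat p (pflip (th (p 1)))).
  by move=> cp; apply: pcat_continuous; rewrite ?t0'.
have lpP p : continuous p -> is_loop x0 (lp p).
  by move=> cp; split; rewrite /lp ?pcat0 ?pcat1 //; apply: pcat_continuous; rewrite ?pcat0 //;
    exact: cpt'.
pose D p : pi1 x0 := pi1_class x0 (lp p).
have Dcat p q : continuous p -> continuous q -> p 1 = q 0 -> D (pcat p q) = (D p * D q)%g.
  move=> cp cq pq; rewrite /D -[RHS]pi1_class_cat; [|exact: lpP..].
  have cpq := pcat_continuous cp cq pq.
  apply/pi1_classE; [exact: lpP|by apply: is_loop_cat; exact: lpP|].
  rewrite /lp pcat0 pcat1; set a := th (p 0); set b := th (p 1); set c := th (q 1).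
  have [ca cb cc] : [/\ continuous a, continuous b & continuous c] by split; exact: ct.
  have [cb' cc'] : continuous (pflip b) /\ continuous (pflip c) by split; exact: ct'.
  have [cp' cq'] := (cpt' _ cp, cpt' _ cq); rewrite -/b -/c in cp' cq'.
  have bq : th (q 0) = b by rewrite /b pq.
  have [a0 a1] : a 0 = x0 /\ a 1 = p 0 by split; [exact: t0|exact: t1].
  have [b0 b1] : b 0 = x0 /\ b 1 = q 0 by rewrite -pq; split; [exact: t0|exact: t1].
  have [b0' b1'] : pflip b 0 = q 0 /\ pflip b 1 = x0 by rewrite pflip0 pflip1 b0 b1.
  have c0' : pflip c 0 = q 1 by exact: t0'.
  have cbq : continuous (pcat b (pcat q (pflip c))) by apply: pcat_continuous; rewrite ?pcat0.
  rewrite bq; apply: homot_sym.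
  apply: homot_trans (pcatA ca cp' cbq _ _) _; rewrite ?pcat0 ?pcat1 //; first by rewrite b0.
  apply: homot_cat (homot_refl ca) _; first by rewrite !pcat0.
  apply: homot_trans (pcatA cp cb' cbq _ _) _; rewrite ?pcat0 ?b0' ?b1' //.
  apply: homot_trans (homot_sym (pcatA cp cq cc' pq _)) => //.
  apply: homot_cat (homot_refl cp) _; first by rewrite ?pcat0 b0'.
  apply: homot_trans (homot_sym (pcatA cb' cb cq' _ _)) _; rewrite ?pcat0 ?b1' //.
  have := pcat_cstl cq'; rewrite pcat0; apply: homot_trans.
  apply: homot_cat (homot_refl cq'); first by rewrite pcat1 pcat0.
  by have := pcat_revl cb; rewrite b1.
have Dhomot p q : continuous p -> homot p q -> D p = D q.
  move=> cp pq; have cq := homot_cont pq; have [e0 e1] := homot_end pq.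
  apply/pi1_classE; [exact: lpP..|]; rewrite /lp -e0 -e1.
  apply: homot_cat (homot_refl (ct _)) _; first by rewrite t1 pcat0.
  by apply: homot_cat pq (homot_refl (ct' _)); rewrite t0'.
exists (pi1 x0), D; split=> // p cp p01 D1.
have cc : continuous (fun _ : R => p 0) by exact: cont_cst.
have Dc : D (fun=> p 0) = 1%g.
  have e : pcat (fun=> p 0) (fun=> p 0) = (fun=> p 0) by apply/funext => t; rewrite /pcat if_same.
  by apply: (mulgI (D (fun=> p 0))); rewrite -Dcat // e mulg1.
move: D1; rewrite -Dc => /(pi1_classE (lpP _ cp) (lpP _ cc)); rewrite /lp -p01.
move=> h; have cr := ct (p 0); have cr' := ct' (p 0).
apply: (homot_cancelr cp cc cr'); rewrite ?t0' //.
apply: (homot_cancell _ _ cr); rewrite ?pcat0 ?t1 //.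
- by apply: pcat_continuous; rewrite ?t0'.
- by apply: pcat_continuous; rewrite ?t0'.
Qed.

End Paths.
End Homotopy.

(** * Realizations *)

Section RealizationTopology.
Import Order.TTheory GRing.Theory Num.Theory numFieldNormedType.Exports.
Local Open Scope classical_set_scope.
Local Open Scope ring_scope.
Variables (R : realType) (V : choiceType) (K : complex V).
Notation pt := (realization R K).
Implicit Types (x y z : pt) (v w : V) (s : set V) (p q : R -> pt).

Definition supp x : set V := [set v | x v != 0].

Lemma pt_eq x y : bary x = bary y -> x = y.
Proof.
case: x y => [f f0 fs f1] [g g0 gs g1] /= e; subst g.
by rewrite (Prop_irrelevance g0 f0) (Prop_irrelevance gs fs) (Prop_irrelevance g1 f1).
Qed.

Lemma realization_openE (U : set pt) : open U = realization_open U.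
Proof. by []. Qed.

Lemma bary_continuous v : continuous (fun x => x v).
Proof.
apply/continuousP => A oA; rewrite realization_openE => s Ks.
exists [set f : {ptws V -> R} | A (f v)] => //.
by move: A oA; apply/continuousP; exact: (@proj_continuous V (fun=> R) v).
Qed.

(** Finitely many simplices are treated one by one near [t]. If [s] contains the support of [f t],
    the coherent topology provides a neighbourhood for pointwise convergence; otherwise a nonzero
    coordinate of [f t] outside [s] stays nonzero nearby, and the condition for [s] is void. *)
Lemma realization_continuous (T : topologicalType) (F : set (set V)) (f : T -> pt) :
  finite_set F -> (forall s, F s -> simplex K s) ->
  (forall t, exists2 s, F s & supp (f t) `<=` s) ->
  (forall v, continuous (fun t => f t v)) -> continuous f.
Proof.
move=> finF KF Fs cf t U /=; rewrite {1}nbhsE => -[Q [oQ Qt] QU].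
have Fnear s : F s -> \forall t' \near t, supp (f t') `<=` s -> Q (f t').
  move=> sF; have [W oW e] := oQ s (KF s sF).
  have [ts|/existsNP[v /not_implyP[vt vs]]] := pselect (supp (f t) `<=` s).
    have Wt : W (bary (f t)).
      have : (closed_simplex s `&` Q) (f t) by [].
      by rewrite e => -[].
    have WN : nbhs (bary (f t) : {ptws V -> R}) W by apply: open_nbhs_nbhs.
    have cW : {ptws, (fun t' => bary (f t')) @ t --> bary (f t)}.
      apply/cvg_sup => v A; rewrite nbhsE => -[B [[C oC <-] Cv] /filterS]; apply.
      by apply: (cf v t); apply: open_nbhs_nbhs.
    have {}cW : nbhs t [set t' | W (bary (f t'))] := cW W WN.
    apply: filterS cW => t' /= Wt' st'.
    have : (closed_simplex s `&` [set x | W (bary x)]) (f t') by [].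
    by rewrite -e => -[].
  have cv : nbhs t [set t' | f t' v != 0].
    have : nbhs (f t v) [set y | y != 0] by apply: open_nbhs_nbhs; split;
      [exact: open_neq|exact: vt].
    exact: (cf v t).
  by apply: filterS cv => t' /= vt' st'; case: vs; exact: st'.
have /finite_seqP[S SF] := finF.
have : \forall t' \near t, forall s, s \in S -> supp (f t') `<=` s -> Q (f t').
  have {}Fnear s : s \in S -> \forall t' \near t, supp (f t') `<=` s -> Q (f t').
    by move=> sS; apply: Fnear; rewrite SF.
  elim: S {SF} Fnear => [|s S IH] Fnear; first by apply: nearW.
  have := IH (fun s' h => Fnear s' (@mem_behead _ (s :: S) _ h)).
  apply: filterS2 (Fnear s (mem_head _ _)) => t' h1 h2 s'.
  by rewrite in_cons => /predU1P[->|]; [exact: h1|exact: h2].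
apply: filterS => t' Ht'; apply: QU; have [s sF st'] := Fs t'.
by apply: Ht' st'; move: sF; rewrite SF.
Qed.

Lemma finite_subsets s : finite_set s -> finite_set [set s' | s' `<=` s].
Proof.
move=> fs; apply: (@sub_finite_set _ _ ((fun X : {fset V} => [set` X] : set V) @`
    [set` fpowerset (fset_set s)])); last exact: finite_image.
move=> s' /= ss'; have fs' := sub_finite_set ss' fs.
exists (fset_set s'); last exact: fset_setK.
by rewrite /= fpowersetE -fset_set_sub.
Qed.

(* Choose one point of the path for each support. The set of these points meets
   every closed simplex in a finite set, so all its subsets are closed: it is
   discrete and lies in a compact set. *)
Lemma compact_supports (p : R -> pt) : continuous p ->
  finite_set [set supp (p t) | t in [set` `[0, 1]]].
Proof.
move=> cp; set I01 : set R := [set` `[0, 1]].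
have /choice[tm tmP] : forall s : set V, exists t, (exists2 t', I01 t' & supp (p t') = s) ->
    I01 t /\ supp (p t) = s.
  by move=> s; have [[t It e]|h] := pselect (exists2 t, I01 t & supp (p t) = s);
    [exists t|exists 0].
pose E := [set p (tm s) | s in [set supp (p t) | t in I01]].
have Esupp x : E x -> p (tm (supp x)) = x.
  by case=> s ss <-; have [_ ->] := tmP s ss.
pose U t := ~` (E `\ p t).
have oU t : open (U t).
  rewrite realization_openE => s Ks; pose F := [set bary x |
    x in (E `\ p t) `&` closed_simplex s].
  have finF : finite_set F.
    apply: (@sub_finite_set _ _ ((fun s' => bary (p (tm s'))) @` [set s' | s' `<=` s])).
      by move=> _ [x [[Ex _] xs] <-]; exists (supp x) => //; rewrite Esupp.
    by apply: finite_image; apply: finite_subsets; exact: simplex_fin Ks.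
  have hV : hausdorff_space {ptws V -> R} by apply: hausdorff_product => v; exact: Rhausdorff.
  exists (~` F).
    by apply: closed_openC; move/hausdorff_accessible/accessible_finite_set_closed: hV; exact.
  apply/seteqP; split=> x [xs Ux]; split=> //.
    by move=> [y [Ey ys] /pt_eq e]; apply: Ux; rewrite -e.
  by move=> Ex; apply: Ux; exists x.
have cov : I01 `<=` cover I01 (fun t => p @^-1` U t).
  by move=> t It; exists t => //; case=> _; apply.
have := @segment_compact R 0 1; rewrite compact_cover => /(_ _ _ _ _ cov).
case=> [t It|D DI Dcov].
  by move/continuousP: cp; exact.
apply: (@sub_finite_set _ _ [set supp (p t) | t in [set` D]]); last exact: finite_image.
move=> s Ss; have [Its es] := tmP s Ss.
have [t Dt Ut] := Dcov _ Its; exists t => //.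
apply: contrapT => ne; apply: Ut; split; first by exists s.
by move=> /= e; apply: ne; rewrite -e.
Qed.

Lemma pt_ex s (f : V -> R) : simplex K s -> (forall v, 0 <= f v) ->
  (forall v, ~ s v -> f v = 0) -> \sum_(v \in s) f v = 1 ->
  exists x : pt, forall v, x v = f v.
Proof.
move=> Ks f0 fs f1; have sub : [set v | f v != 0] `<=` s.
  by move=> v /= fv; apply: contrapT => /fs /eqP; apply/negP.
have sum1 : \sum_(v \in [set v | f v != 0]) f v = 1.
  rewrite -f1; apply: fsbig_widen => // v [_ /= /negP].
  by rewrite negbK => /eqP.
have Kf : simplex K [set v | f v != 0].
  apply: simplex_sub Ks sub _; apply/set0P/eqP => e.
  by move: sum1; rewrite e fsbig_set0 => /esym/eqP; rewrite oner_eq0.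
by exists (Point f0 Kf sum1).
Qed.

Lemma sum_bary x s : supp x `<=` s -> \sum_(v \in s) x v = 1.
Proof.
move=> xs; rewrite -(bary_sum x); apply/esym/fsbig_widen => // v [_ /= /negP].
by rewrite negbK => /eqP.
Qed.

Lemma bary_out x s v : supp x `<=` s -> ~ s v -> x v = 0.
Proof. by move=> xs sv; apply/eqP/negPn/negP => /xs. Qed.

Lemma vtx_ex v : exists x : pt, forall w, x w = (w == v)%:R.
Proof.
apply: (@pt_ex [set v]); [exact: simplex1|by move=> w; exact: ler0n| |].
  by move=> w /eqP/negPf ->.
by rewrite fsbig_set1 eqxx.
Qed.

Definition vtx v : pt := projT1 (cid (vtx_ex v)).

Lemma vtxE v w : vtx v w = (w == v)%:R.
Proof. by rewrite /vtx; case: cid. Qed.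

Lemma supp_vtx v s : s v -> supp (vtx v) `<=` s.
Proof.
move=> sv w; rewrite /supp /= vtxE; case: (eqVneq w v) => [->|] //.
by rewrite eqxx.
Qed.

(* The junk value, when x and y lie in no common closed simplex, is x. *)
Definition mix x y (t : R) : pt :=
  match pselect (exists z : pt, forall v, z v = (1 - t) * x v + t * y v) with
  | left h => projT1 (cid h)
  | right _ => x
  end.

Lemma mixE x y s t v : simplex K s -> supp x `<=` s -> supp y `<=` s ->
  0 <= t <= 1 -> mix x y t v = (1 - t) * x v + t * y v.
Proof.
move=> Ks xs ys /andP[t0 t1]; rewrite /mix; case: pselect => [h|]; first by case: cid.
case; apply: (@pt_ex s) => // [w|w sw|].
- by apply: addr_ge0; apply: mulr_ge0; rewrite ?bary_ge0 // subr_ge0.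
- by rewrite (bary_out xs sw) (bary_out ys sw) !mulr0 addr0.
- rewrite fsbig_split; last exact: simplex_fin Ks.
  by rewrite -!mulr_fsumr !sum_bary // !mulr1 /= subrK.
Qed.

Lemma mix0 x y : mix x y 0 = x.
Proof.
rewrite /mix; case: pselect => // h; case: cid => z zE /=.
by apply: pt_eq; apply/funext => v; rewrite zE subr0 mul1r mul0r addr0.
Qed.

Lemma mixxx x t : mix x x t = x.
Proof.
rewrite /mix; case: pselect => // h; case: cid => z zE /=.
by apply: pt_eq; apply/funext => v; rewrite zE -mulrDl subrK mul1r.
Qed.

Section Mix.
Variables (x y : pt) (s : set V).
Hypotheses (Ks : simplex K s) (xs : supp x `<=` s) (ys : supp y `<=` s).

Lemma mix1 : mix x y 1 = y.
Proof.
apply: pt_eq; apply/funext => v; rewrite (mixE v Ks) ?lexx ?ler01 //.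
by rewrite subrr mul0r mul1r add0r.
Qed.

Lemma supp_mix t : 0 <= t <= 1 -> supp (mix x y t) `<=` s.
Proof.
move=> t01 v; apply: contraPP => sv; rewrite /supp /= (mixE v Ks) //.
by rewrite (bary_out xs sv) (bary_out ys sv) !mulr0 addr0 eqxx.
Qed.

End Mix.

Lemma mix_homot (p q : R -> pt) (F : set (set V)) : finite_set F ->
  (forall s, F s -> simplex K s) ->
  (forall t, exists2 s, F s & supp (p t) `<=` s /\ supp (q t) `<=` s) ->
  continuous p -> continuous q ->
  continuous (fun z : R * R => mix (p z.1) (q z.1) (clamp z.2)).
Proof.
move=> finF KF Fpq cp cq; apply: (realization_continuous finF KF) => [z|v].
  have [s Fs [ps qs]] := Fpq z.1; exists s => //.
  by apply: supp_mix; [exact: KF|done|done|exact: clamp_itv].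
rewrite (_ : (fun _ => _) = fun z : R * R => (1 - clamp z.2) * p z.1 v + clamp z.2 * q z.1 v).
  have cc : continuous (fun z : R * R => clamp z.2).
    by apply: cont_comp; [exact: clamp_continuous|exact: cont_snd].
  have cb (f : R -> pt) : continuous f -> continuous (fun z : R * R => f z.1 v).
    move=> cf; apply: (@cont_comp _ _ _ (fun z : R * R => f z.1) (fun x : pt => x v));
      first exact: bary_continuous.
    by apply: cont_comp => //; exact: cont_fst.
  by apply: (@contD R _ R^o); apply: contM => //; [exact: contB1|exact: cb|exact: cb].
apply/funext => z; have [s Fs [ps qs]] := Fpq z.1.
by apply: (mixE _ (KF s Fs)) => //; exact: clamp_itv.
Qed.

Definition seg x y t := mix x y (clamp t).

Lemma seg0 x y : seg x y 0 = x. Proof. by rewrite /seg clamp0 mix0. Qed.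

Lemma seg1 x y s : simplex K s -> supp x `<=` s -> supp y `<=` s -> seg x y 1 = y.
Proof. by rewrite /seg clamp1; exact: mix1. Qed.

Lemma supp_seg x y s t : simplex K s -> supp x `<=` s -> supp y `<=` s ->
  supp (seg x y t) `<=` s.
Proof. by move=> Ks xs ys; apply: supp_mix => //; exact: clamp_itv. Qed.

Lemma seg_continuous x y s : simplex K s -> supp x `<=` s -> supp y `<=` s ->
  continuous (seg x y).
Proof.
move=> Ks xs ys.
have := @mix_homot (fun=> x) (fun=> y) [set s]
  (finite_set1 s) _ _ (@cont_cst _ _ _) (@cont_cst _ _ _).
move=> h; apply: (@cont_comp _ _ _ (fun t : R => (0, t)) _ (h _ _)) => [s' ->//|t|].
  by exists s.
by apply: cont_pair; [exact: cont_cst|exact: cont_id].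
Qed.

Lemma simplex_homot (p q : R -> pt) s : simplex K s -> continuous p -> continuous q ->
  (forall t, supp (p t) `<=` s) -> (forall t, supp (q t) `<=` s) ->
  p 0 = q 0 -> p 1 = q 1 -> homot p q.
Proof.
move=> Ks cp cq ps qs e0 e1.
exists (fun z : R * R => mix (p z.1) (q z.1) (clamp z.2)); split=> /= [|t|t|t].
- apply: (@mix_homot _ _ [set s]) => //; first by move=> s' ->.
  by move=> t; exists s.
- by rewrite clamp0 mix0.
- by rewrite clamp1 (mix1 Ks).
- by rewrite -e0 -e1 !mixxx.
Qed.

(* The straight-line homotopy to the vertex v is defined on the open star of v. *)
Lemma star_homot (p : R -> pt) v : continuous p -> (forall t, p t = p (clamp t)) ->
  (forall t, p t v != 0) ->
  homot p (pcat (seg (p 0) (vtx v)) (pcat (fun=> vtx v) (pflip (seg (p 1) (vtx v))))).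
Proof.
move=> cp pclamp pv; pose H (z : R * R) := mix (p z.1) (vtx v) (clamp z.2).
have sv t : supp (vtx v) `<=` supp (p t) by apply: supp_vtx; exact: pv.
have Ks t : simplex K (supp (p t)) by exact: bary_supp.
have cH : continuous H.
  apply: (@mix_homot p (fun=> vtx v) _ (compact_supports cp)) => //.
  - by move=> s [t _ <-].
  - move=> t; exists (supp (p (clamp t))); last by rewrite -pclamp; split=> //; exact: sv.
    by exists (clamp t) => //; rewrite /= in_itv /=; exact: clamp_itv.
  - exact: cont_cst.
pose a t : R * R := (t, 0).
pose b := pcat (fun t : R => (0 : R, t)) (pcat (fun t : R => (t, 1 : R)) (fun t : R => (1 : R,
  1 - t))).
have ca : continuous a by apply: cont_pair; [exact: cont_id|exact: cont_cst].
have cb : continuous b.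
  apply: pcat_continuous; first by apply: cont_pair; [exact: cont_cst|exact: cont_id].
    apply: pcat_continuous; first by apply: cont_pair; [exact: cont_id|exact: cont_cst].
      by apply: cont_pair; [exact: cont_cst|apply: contB1; exact: cont_id].
    by rewrite subr0.
  by rewrite pcat0.
have : homot (H \o a) (H \o b).
  apply: homot_convex => //; first by rewrite /b pcat0.
  by rewrite /b !pcat1 subrr.
congr homot; apply/funext => t /=; first by rewrite /H /= clamp0 mix0.
rewrite /b /pcat /pflip /seg /H; case: ifP => //= _; case: ifP => //= _.
by rewrite clamp1; apply: (mix1 (Ks (2 * (2 * t - 1)))) => //; exact: sv.
Qed.

Lemma supp_neq0 x : supp x !=set0.
Proof. exact: simplex_neq0 (bary_supp x). Qed.

Definition joined x y := exists p : R -> pt, [/\ continuous p, p 0 = x & p 1 = y].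

Lemma joined_sym x y : joined x y -> joined y x.
Proof.
by case=> p [cp p0 p1]; exists (pflip p); rewrite pflip0 pflip1; split=> //;
  exact: pflip_continuous.
Qed.

Lemma joined_trans x y z : joined x y -> joined y z -> joined x z.
Proof.
move=> [p [cp p0 p1]] [q [cq q0 q1]]; exists (pcat p q); rewrite pcat0 pcat1.
by split=> //; apply: pcat_continuous => //; rewrite p1.
Qed.

Lemma joined_seg x y s : simplex K s -> supp x `<=` s -> supp y `<=` s -> joined x y.
Proof.
move=> Ks xs ys; exists (seg x y).
by split; [exact: seg_continuous Ks xs ys|exact: seg0|exact: seg1 Ks xs ys].
Qed.

Lemma all_joined :
  (forall v w, clos_refl_trans _ (fun v w => simplex K [set v; w]) v w) ->
  forall x y, joined x y.
Proof.
move=> conn x y; have [[v xv] [w yw]] := (supp_neq0 x, supp_neq0 y).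
have star u t : supp u t -> joined u (vtx t).
  by move=> ut; apply: (joined_seg (bary_supp u)) => //; exact: supp_vtx.
apply: joined_trans (star _ _ xv) _; apply: joined_trans (joined_sym (star _ _ yw)).
elim: (conn v w) => {v w xv yw} [v w Kvw|v|v w u _ h _ h'].
- by apply: (joined_seg Kvw); apply: supp_vtx; [left|right].
- by apply: (joined_seg (simplex1 K v)); exact: supp_vtx.
- exact: joined_trans h h'.
Qed.

(** * Transport of a potential along paths of the realization *)

Section Potential.
Variables (Pi : groupType) (D : (R -> pt) -> Pi).
Hypothesis Dcat : forall p q, continuous p -> continuous q -> p 1 = q 0 ->
  D (pcat p q) = (D p * D q)%g.
Hypothesis Dhomot : forall p q, continuous p -> homot p q -> D p = D q.

Lemma D_cst x : D (fun=> x) = 1%g.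
Proof.
have cx : continuous (fun _ : R => x) by exact: cont_cst.
have e : pcat (fun _ : R => x) (fun _ : R => x) = (fun _ : R => x).
  by apply: funext => t; rewrite /pcat if_same.
by apply: (mulgI (D (fun=> x))); rewrite -Dcat // e mulg1.
Qed.

Lemma D_flip p : continuous p -> D (pflip p) = (D p)^-1%g.
Proof.
move=> cp; have cp' := pflip_continuous cp.
apply: (mulgI (D p)); rewrite -Dcat ?pflip0 // mulgV -(D_cst (p 0)).
apply: Dhomot; last exact: pcat_revr.
by apply: pcat_continuous; rewrite ?pflip0.
Qed.

Lemma D_seg x y z s : simplex K s -> supp x `<=` s -> supp y `<=` s -> supp z `<=` s ->
  (D (seg x y) * D (seg y z))%g = D (seg x z).
Proof.
move=> Ks xs ys zs.
have [cxy cyz cxz] := And3 (seg_continuous Ks xs ys) (seg_continuous Ks ys zs) (seg_continuous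
  Ks xs zs).
have e1 : seg x y 1 = seg y z 0 by rewrite (seg1 Ks) // seg0.
have cc := pcat_continuous cxy cyz e1.
rewrite -Dcat //; apply: Dhomot => //; apply: (simplex_homot Ks) => //.
- by move=> t; rewrite /pcat; case: ifP => _; exact: supp_seg.
- by move=> t; exact: supp_seg.
- by rewrite pcat0 !seg0.
- by rewrite pcat1 !(seg1 Ks).
Qed.

Variable phi : V -> Pi.
Hypothesis phiP : forall v w, simplex K [set v; w] ->
  (phi v * D (seg (vtx v) (vtx w)))%g = phi w.

(** [phi] is transported along the segment between [x] and one vertex of its support. Two such
    vertices span an edge in the closed simplex of [x], so [D_seg] and [phiP] make the choice
    immaterial. *)
Lemma psi_ex : exists psi : pt -> Pi, forall x v, supp x v ->
  (psi x * D (seg x (vtx v)))%g = phi v.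
Proof.
have /choice[vx vxP] := supp_neq0.
exists (fun x => phi (vx x) * (D (seg x (vtx (vx x))))^-1)%g => x v xv.
have Kx := bary_supp x; have sv u : supp x u -> supp (vtx u) `<=` supp x := @supp_vtx u _.
rewrite -(@D_seg x (vtx (vx x)) (vtx v) (supp x)) //; try exact: sv.
rewrite mulgA mulgVK; apply: phiP; apply: simplex_sub Kx _ _.
  by move=> u [->|->] //; exact: vxP.
by exists v; right.
Qed.

Definition subpath (p : R -> pt) (a b : R) t := p (a + (b - a) * clamp t).

Lemma subpath_affine_continuous (a b : R) : continuous (fun t => a + (b - a) * clamp t).
Proof.
apply: (@contD R _ R^o); first exact: cont_cst.
by apply: contM; [exact: cont_cst|exact: clamp_continuous].
Qed.

Lemma subpath_continuous p a b : continuous p -> continuous (subpath p a b).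
Proof. by move=> cp; apply: cont_comp => //; exact: subpath_affine_continuous. Qed.

Lemma subpath0 p a b : subpath p a b 0 = p a.
Proof. by rewrite /subpath clamp0 mulr0 addr0. Qed.

Lemma subpath1 p a b : subpath p a b 1 = p b.
Proof. by rewrite /subpath clamp1 mulr1 subrKC. Qed.

Lemma D_subpath p a b c : continuous p ->
  D (subpath p a c) = (D (subpath p a b) * D (subpath p b c))%g.
Proof.
move=> cp; pose f a b t : R := a + (b - a) * clamp t.
have f0 (u v : R) : f u v 0 = u by rewrite /f clamp0 mulr0 addr0.
have f1 (u v : R) : f u v 1 = v by rewrite /f clamp1 mulr1 subrKC.
have cf (u v : R) : continuous (f u v) by exact: subpath_affine_continuous.
rewrite -Dcat; [|exact: subpath_continuous..|by rewrite subpath0 subpath1].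
apply: Dhomot; first exact: subpath_continuous.
have -> : pcat (subpath p a b) (subpath p b c) = p \o pcat (f a b) (f b c).
  by apply/funext => t; rewrite /pcat /=; case: ifP.
apply: (homot_reparam cp (cf a c)); rewrite ?pcat0 ?pcat1 ?f0 ?f1 //.
by apply: pcat_continuous => //; rewrite f0 f1.
Qed.

(** [P] is transitive, and it holds between nearby parameters: there [p] stays in the open star of a
    vertex [v], and [star_homot] deforms it into two segments through [v]. The parameters related to
    [0] thus form a nonempty open and closed subset of the line. *)
Lemma psi_path psi p : (forall x v, supp x v -> (psi x * D (seg x (vtx v)))%g = phi v) ->
  continuous p -> (psi (p 0) * D (subpath p 0 1))%g = psi (p 1).
Proof.
move=> psiP cp; pose P a b := (psi (p a) * D (subpath p a b))%g = psi (p b).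
have Ptrans a b c : P a b -> P b c -> P a c.
  by rewrite /P (@D_subpath p a b c) // mulgA => -> ->.
have Plocal t : exists2 e, 0 < e & forall a b, `|t - a| < e -> `|t - b| < e -> P a b.
  have [v tv] := supp_neq0 (p t).
  have nt : nbhs t [set a | p a v != 0].
    have : nbhs (p t v) [set r : R | r != 0].
      by apply: open_nbhs_nbhs; split; [exact: open_neq|exact: tv].
    have cpv : continuous (fun t => p t v).
      by apply: (@cont_comp _ _ _ p (fun x => x v)) => //; exact: bary_continuous.
    exact: (cpv t).
  have [e /= e0 eP] := (nbhs_ballP t _).1 nt; exists e => // a b ta tb; rewrite /P.
  have qv t' : subpath p a b t' v != 0.
    apply: (eP (a + (b - a) * clamp t')); rewrite /ball /=.
    have /andP[c0 c1] := clamp_itv t'; set c := clamp t' in c0 c1 *.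
    (* A convex combination of two parameters within distance [e] of [t] is again within distance
       [e]; positivity is needed for both bounds. *)
    have conv (r r' : R) : 0 < r -> 0 < r' -> 0 < (1 - c) * r + c * r'.
      by move=> r0 r0'; case: (leP (2 * c) 1) => ?; nra.
    move: ta tb; rewrite !ltr_norml => /andP[? ?] /andP[? ?].
    have := conv (t - a + e) (t - b + e); have := conv (e - (t - a)) (e - (t - b)).
    by move=> h1 h2; apply/andP; split; [have := h2 _ _|have := h1 _ _]; lra.
  have cq := @subpath_continuous p a b cp.
  have := star_homot cq _ qv; rewrite subpath0 subpath1 => /(_ _)/Dhomot ->//; last first.
    by move=> t'; rewrite /subpath (clampE (clamp_itv t')).
  have pv c : c = 0 \/ c = 1 -> supp (subpath p a b c) v by move=> _; exact: qv.
  have av : supp (p a) v by rewrite -(subpath0 p a b); exact: qv.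
  have bv : supp (p b) v by rewrite -(subpath1 p a b); exact: qv.
  have ca := seg_continuous (bary_supp (p a)) (@subset_refl _ _) (supp_vtx av).
  have cb := seg_continuous (bary_supp (p b)) (@subset_refl _ _) (supp_vtx bv).
  have sa := seg1 (bary_supp (p a)) (@subset_refl _ _) (supp_vtx av).
  have sb := seg1 (bary_supp (p b)) (@subset_refl _ _) (supp_vtx bv).
  have cf := pflip_continuous cb; have cv : continuous (fun _ : R => vtx v) by exact: cont_cst.
  have ccf : continuous (pcat (fun=> vtx v) (pflip (seg (p b) (vtx v)))).
    by apply: pcat_continuous; rewrite ?pflip0.
  rewrite !Dcat ?pcat0 ?pflip0 // D_cst mul1g D_flip // mulgA psiP //.
  by rewrite -(psiP (p b) v bv) mulgK.
have P0 : P 0 0 by have [e e0 h] := Plocal 0; apply: h; rewrite subrr normr0.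
suff /seteqP[_ /(_ 1 I)] : [set b | P 0 b] = setT by [].
have /connected_intervalP cT : is_interval [set: R] by [].
apply: cT; first by exists 0.
- exists [set b | P 0 b]; rewrite ?setTI // openE => b /= Pb.
  have [e e0 h] := Plocal b; apply/nbhs_ballP; exists e => //= c bc.
  by apply: Ptrans Pb _; apply: h => //; rewrite subrr normr0.
- exists [set b | P 0 b]; rewrite ?setTI // -openC openE => b /= Pb.
  have [e e0 h] := Plocal b; apply/nbhs_ballP; exists e => //= c bc Pc.
  by apply: Pb; apply: Ptrans Pc _; apply: h => //; rewrite subrr normr0.
Qed.

End Potential.

Theorem realization_simply_connected (v0 : V) :
  (forall v w, clos_refl_trans _ (fun v w => simplex K [set v; w]) v w) ->
  (forall (Pi : groupType) (e : V -> V -> Pi),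
    (forall u v w, simplex K [set u; v; w] -> e u v * e v w = e u w)%g ->
    exists phi : V -> Pi, forall v w, simplex K [set v; w] -> phi v * e v w = phi w)%g ->
  simply_connected R pt.
Proof.
move=> conn pot; have join := all_joined conn; split.
  split; first by exists (vtx v0).
  move=> x y; have [p [cp p0 p1]] := join x y; exists p; split=> //.
  exact: continuous_subspaceT.
(* The given loop is continuous on the unit interval only; [q] extends it to the line by
   constants. *)
move=> p cp p01; pose q t := p (clamp t).
have [q0 q1] : q 0 = p 0 /\ q 1 = p 1 by rewrite /q clamp0 clamp1.
have cq : continuous q.
  move/subspace_continuousP: cp => cp t U Ut.
  have It : [set` `[0, 1]] (clamp t) by rewrite /= in_itv /=; exact: clamp_itv.
  have nU : nbhs (clamp t) [set t' | [set` `[0, 1]] t' -> U (p t')] := cp _ It U Ut.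
  have : nbhs t (@clamp R @^-1` [set t' | [set` `[0, 1]] t' -> U (p t')]).
    exact: (@clamp_continuous R t).
  by apply: filterS => t' /=; apply; rewrite in_itv /=; exact: clamp_itv.
have [Pi [D [Dcat Dhomot D1]]] := fundamental_functor (join (vtx v0)).
have [|phi phiP] := pot Pi (fun v w => D (seg (vtx v) (vtx w))).
  move=> u v w Kuvw; apply: (D_seg Dcat Dhomot Kuvw); apply: supp_vtx.
  - by left; left.
  - by left; right.
  - by right.
have [psi psiP] := psi_ex Dcat Dhomot phiP.
have qE : subpath q 0 1 = q.
  by apply/funext => t; rewrite /subpath subr0 add0r mul1r /q (clampE (clamp_itv t)).
(* As [q] is closed, [psi] takes the same value at both ends, so [D q] is trivial and [D1] contracts
   the loop. *)
have := psi_path Dcat Dhomot psiP cq; rewrite qE q0 q1 -p01 => /(canRL (mulKg _)).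
rewrite mulVg => /(D1 q cq); rewrite q0 q1 => /(_ p01) [h [ch h0 h1 he]].
exists h; split=> [|t t01|t _|s _].
- exact: continuous_subspaceT.
- by rewrite h0 /q clampE.
- by rewrite h1.
- by case: (he s) => -> ->; rewrite q0 q1 p01.
Qed.

End RealizationTopology.

Lemma adjeq_simplex (G : groupType) (n : nat) (Gs : 'I_n -> set G) (c d : Cvertex Gs) :
  adjeq c d <-> simplex (Ccomplex Gs) [set c; d]%classic.
Proof.
split=> [cd|[_ _ h]].
  split; first by exists c; left.
    by exists c, d, d => x [->|->]; [left; left|right].
  move=> x y; case: cd => [->|cd]; first by case=> -> [] -> /(_ erefl).
  by case=> -> [] -> // _; exact: CadjC.
have [->|/eqP ne] := eqVneq c d; first by left.
by right; apply: h => //; [left|right].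
Qed.

Theorem corollary6p3p3 (R : realType) (G : groupType) (n : nat)
    (Gs : 'I_n -> set G) (hn : (5 <= n)%N)
    (hG : is_free_product Gs)
    (hnt : forall i : 'I_n, Gs i <> [set 1%g]%classic) :
  simply_connected R (realization R (Ccomplex Gs)).
Proof.
have [L0 E0] := lab0_ex hG.
apply: (@realization_simply_connected _ _ _ (Vx (alphaT n) L0)).
  move=> c d; elim: (adjeq_connected hG hnt hn E0 c d) => {c d} [c d /adjeq_simplex|c|c d f _ h
    _ h'].
  - exact: rt_step.
  - exact: rt_refl.
  - exact: rt_trans h h'.
move=> Pi e eP; have eT x y z : adjeq x y -> adjeq y z -> adjeq x z -> (e x y * e y z = e x z)%g.
  move=> xy yz xz; apply: eP; split; first by exists x; left; left.
    by exists x, y, z.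
  move=> c d sc sd cd; suff [] : adjeq c d by [].
  by case: sc => [[]|] ->; case: sd => [[]|] ->; first [exact: adjeq_refl|done|exact: adjeq_sym].
have [phi phiP] := potential_ex eT hG hnt hn E0.
exists phi => x y /adjeq_simplex[->|]; last exact: phiP.
(* Degenerate edge: the cocycle identity on a repeated vertex makes [e y y] trivial. *)
have /(mulgI (e y y)) -> : (e y y * e y y = e y y * 1)%g by rewrite mulg1; apply: eT; left.
by rewrite mulg1.
Qed.
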